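(* Let $L,g\in C^1([a,b]\times\mathbb{R}^2;\mathbb{R})$, let $\phi:[a,b]\times\mathbb{R}\to\mathbb{R}$ be of class $C^1$, let $\psi:[a,b]\to\mathbb{R}$ be differentiable, and let $x_a\in\mathbb{R}$ be fixed. Suppose that $(x,T)\in D$ gives a local minimum for the functional $$\mathcal{J}(x,T)=\int_a^T L[x]_\gamma^{\alpha,\beta}(t)\,dt+\phi(T,x(T))$$ on $D$ subject to the boundary condition $x(a)=x_a$ and the isoperimetric constraint $$\int_a^T g[x]_\gamma^{\alpha,\beta}(t)\,dt=\psi(T)$$ (the terminal time $T$ and the terminal state $x(T)$ being free). Suppose that at least one of the following two conditions is not verified: $$\partial_2 g[x]_\gamma^{\alpha,\beta}(t)+D_{\overline{\gamma},T}^{\beta(\cdot,\cdot),\alpha(\cdot,\cdot)}\partial_3 g[x]_\gamma^{\alpha,\beta}(t)=0,\quad t\in[a,T],$$ $$\gamma_2\left[{}_aD_t^{\beta(\cdot,\cdot)}\partial_3 g[x]_\gamma^{\alpha,\beta}(t)-{}_TD_t^{\beta(\cdot,\cdot)}\partial_3 g[x]_\gamma^{\alpha,\beta}(t)\right]=0,\quad t\in[T,b].$$ Then there exists a constant $\lambda\in\mathbb{R}$ such that, with $F:[a,b]\times\mathbb{R}^2\to\mathbb{R}$ defined by $F=L-\lambda g$, $(x,T)$ satisfies the fractional Euler--Lagrange equations $$\partial_2 F[x]_\gamma^{\alpha,\beta}(t)+D_{\overline{\gamma},T}^{\beta(\cdot,\cdot),\alpha(\cdot,\cdot)}\partial_3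 F[x]_\gamma^{\alpha,\beta}(t)=0\quad\text{on }[a,T],$$ $$\gamma_2\left({}_aD_t^{\beta(\cdot,\cdot)}\partial_3 F[x]_\gamma^{\alpha,\beta}(t)-{}_TD_t^{\beta(\cdot,\cdot)}\partial_3 F[x]_\gamma^{\alpha,\beta}(t)\right)=0\quad\text{on }[T,b].$$ Moreover, $(x,T)$ satisfies the transversality conditions $$\begin{cases}F[x]_\gamma^{\alpha,\beta}(T)+\partial_1\phi(T,x(T))+\partial_2\phi(T,x(T))x'(T)+\lambda\psi'(T)=0,\\ \left[\gamma_1\,{}_tI_T^{1-\alpha(\cdot,\cdot)}\partial_3F[x]_\gamma^{\alpha,\beta}(t)-\gamma_2\,{}_TI_t^{1-\beta(\cdot,\cdot)}\partial_3F[x]_\gamma^{\alpha,\beta}(t)\right]_{t=T}+\partial_2\phi(T,x(T))=0,\\ \gamma_2\left[{}_TI_t^{1-\beta(\cdot,\cdot)}\partial_3F[x]_\gamma^{\alpha,\beta}(t)-{}_aI_t^{1-\beta(\cdot,\cdot)}\partial_3F[x]_\gamma^{\alpha,\beta}(t)\right]_{t=b}=0.\end{cases}$$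
   Context: Let $a<b$ be reals. The fractional orders $\alpha,\beta:[a,b]^2\to(0,1)$ are continuous, and $\gamma=(\gamma_1,\gamma_2)\in[0,1]^2$ is a constant vector. Fractional operators. For an order $\alpha$ (and likewise for $\beta$), and base points $p,q\in[a,b]$ (here $p\in\{a,T\}$, $q\in\{T,b\}$), the left and right Riemann--Liouville derivatives are $${}_pD_t^{\alpha(\cdot,\cdot)}y(t)=\frac{d}{dt}\int_p^t\frac{(t-\tau)^{-\alpha(t,\tau)}}{\Gamma(1-\alpha(t,\tau))}y(\tau)\,d\tau,\qquad {}_tD_q^{\alpha(\cdot,\cdot)}y(t)=\frac{d}{dt}\int_t^q\frac{-(\tau-t)^{-\alpha(\tau,t)}}{\Gamma(1-\alpha(\tau,t))}y(\tau)\,d\tau;$$ the left and right Caputo derivatives are $${}^C_aD_t^{\alpha(\cdot,\cdot)}x(t)=\int_a^t\frac{(t-\tau)^{-\alpha(t,\tau)}}{\Gamma(1-\alpha(t,\tau))}x'(\tau)\,d\tau,\qquad {}^C_tD_b^{\alpha(\cdot,\cdot)}x(t)=\int_t^b\frac{-(\tau-t)^{-\alpha(\tau,t)}}{\Gamma(1-\alpha(\tau,t))}x'(\tau)\,d\tau;$$ the left and right Riemann--Liouville integrals are $${}_pI_t^{\alpha(\cdot,\cdot)}y(t)=\int_p^t\frac{(t-\tau)^{\alpha(t,\tau)-1}}{\Gamma(\alpha(t,\tau))}y(\tau)\,d\tau,\qquad {}_tI_q^{\alpha(\cdot,\cdot)}y(t)=\int_t^q\frac{(\tau-t)^{\alpha(\tau,t)-1}}{\Gamma(\alpha(\tau,t))}y(\tau)\,d\tau,$$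 and the order $1-\alpha(\cdot,\cdot)$ means the function $1-\alpha$. The combined Caputo derivative is ${}^CD_\gamma^{\alpha(\cdot,\cdot),\beta(\cdot,\cdot)}x(t)=\gamma_1\,{}^C_aD_t^{\alpha(\cdot,\cdot)}x(t)+\gamma_2\,{}^C_tD_b^{\beta(\cdot,\cdot)}x(t)$. The dual derivative is $D_{\overline{\gamma},c}^{\beta(\cdot,\cdot),\alpha(\cdot,\cdot)}=\gamma_2\,{}_aD_t^{\beta(\cdot,\cdot)}+\gamma_1\,{}_tD_c^{\alpha(\cdot,\cdot)}$, where $\overline{\gamma}=(\gamma_2,\gamma_1)$ and $c\in(a,b]$. Notation: $[x]_\gamma^{\alpha,\beta}(t)=(t,x(t),{}^CD_\gamma^{\alpha(\cdot,\cdot),\beta(\cdot,\cdot)}x(t))$; for a function $z$ of several real variables, $z[x]_\gamma^{\alpha,\beta}(t)$ means $z([x]_\gamma^{\alpha,\beta}(t))$, and $\partial_i z$ is the partial derivative with respect to the $i$th argument. In expressions such as $D\,\partial_3 g[x]_\gamma^{\alpha,\beta}(t)$ the operator $D$ is applied to the function $t\mapsto\partial_3 g([x]_\gamma^{\alpha,\beta}(t))$. The set $D=\{(x,t)\in C^1([a,b])\times[a,b]: {}^CD_\gamma^{\alpha(\cdot,\cdot),\beta(\cdot,\cdot)}x(t)\text{ exists and is continuous on }[a,b]\}$ is endowed with the norm $\|(x,t)\|=\max_{a\le t\le b}|x(t)|+\max_{a\le t\le b}|{}^CD_\gamma^{\alpha(\cdot,\cdot),\beta(\cdot,\cdot)}x(t)|+|t|$.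 A local minimum of $\mathcal{J}$ subject to constraints is an element $(x,T)\in D$ satisfying the constraints such that, for some $\delta>0$, $\mathcal{J}(x,T)\le\mathcal{J}(\tilde x,\tilde T)$ for every $(\tilde x,\tilde T)\in D$ satisfying the constraints with $\|(\tilde x-x,\tilde T-T)\|<\delta$.
   Formalization: The terminal time is assumed interior, a<T<b (at T=b the first transversality condition can fail), and in the Euler-Lagrange equations d/dt acts on the whole combination of fractional integrals, since the separate Riemann-Liouville derivatives need not exist. *)

(* Defs.v *)
From HB Require Import structures.
From mathcomp Require Import all_boot all_order all_algebra.
From mathcomp Require Import all_classical all_reals all_analysis.
From mathcomp Require Import ring.

Set Implicit Arguments.
Unset Strict Implicit.
Unset Printing Implicit Defensive.

Import Order.TTheory GRing.Theory Num.Theory.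
Import numFieldNormedType.Exports.

Local Open Scope classical_set_scope.
Local Open Scope ring_scope.

Section Defs.
Context {R : realType}.
Implicit Types (A : set R) (a b c p q t T xa : R) (f x y psi : R -> R).
Implicit Types (alpha beta phi : R -> R -> R) (gam : R * R).
Implicit Types (z L g : R -> R -> R -> R).

Notation mu := (@lebesgue_measure R).

(* Derivatives of functions that live on an interval A (one-sided at its end
   points). The quotient is restricted to points of A other than t, so values
   of f outside A play no role. [deriv_in] is meaningful under [derivable_in]. *)
Definition derivable_in A f t : Prop :=
  cvg ((fun s => (f s - f t) / (s - t)) @ within A t^').

Definition deriv_in A f t : R :=
  lim ((fun s => (f s - f t) / (s - t)) @ within A t^').

Definition C1_on a b x : Prop :=
  (forall t, t \in `[a, b] -> derivable_in `[a, b] x t) /\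
  {within `[a, b], continuous (deriv_in `[a, b] x)}.

(* Partial derivatives; the first argument ranges over [a, b] only. *)
Definition partial1 a b z : R -> R -> R -> R :=
  fun t u v => deriv_in `[a, b] (fun s => z s u v) t.
Definition partial2 z : R -> R -> R -> R :=
  fun t u v => derive1 (fun w => z t w v) u.
Definition partial3 z : R -> R -> R -> R :=
  fun t u v => derive1 (fun w => z t u w) v.

Definition C1_3 a b z : Prop :=
  let dom := [set w : R * R * R | w.1.1 \in `[a, b]] in
  [/\ forall t u v, t \in `[a, b] ->
        [/\ derivable_in `[a, b] (fun s => z s u v) t,
            derivable (fun w => z t w v) u 1 &
            derivable (fun w => z t u w) v 1],
      {within dom, continuous (fun w => partial1 a b z w.1.1 w.1.2 w.2)},
      {within dom, continuous (fun w => partial2 z w.1.1 w.1.2 w.2)} &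
      {within dom, continuous (fun w => partial3 z w.1.1 w.1.2 w.2)}].

Definition dphi1 a b phi : R -> R -> R :=
  fun t u => deriv_in `[a, b] (fun s => phi s u) t.
Definition dphi2 phi : R -> R -> R := fun t u => derive1 (fun w => phi t w) u.

Definition C1_2 a b phi : Prop :=
  let dom := [set w : R * R | w.1 \in `[a, b]] in
  [/\ forall t u, t \in `[a, b] ->
        derivable_in `[a, b] (fun s => phi s u) t /\
        derivable (fun w => phi t w) u 1,
      {within dom, continuous (fun w => dphi1 a b phi w.1 w.2)} &
      {within dom, continuous (fun w => dphi2 phi w.1 w.2)}].

(* A continuous order [a, b]^2 -> (0, 1). *)
Definition frac_order a b alpha : Prop :=
  (forall t s, t \in `[a, b] -> s \in `[a, b] -> 0 < alpha t s < 1) /\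
  {within [set w : R * R | w.1 \in `[a, b] /\ w.2 \in `[a, b]],
    continuous (fun w => alpha w.1 w.2)}.

(* Euler's integral; only used at positive arguments. *)
Definition Gamma (r : R) : R :=
  \int[mu]_(s in `]0, +oo[) (s `^ (r - 1) * expR (- s)).

(* The common kernels of the Riemann-Liouville and Caputo derivatives. *)
Definition ker_left alpha t s : R :=
  (t - s) `^ (- alpha t s) / Gamma (1 - alpha t s).
Definition ker_right alpha t s : R :=
  - (s - t) `^ (- alpha s t) / Gamma (1 - alpha s t).

Definition kerint_left alpha p y t : R :=
  \int[mu]_(s in `[p, t]) (ker_left alpha t s * y s).
Definition kerint_right alpha q y t : R :=
  \int[mu]_(s in `[t, q]) (ker_right alpha t s * y s).

Definition RL_left_deriv A alpha p y t : R := deriv_in A (kerint_left alpha p y) t.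
Definition RL_right_deriv A alpha q y t : R := deriv_in A (kerint_right alpha q y) t.

Definition caputo_left a b alpha x t : R :=
  kerint_left alpha a (deriv_in `[a, b] x) t.
Definition caputo_right a b alpha x t : R :=
  kerint_right alpha b (deriv_in `[a, b] x) t.

Definition RL_left_int alpha p y t : R :=
  \int[mu]_(s in `[p, t]) ((t - s) `^ (alpha t s - 1) / Gamma (alpha t s) * y s).
Definition RL_right_int alpha q y t : R :=
  \int[mu]_(s in `[t, q]) ((s - t) `^ (alpha s t - 1) / Gamma (alpha s t) * y s).

Definition compl_order alpha : R -> R -> R := fun t s => 1 - alpha t s.

Definition combined_caputo a b alpha beta gam x t : R :=
  gam.1 * caputo_left a b alpha x t + gam.2 * caputo_right a b beta x t.

Definition combined_caputo_exists a b alpha beta x t : Prop :=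
  mu.-integrable `[a, t]
    (fun s => (ker_left alpha t s * deriv_in `[a, b] x s)%:E) /\
  mu.-integrable `[t, b]
    (fun s => (ker_right beta t s * deriv_in `[a, b] x s)%:E).

(* The fractional derivatives below are d/dt of a linear combination of
   fractional integrals, the sign "d/dt" being put in front of the whole
   combination. This agrees with the combination of the separate derivatives
   whenever these exist ([dual_derivE], [diff_derivE]). It also has a meaning
   where they do not: for y continuous with y(a) <> 0, the function
   [kerint_left beta a y] has an infinite slope at a, and likewise
   [kerint_right alpha c y] at c; for extremals, only the combination is
   differentiable up to the end points. *)

(* The dual derivative gbar_1 aD_t^beta y + gbar_2 tD_c^alpha y on [a, c]. *)
Definition dual_fun gam beta alpha a c y : R -> R :=
  fun t => gam.1 * kerint_left beta a y t + gam.2 * kerint_right alpha c y t.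
Definition dual_derivable gam beta alpha a c y t : Prop :=
  derivable_in `[a, c] (dual_fun gam beta alpha a c y) t.
Definition dual_deriv gam beta alpha a c y t : R :=
  deriv_in `[a, c] (dual_fun gam beta alpha a c y) t.

(* gam_2 (aD_t^beta y - TD_t^beta y) on [T, b]. *)
Definition diff_fun gam beta a T y : R -> R :=
  fun t => gam.2 * (kerint_left beta a y t - kerint_left beta T y t).
Definition diff_derivable gam beta a T b y t : Prop :=
  derivable_in `[T, b] (diff_fun gam beta a T y) t.
Definition diff_deriv gam beta a T b y t : R :=
  deriv_in `[T, b] (diff_fun gam beta a T y) t.

Definition along a b alpha beta gam x (z : R -> R -> R -> R) t : R :=
  z t (x t) (combined_caputo a b alpha beta gam x t).

Definition inD a b alpha beta gam x T : Prop :=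
  [/\ C1_on a b x,
      a <= T <= b,
      forall t, t \in `[a, b] -> combined_caputo_exists a b alpha beta x t &
      {within `[a, b], continuous (combined_caputo a b alpha beta gam x)}].

(* The suprema are maxima when (x, T) is a difference of elements of D. *)
Definition normD a b alpha beta gam x T : R :=
  sup [set `|x t| | t in `[a, b]] +
  sup [set `|combined_caputo a b alpha beta gam x t| | t in `[a, b]] +
  `|T|.

Definition functional a b alpha beta gam L phi x T : R :=
  \int[mu]_(t in `[a, T]) along a b alpha beta gam x L t + phi T (x T).

Definition admissible a b alpha beta gam g psi xa x T : Prop :=
  [/\ inD a b alpha beta gam x T,
      x a = xa &
      \int[mu]_(t in `[a, T]) along a b alpha beta gam x g t = psi T].

Definition local_min a b alpha beta gam L phi g psi xa x T : Prop :=
  admissible a b alpha beta gam g psi xa x T /\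
  exists2 delta : R, 0 < delta &
    forall x' T', admissible a b alpha beta gam g psi xa x' T' ->
      normD a b alpha beta gam (x' \- x) (T' - T) < delta ->
      functional a b alpha beta gam L phi x T <=
      functional a b alpha beta gam L phi x' T'.

Definition EL_left a b alpha beta gam x T z : Prop :=
  forall t, t \in `[a, T] ->
    let y := along a b alpha beta gam x (partial3 z) in
    let gbar := (gam.2, gam.1) in
    dual_derivable gbar beta alpha a T y t /\
    along a b alpha beta gam x (partial2 z) t +
      dual_deriv gbar beta alpha a T y t = 0.

Definition EL_right a b alpha beta gam x T z : Prop :=
  forall t, t \in `[T, b] ->
    let y := along a b alpha beta gam x (partial3 z) in
    diff_derivable gam beta a T b y t /\ diff_deriv gam beta a T b y t = 0.

Lemma within_itv_dnbhs_proper p q t : p < q -> t \in `[p, q] ->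
  ProperFilter (within `[p, q] t^').
Proof.
move=> pq; rewrite in_itv /= => /andP[pt tq].
apply: Build_ProperFilter_ex => P; rewrite /within /dnbhs /= => nP.
have [tltq|qt] := ltP t q.
- have : \forall s \near t^'+, P s.
    near=> s; have ts : t < s by near: s; exact: nbhs_right_gt.
    have sq : s < q by near: s; exact: nbhs_right_lt.
    have : s != t -> s \in `[p, q] -> P s.
      by near: s; exact: (@cvg_within _ (nbhs t)).
    by apply; rewrite ?gt_eqF //= in_itv /= (le_trans pt (ltW ts)) ltW.
  by move=> H; exact: (@filter_ex _ _ (at_right_proper_filter t) _ H).
have pltt : p < t by exact: lt_le_trans qt.
have : \forall s \near t^'-, P s.
  near=> s; have st : s < t by near: s; exact: nbhs_left_lt.
  have ps : p < s by near: s; exact: nbhs_left_gt.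
  have : s != t -> s \in `[p, q] -> P s.
      by near: s; exact: (@cvg_within _ (nbhs t)).
  by apply; rewrite ?lt_eqF //= in_itv /= (le_trans (ltW st) tq) andbT ltW.
by move=> H; exact: (@filter_ex _ _ (at_left_proper_filter t) _ H).
Unshelve. all: by end_near. Qed.

Lemma deriv_in_comb p q t (k l : R) f h : p < q -> t \in `[p, q] ->
  derivable_in `[p, q] f t -> derivable_in `[p, q] h t ->
  derivable_in `[p, q] (fun s => k * f s + l * h s) t /\
  deriv_in `[p, q] (fun s => k * f s + l * h s) t =
    k * deriv_in `[p, q] f t + l * deriv_in `[p, q] h t.
Proof.
move=> pq tpq df dh; have PF := within_itv_dnbhs_proper pq tpq.
have H : (fun s => (k * f s + l * h s - (k * f t + l * h t)) / (s - t))
    @ within `[p, q] t^' -->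
    k * deriv_in `[p, q] f t + l * deriv_in `[p, q] h t.
  rewrite (_ : (fun s => _) = (fun s => k * ((f s - f t) / (s - t)) +
     l * ((h s - h t) / (s - t)))); last first.
    by apply/funext => s; rewrite !mulrA -mulrDl; congr (_ / _); ring.
  by apply: cvgD; apply: cvgMl_tmp.
by split; [apply/cvg_ex; eexists; exact: H|exact: cvg_lim H].
Qed.

Lemma dual_derivE gam beta alpha a c y t : a < c -> t \in `[a, c] ->
  derivable_in `[a, c] (kerint_left beta a y) t ->
  derivable_in `[a, c] (kerint_right alpha c y) t ->
  dual_derivable gam beta alpha a c y t /\
  dual_deriv gam beta alpha a c y t =
    gam.1 * RL_left_deriv `[a, c] beta a y t +
    gam.2 * RL_right_deriv `[a, c] alpha c y t.
Proof. exact: deriv_in_comb. Qed.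

Lemma diff_derivE gam beta a T b y t : T < b -> t \in `[T, b] ->
  derivable_in `[T, b] (kerint_left beta a y) t ->
  derivable_in `[T, b] (kerint_left beta T y) t ->
  diff_derivable gam beta a T b y t /\
  diff_deriv gam beta a T b y t =
    gam.2 * (RL_left_deriv `[T, b] beta a y t -
             RL_left_deriv `[T, b] beta T y t).
Proof.
move=> Tb tTb d1 d2; rewrite /diff_derivable /diff_deriv /RL_left_deriv.
rewrite mulrBr -mulNr.
have -> : diff_fun gam beta a T y = fun s =>
    gam.2 * kerint_left beta a y s + (- gam.2) * kerint_left beta T y s.
  by apply/funext => s; rewrite /diff_fun mulrBr mulNr.
exact: deriv_in_comb.
Qed.

End Defs.

(* Main.v *)
Require Import Defs.
From HB Require Import structures.
From mathcomp Require Import all_boot all_order all_algebra.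
From mathcomp Require Import all_classical all_reals all_analysis.
From mathcomp Require Import measurable_realfun.
From mathcomp Require Import ring lra.

Set Implicit Arguments.
Unset Strict Implicit.
Unset Printing Implicit Defensive.

Import Order.TTheory GRing.Theory Num.Theory.
Import numFieldNormedType.Exports.

Local Open Scope classical_set_scope.
Local Open Scope ring_scope.

(* The state is varied by e1 K1 + e2 K0, where K_i is the primitive, vanishing at a, of
   a continuous k_i, and the terminal time by e1 tau. The combined Caputo derivative
   of K_i is a weakly singular integral operator N applied to k_i, so the functional and
   the constraint are differentiable in (e1, e2) at the origin. By Fubini the first
   variation of int_a^T z in the direction k is int_a^b k E_z, where E_z applies the
   transposes of N and of the primitive operator to d_3 z and d_2 z along x, both cut
   off at T; weak singularity makes E_z continuous on [a, b].

   If the first variation of the constraint vanished for all k, then E_g = 0, which is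
   the integrated form of both Euler-Lagrange equations of g. Hence some k0 has nonzero
   variation, and the multiplier rule gives lambda, the same for all k and tau, such that
   int_a^b k E_F + d_2 phi int_a^T k = 0 for every k, together with the first
   transversality condition (from tau). So E_F equals -d_2 phi before T and 0 after T.
   As E_F is continuous at T, d_2 phi = 0 and E_F = 0 on all of [a, b]. On [a, T] this
   reads dual_fun(t) = int_t^T d_2 F, which is differentiated; on [T, b] it reads
   diff_fun = 0, which at t = b is the third transversality condition. *)

(** * Weakly singular integral operators *)

(** The obstacle is that y = d_3 z along x is merely continuous: the fractional integrals of y need
    not be differentiable up to the end points, so there is no classical integration by parts to
    rely on. The work is therefore done on k, the derivative of the variation, and on the integrated
    equation; differentiation comes last, once the combination of fractional integrals has been
    identified with the integral of a continuous function. The orders are continuous on a compact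
    square, hence bounded by a single A < 1, and every kernel is dominated by a multiple of
    [|t - s|^(-A) + 1]. This bound, with continuity off the diagonal, yields Fubini, uniform
    estimates and continuity. A one-parameter variation would leave the constraint. With k0 fixed,
    e2 restores it, and lambda = Q / B is the quotient of the variations of cost and constraint
    along k0, in which neither k1 nor tau occurs. The second transversality condition contains two
    integrals over the single point T, so it says exactly that d_2 phi = 0. *)

Section integral_bounds.
Context {R : realType}.
Notation mu := (@lebesgue_measure R).
Implicit Types (f F : R -> R) (a b p q s t A r : R).

Lemma integrable_bounded a b (D : set R) f M : measurable D ->
  D `<=` `[a, b] -> measurable_fun D f -> (forall s, D s -> `|f s| <= M) ->
  mu.-integrable D (EFin \o f).
Proof.
move=> mD Dab mf fM; apply: measurable_bounded_integrable => //.
  apply: (@le_lt_trans _ _ (mu `[a, b])); first by rewrite le_measure ?inE.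
  by rewrite lebesgue_measure_itv/=; case: ifP => _; rewrite ltry.
exists M; split; first exact: num_real.
by move=> N MN s Ds; exact: le_trans (fM s Ds) (ltW MN).
Qed.

Lemma ge0_integral_oo_le f F p q B : p < q ->
  (forall s, p < s < q -> 0 <= f s) ->
  {in `]p, q[, continuous f} ->
  (forall s, p < s < q -> is_derive s 1 F (f s)) ->
  (forall s, p < s < q -> `|F s| <= B) ->
  (\int[mu]_(s in `]p, q[) (f s)%:E <= (2 * B)%:E)%E.
Proof.
move=> pq f0 cf dF FB.
(* The denominator exceeds 2 from the start, so that [E 0] is already a nondegenerate interval. *)
pose d n := (q - p) / n.+3%:R.
have d0 n : 0 < d n by rewrite divr_gt0// subr_gt0.
have d2 n : p + d n < q - d n.
  have : d n * 2 < d n * n.+3%:R by rewrite ltr_pM2l// ltr_nat.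
  rewrite divfK ?pnatr_eq0//; lra.
pose E n : set R := `[p + d n, q - d n]%classic.
have EI n s : E n s -> p < s < q.
  rewrite /E /= in_itv/= => /andP[? ?]; have := d0 n; move=> ?; apply/andP; split; lra.
have -> : `]p, q[%classic = \bigcup_n E n.
  apply/seteqP; split => s /=; last by move=> [n _ /EI]; rewrite in_itv.
  rewrite in_itv/= => /andP[ps sq].
  pose m := Num.min (s - p) (q - s).
  have m0 : 0 < m by rewrite lt_min !subr_gt0 ps sq.
  have [n _ Hn] : exists2 n, True & (q - p) / n.+3%:R <= m.
    exists (Num.trunc ((q - p) / m)) => //.
    rewrite ler_pdivrMr// mulrC -ler_pdivrMr//.
    have /ltW := @truncnS_gt R ((q - p) / m).
    by move=> /le_trans; apply; rewrite ler_nat ltnW.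
  exists n => //; rewrite /E /= in_itv/=; move: Hn; rewrite -/(d n) le_min => /andP[? ?].
  by apply/andP; split; lra.
have ndE : nondecreasing_seq E.
  apply/nondecreasing_seqP => n; rewrite /E subsetEset.
  have : d n.+1 <= d n.
    by rewrite ler_pM2l ?subr_gt0// lef_pV2 ?posrE// ler_nat.
  by move=> ?; apply: subset_itv; rewrite bnd_simp; lra.
have cE n : {within E n, continuous f}.
  apply: continuous_in_subspaceT => s; rewrite inE => /EI spq.
  by apply: cf; rewrite in_itv.
have mE n : measurable (E n) by exact: measurable_itv.
have mf n : measurable_fun (E n) (EFin \o f).
  by apply/measurable_EFinP; exact: subspace_continuous_measurable_fun.
have cv := @ge0_nondecreasing_set_cvg_integral _ (measurableTypeR R) R E (EFin \o f) mu ndE mE mf.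
have {}cv := cv (fun i x Eix => f0 x (EI i x Eix)).
rewrite -(cvg_lim _ cv)//; apply: lime_le; first by apply/cvg_ex; eexists; exact: cv.
apply: nearW => n.
have Ep : p < p + d n < q by have := d0 n; have := d2 n; move=> ? ?; apply/andP; split; lra.
have Eq : p < q - d n < q by have := d0 n; have := d2 n; move=> ? ?; apply/andP; split; lra.
have dFc s : p < s < q -> {for s, continuous F}.
  move=> spq; apply/differentiable_continuous/derivable1_diffP.
  by have [] := dF s spq.
rewrite (@continuous_FTC2 _ f F)//=.
- rewrite -EFinB lee_fin.
  have := FB _ Ep; have := FB _ Eq; rewrite !ler_norml => /andP[? ?] /andP[? ?]; lra.
- exact: cE.
- split.
  + move=> s; rewrite in_itv/= => /andP[? ?].
    have spq : p < s < q by apply: (EI n); rewrite /E/= in_itv/= !ltW.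
    by have [] := dF s spq.
  + exact/cvg_at_right_filter/dFc.
  + exact/cvg_at_left_filter/dFc.
- move=> s; rewrite in_itv/= => /andP[? ?].
  have spq : p < s < q by apply: (EI n); rewrite /E/= in_itv/= !ltW.
  by rewrite derive1E; have [] := dF _ spq.
Qed.

Lemma cvg_powR (X : Type) (G : set_system X) (FG : Filter G) (f g : X -> R)
    (x r : R) :
  0 < x -> f @ G --> x -> g @ G --> r -> (fun i => f i `^ g i) @ G --> x `^ r.
Proof.
move=> x0 fx gr.
have -> : x `^ r = expR (r * ln x) by rewrite /powR gt_eqF.
apply: (@cvg_trans _ ((fun i => expR (g i * ln (f i))) @ G)).
  apply: near_eq_cvg; near=> i.
  have fi0 : 0 < f i by near: i; exact: cvgr_gt fx _ x0.
  by rewrite /powR gt_eqF.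
apply: continuous_cvg; first exact: continuous_expR.
by apply: cvgM => //; apply: continuous_cvg => //; exact: continuous_ln.
Unshelve. all: by end_near. Qed.

(** What matters is uniformity in [t]. The interval is cut at [t]; on each side the integrand has an
    antiderivative with values in [-B, B], which costs [2 * B] per side. *)
Lemma integral_abs_powR_le a b A : a < b -> 0 < A < 1 ->
  exists2 C, 0 <= C & forall t, a <= t <= b ->
    (\int[mu]_(s in `[a, b]) (`|t - s| `^ (- A))%:E <= C%:E)%E.
Proof.
move=> ab /andP[A0 A1].
have A1' : 0 < 1 - A by lra.
pose B := (b - a) `^ (1 - A) / (1 - A).
have B0 : 0 <= B by rewrite divr_ge0 ?powR_ge0// ltW.
have FB u : 0 < u <= b - a -> `|u `^ (1 - A) / (1 - A)| <= B.
  move=> /andP[u0 uba]; rewrite ger0_norm ?divr_ge0 ?powR_ge0 ?(ltW A1')//.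
  by rewrite ler_pM2r ?invr_gt0// ge0_ler_powR ?nnegrE; lra.
(* The sign [c] is 1 to the right of [t] and -1 to its left, so that one antiderivative serves both
   sides. *)
have dG t s (c : R) : `|c| = 1 -> 0 < c * (s - t) ->
    is_derive s 1 (fun u => c * ((c * (u - t)) `^ (1 - A) / (1 - A)))
      (`|t - s| `^ (- A)).
  move=> c1 cst0.
  have dl : is_derive s 1 (fun u => c * (u - t)) c.
    by apply: is_derive_eq; rewrite subr0 [LHS]mulr1.
  have dp := is_derive1_powR (1 - A) cst0.
  have dc := is_derive1_comp (f := @powR R ^~ (1 - A)) (g := fun u => c * (u - t)) dp dl. 
  have -> : (fun u => c * ((c * (u - t)) `^ (1 - A) / (1 - A))) =
      (c / (1 - A)) *: ((@powR R ^~ (1 - A)) \o (fun u => c * (u - t))).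
    apply/funext => u.
    by transitivity (c / (1 - A) * (c * (u - t)) `^ (1 - A)) => //; ring.
  apply: is_derive_eq.
  have -> : 1 - A - 1 = - A by ring.
  have -> : `|t - s| = c * (s - t).
    by rewrite -[RHS]gtr0_norm// normrM c1 mul1r distrC.
  have c2 : c * c = 1 by rewrite -expr2 -real_normK ?num_real// c1 expr1n.
  rewrite /GRing.scale/=.
  transitivity ((c * c) * (c * (s - t)) `^ (- A)); last by rewrite c2 mul1r.
  by field; rewrite gt_eqF.
have side t p q (c : R) : `|c| = 1 -> p < q -> (forall s, p < s < q -> 0 < c * (s - t) <= b - a) ->
    (\int[mu]_(s in `]p, q[) (`|t - s| `^ (- A))%:E <= (2 * B)%:E)%E.
  move=> c1 pq Hc.
  apply: (@ge0_integral_oo_le (fun s => `|t - s| `^ (- A))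
    (fun s => c * ((c * (s - t)) `^ (1 - A) / (1 - A)))) => //.
  - move=> s; rewrite in_itv/= => /Hc /andP[+ _]; rewrite lt_neqAle => /andP[+ _].
    rewrite eq_sym mulf_eq0 negb_or => /andP[_ st]; apply: cvg_powR.
    + by rewrite normr_gt0 subr_eq0 eq_sym -subr_eq0.
    + by apply: cvg_norm; apply: cvgB; [exact: cvg_cst|exact: cvg_id].
    + exact: cvg_cst.
  - by move=> s /Hc /andP[? _]; exact: dG.
  - by move=> s /Hc ?; rewrite normrM c1 mul1r FB.
exists (4 * B) => [|t /andP[a_t tb]]; first by rewrite mulr_ge0.
have mf D : measurable_fun D (fun s : measurableTypeR R => (`|t - s| `^ (- A))%:E).
  apply/measurable_EFinP/(measurableT_comp (measurable_powR _)).
  exact/measurableT_comp/measurable_funB.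
have left : (\int[mu]_(s in `[a, t]) (`|t - s| `^ (- A))%:E <= (2 * B)%:E)%E.
  move: a_t; rewrite le_eqVlt => /predU1P[<-|a_t].
    by rewrite set_itv1 integral_set1 lee_fin mulr_ge0.
  rewrite integral_itv_bndoo; last exact: mf.
  apply: (@side _ _ _ (-1)) => //.
    by rewrite normrN1.
  by move=> s /andP[? ?]; apply/andP; split; lra.
have right : (\int[mu]_(s in `]t, b]) (`|t - s| `^ (- A))%:E <= (2 * B)%:E)%E.
  move: tb; rewrite le_eqVlt => /predU1P[->|tb].
    by rewrite set_itvoc0 integral_set0 lee_fin mulr_ge0.
  rewrite integral_itv_bndoo; last exact: mf.
  apply: (@side _ _ _ 1) => //.
    by rewrite normr1.
  by move=> s /andP[? ?]; apply/andP; split; lra.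
have -> : `[a, b]%classic = `[a, t] `|` `]t, b].
  by rewrite -itv_bndbnd_setU// bnd_simp.
rewrite ge0_integral_setU//=.
- by rewrite (_ : 4 * B = 2 * B + 2 * B) ?EFinD ?leeD//; ring.
- apply/disj_setPS => s [/=]; rewrite !in_itv/= => /andP[_ ?] /andP[? _].
  lra.
Qed.

Lemma integrable_abs_powR a b A t : a < b -> 0 < A < 1 -> a <= t <= b ->
  mu.-integrable `[a, b] (fun s => (`|t - s| `^ (- A))%:E).
Proof.
move=> ab hA tab; have [C C0 HC] := integral_abs_powR_le ab hA.
apply/integrableP; split.
  apply/measurable_EFinP/(measurableT_comp (measurable_powR _)).
  exact/measurableT_comp/measurable_funB.
under eq_integral => s _ do rewrite gee0_abs ?lee_fin ?powR_ge0//.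
exact: le_lt_trans (HC t tab) (ltry _).
Qed.

(** A majorant of Euler's integrand for all exponents in [r, 1] at once: the power dominates near 0,
    the exponential density beyond 1. *)
Definition gamma_bound r s : R :=
  ((fun u => u `^ (r - 1)) \_ `]0, 1]) s + exponential_pdf 1 s.

Lemma gamma_integrand_le r r1 s : 0 < r1 -> r1 <= r <= 1 -> 0 < s ->
  `|s `^ (r - 1) * expR (- s)| <= gamma_bound r1 s.
Proof.
move=> r10 /andP[r1r r1'] s0; rewrite /gamma_bound ger0_norm; last first.
  by rewrite mulr_ge0 ?powR_ge0 ?expR_ge0.
rewrite exponential_pdfE ?(ltW s0)// mul1r mulN1r patchE.
have [s1|s1] := leP s 1.
  rewrite mem_set /= ?in_itv/= ?s0//.
  rewrite ler_wpDr ?expR_ge0// -[leRHS]mulr1 ler_pM ?powR_ge0 ?expR_ge0//.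
    by apply: ger_powR; rewrite ?s0//; lra.
  by rewrite -expR0 ler_expR; lra.
rewrite ifF ?add0r; last by apply/negP; rewrite inE/= in_itv/= s0 leNgt s1.
rewrite -[leRHS]mul1r ler_wpM2r ?expR_ge0//.
by rewrite -[leRHS](powRr0 s) ler_powR; lra.
Qed.

Lemma integrable_gamma_bound r : 0 < r < 1 ->
  mu.-integrable `]0, +oo[ (EFin \o gamma_bound r).
Proof.
move=> /andP[r0 r1].
apply: (@integrableS _ _ _ mu setT) => //.
pose f1 := (fun u => u `^ (r - 1)) \_ `]0, 1].
rewrite (_ : EFin \o _ = ((EFin \o f1) \+ (EFin \o exponential_pdf 1%R))%E)//.
apply: integrableD => //; last exact: integrable_exponential_pdf.
rewrite /f1 -restrict_EFin; apply/integrable_restrict => //; rewrite setTI.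
have hA : 0 < 1 - r < 1 by apply/andP; split; lra.
have := @integrable_abs_powR 0 1 (1 - r) 0 ltr01 hA.
rewrite lexx ler01 => /(_ isT) H.
apply: (@eq_integrable _ _ _ mu _ _ (fun s => (`|0 - s| `^ (- (1 - r)))%:E)) => //.
  move=> s; rewrite inE/= in_itv/= => /andP[s0 _].
  by rewrite sub0r normrN gtr0_norm// opprB.
apply: integrableS H => //; apply: subset_itvr.
by rewrite bnd_simp.
Qed.

Lemma measurable_gamma_integrand r (D : set R) :
  measurable_fun D (fun s => s `^ (r - 1) * expR (- s)).
Proof.
apply: measurable_funTS; apply: measurable_funM; first exact: measurable_powR.
exact/measurableT_comp.
Qed.

Lemma integrable_gamma r : 0 < r < 1 ->
  mu.-integrable `]0, +oo[ (fun s => (s `^ (r - 1) * expR (- s))%:E).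
Proof.
move=> hr; have /andP[r0 r1] := hr.
apply: le_integrable (integrable_gamma_bound hr) => //.
  by apply/measurable_EFinP; exact: measurable_gamma_integrand.
move=> s /=; rewrite in_itv/= andbT => s0; rewrite lee_fin.
rewrite (le_trans _ (ler_norm _))// gamma_integrand_le// lexx ltW//.
Qed.

(** On ]0, 1] the power is at least 1 and the exponential at least [expR (- 1)]. The inverse of this
    bound is the constant [expR 1] of [weakly_singular_left_kernel]. *)
Lemma Gamma_ge r : 0 < r < 1 -> expR (- 1) <= Gamma r.
Proof.
move=> hr; have /andP[r0 r1] := hr.
have I01 : (`]0, 1] : set R) `<=` `]0, +oo[ by exact: subset_itvl.
have iG := integrable_gamma hr.
have iG1 : mu.-integrable `]0, 1] (fun s => (s `^ (r - 1) * expR (- s))%:E).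
  exact: integrableS iG.
apply: (@le_trans _ _ (\int[mu]_(s in `]0, 1]) (s `^ (r - 1) * expR (- s)))).
  have <- : \int[mu]_(s in `]0, 1]) (cst (expR (- 1)) s) = expR (- 1).
    rewrite Rintegral_cst//= lebesgue_measure_itv/= lte_fin ltr01/=.
    by rewrite oppr0 addr0 mulr1.
  apply: le_Rintegral => //.
    have := @integrable_bounded 0 1 `]0, 1] (cst (expR (- 1))) (expR (- 1)).
    by apply => // [|s _]; [apply: subset_itvr; rewrite bnd_simp|rewrite ger0_norm ?expR_ge0].
  move=> s /=; rewrite in_itv/= => /andP[s0 s1].
  rewrite -[leLHS]mul1r ler_pM ?expR_ge0//.
    by rewrite -[leLHS](powRr0 s) ger_powR ?s0//; lra.
  by rewrite ler_expR lerN2.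
rewrite /Gamma /Rintegral fine_le ?integrable_fin_num//.
apply: ge0_subset_integral => //.
  by apply/measurable_EFinP; exact: measurable_gamma_integrand.
by move=> s _; rewrite lee_fin mulr_ge0 ?powR_ge0 ?expR_ge0.
Qed.

(** Dominated convergence: near [r] the exponents stay above [r / 2], where [gamma_bound (r / 2)] is
    a common majorant. *)
Lemma Gamma_continuous : {in `]0, 1[, continuous (@Gamma R)}.
Proof.
move=> r; rewrite in_itv/= => /andP[r0 r1].
apply: (@continuity_under_integral R _ (measurableTypeR R) mu
  (fun r s => s `^ (r - 1) * expR (- s))
  `]0, +oo[ _ (r / 2) 1 _ _ (gamma_bound (r / 2))) => //.
- move=> u; rewrite /= in_itv/= => /andP[? ?]; apply: integrable_gamma.
  by apply/andP; split; lra.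
- apply: nearW => s; rewrite /= in_itv/= andbT => s0 u _.
  apply: cvgM; last exact: cvg_cst.
  by apply: cvg_powR => //; [exact: cvg_cst|apply: cvgB => //; exact: cvg_cst].
- by apply: integrable_gamma_bound; apply/andP; split; lra.
- move=> u; rewrite /= in_itv/= => /andP[? ?]; apply: nearW => s.
  rewrite /= in_itv/= andbT => s0; apply: gamma_integrand_le => //; first lra.
  by apply/andP; split; lra.
- by rewrite inE/= in_itv/=; apply/andP; split; lra.
Qed.

End integral_bounds.

(** * Borel sets of the plane and the product sigma-algebra *)

Section measurable_plane.
Context {R : realType}.
Local Notation RR := (measurableTypeR R * measurableTypeR R)%type.

(** [RR] carries the product sigma-algebra. It contains the open sets because each is a countable
    union of squares with rational centres and radii [1 / (n + 1)]. *)
Lemma open_measurable_plane (U : set (R * R)) :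
  open U -> measurable (U : set RR).
Proof.
move=> oU.
pose B (i : rat * rat * nat) : set RR :=
  ball (ratr i.1.1 : R) i.2.+1%:R^-1 `*` ball (ratr i.1.2 : R) i.2.+1%:R^-1.
have -> : U = \bigcup_(i in [set i | B i `<=` U]) B i.
  apply/seteqP; split => [p Up|p [i /= +]]; last exact.
  have /nbhs_ballP[e /= e0 eU] := open_nbhs_nbhs (conj oU Up).
  have [n _ ne] : exists2 n, True & n.+1%:R^-1 < e / 2.
    exists (Num.trunc (e / 2)^-1) => //.
    rewrite invf_plt ?posrE ?divr_gt0//; exact: truncnS_gt.
  have n0 : 0 < n.+1%:R^-1 :> R by rewrite invr_gt0.
  have rt (x : R) : exists q : rat, `|ratr q - x| < n.+1%:R^-1.
    have [|q] := @rat_in_itvoo R (x - n.+1%:R^-1) (x + n.+1%:R^-1); first by rewrite ltrD2l gtrN.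
    by rewrite in_itv/= -ltr_distlC distrC; exists q.
  have [[q1 h1] [q2 h2]] := (rt p.1, rt p.2).
  exists ((q1, q2), n) => //= z [/= z1 z2]; apply: eU.
  move: z1 z2; rewrite /ball/= => /lt_trans/(_ ne) z1 /lt_trans/(_ ne) z2.
  have := lt_trans h1 ne; have := lt_trans h2 ne => {}h2 {}h1.
  split => /=; rewrite /ball/=.
    rewrite (_ : p.1 - z.1 = (ratr q1 - z.1) - (ratr q1 - p.1)); last by ring.
    by rewrite (le_lt_trans (ler_normB _ _))// [ltRHS]splitr ltrD.
  rewrite (_ : p.2 - z.2 = (ratr q2 - z.2) - (ratr q2 - p.2)); last by ring.
  by rewrite (le_lt_trans (ler_normB _ _))// [ltRHS]splitr ltrD.
rewrite bigcup_mkcond; apply: countable_bigcupT_measurable => //= i.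
by case: ifP => // _; apply: measurableX; exact: measurable_ball.
Qed.

Lemma continuous_measurable_plane (f : R * R -> R) :
  continuous f -> measurable_fun setT (f : RR -> measurableTypeR R).
Proof.
move=> /continuousP cf; apply: (measurability _ (RGenOpens.measurableE R)).
move=> _ [_ [a [b ->] <-]]; rewrite setTI; apply: open_measurable_plane.
exact/cf/interval_open.
Qed.

End measurable_plane.

(** * Kernels with an integrable singularity on the diagonal *)

Section weakly_singular.
Context {R : realType}.
Notation mu := (@lebesgue_measure R).
Local Notation RR := (measurableTypeR R * measurableTypeR R)%type.
Implicit Types (a b A C M t s : R) (f k y : R -> R) (N : R -> R -> R).

(** Kernels live on the whole plane, where Fubini's theorem is applied. The summand 1 is for
    distances [u > 1], at which [u ^ (- alpha)] exceeds [u ^ (- A)] when [alpha < A]. The value 0 on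
    the diagonal makes the cutoff error vanish at [s = t] without recourse to null sets. *)
Definition weakly_singular A C N : Prop :=
  [/\ measurable_fun setT ((fun p => N p.1 p.2) : RR -> measurableTypeR R),
      forall t, N t t = 0,
      forall t s, `|N t s| <= C * (`|t - s| `^ (- A) + 1) &
      forall t s, t != s -> {for (t, s), continuous (fun p => N p.1 p.2)}].

(** Continuity would be too strong a condition here: the data given to the operators are cut off at
    [T] and may jump there. *)
Definition bounded_measurable M f : Prop :=
  measurable_fun setT (f : measurableTypeR R -> measurableTypeR R) /\
  forall t, `|f t| <= M.

Definition kernel_integral N a b f t : R :=
  \int[mu]_(s in `[a, b]) (N t s * f s).

Lemma weakly_singular_transpose A C N :
  weakly_singular A C N -> weakly_singular A C (fun t s => N s t).
Proof.
move=> [mN N0 NC cN]; split => //.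
- by have := measurableT_comp mN (@measurable_swap _ _ (measurableTypeR R) (measurableTypeR R)).
- by move=> t s; rewrite distrC.
- move=> t s ts; apply: (@continuous_comp _ _ _ (fun p => (p.2, p.1)) (fun p => N p.1 p.2)).
    exact: swap_continuous.
  by apply: cN; rewrite eq_sym.
Qed.

Lemma weakly_singular_comb A C1 C2 N1 N2 (k l : R) :
  weakly_singular A C1 N1 -> weakly_singular A C2 N2 ->
  weakly_singular A (`|k| * C1 + `|l| * C2) (fun t s => k * N1 t s + l * N2 t s).
Proof.
move=> [m1 z1 b1 c1] [m2 z2 b2 c2]; split.
- by apply: measurable_funD; apply: measurable_funM.
- by move=> t; rewrite z1 z2 !mulr0 addr0.
- move=> t s; rewrite (le_trans (ler_normD _ _))// mulrDl !normrM -!mulrA.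
  by rewrite lerD// ler_wpM2l.
- move=> t s ts; apply: cvgD; apply: cvgM; try exact: cvg_cst.
    exact: c1.
  exact: c2.
Qed.

Lemma measurable_section N t : measurable_fun setT ((fun p => N p.1 p.2) : RR -> measurableTypeR R) ->
  measurable_fun setT (N t : measurableTypeR R -> measurableTypeR R).
Proof. by move=> mN; exact: (measurable_fun_pair2 t mN). Qed.

Lemma bounded_measurable_ge0 M f : bounded_measurable M f -> 0 <= M.
Proof. by move=> [_ /(_ 0)]; exact: le_trans. Qed.

Lemma bounded_measurable_integrable M f (D : set R) a b :
  measurable D -> D `<=` `[a, b] ->
  bounded_measurable M f -> mu.-integrable D (EFin \o f).
Proof.
move=> mD Dab [mf bf]; apply: (integrable_bounded mD Dab) => //.
exact: measurable_funTS.
Qed.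

Lemma weight_integrable a b A C t : a < b -> 0 < A < 1 -> a <= t <= b ->
  mu.-integrable `[a, b] (EFin \o (fun s => C * (`|t - s| `^ (- A) + 1))).
Proof.
move=> ab hA tab.
pose f1 s : R := `|t - s| `^ (- A).
rewrite (_ : EFin \o _ = (fun s => C%:E * (((EFin \o f1) \+ (EFin \o cst 1%R)) s))%E)//.
apply: integrableZl => //; apply: integrableD => //.
  exact: integrable_abs_powR.
by apply: (@bounded_measurable_integrable 1 _ _ a b) => //; split=> // s; rewrite normr1.
Qed.

Lemma weight_integral_le a b A : a < b -> 0 < A < 1 ->
  exists2 K, 0 <= K & forall t, a <= t <= b ->
    \int[mu]_(s in `[a, b]) (`|t - s| `^ (- A)) <= K.
Proof.
move=> ab hA; have [K K0 HK] := integral_abs_powR_le ab hA.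
exists K => // t tab; rewrite /Rintegral -lee_fin fineK ?HK//.
apply: integrable_fin_num => //; exact: integrable_abs_powR.
Qed.

Lemma kernel_integrable a b A C N M f t : a < b -> 0 < A < 1 ->
  weakly_singular A C N -> bounded_measurable M f -> a <= t <= b ->
  mu.-integrable `[a, b] (EFin \o (fun s => N t s * f s)).
Proof.
move=> ab hA [mN N0 bN cN] fM tab.
have M0 := bounded_measurable_ge0 fM; have [mf bf] := fM.
apply: le_integrable (weight_integrable (M * C) ab hA tab) => //.
  apply/measurable_EFinP; apply: measurable_funTS; apply: measurable_funM => //.
  exact: measurable_section.
move=> s _ /=; rewrite lee_fin (le_trans _ (ler_norm _))//.
by rewrite normrM mulrC -mulrA ler_pM.
Qed.

Lemma kernel_integral_le a b A C N : a < b -> 0 < A < 1 ->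
  weakly_singular A C N -> exists2 K, 0 <= K & forall M f t,
    bounded_measurable M f -> a <= t <= b ->
    `|kernel_integral N a b f t| <= K * M.
Proof.
move=> ab hA hN; have [mN N0 bN cN] := hN.
have [K K0 HK] := weight_integral_le ab hA.
(* At distance 1 the bound on the kernel reads [0 <= C * (1 + 1)]. *)
have C0 : 0 <= C.
  have := bN 0 1; rewrite sub0r normrN normr1 powR1 => /(le_trans (normr_ge0 _)).
  by rewrite pmulr_lge0.
exists (C * (K + (b - a))) => [|M f t fM tab].
  by rewrite mulr_ge0// addr_ge0// subr_ge0 ltW.
have M0 := bounded_measurable_ge0 fM; have [mf bf] := fM.
have iN := kernel_integrable ab hA hN fM tab.
have i1 : mu.-integrable `[a, b] (EFin \o (fun s => `|t - s| `^ (- A))).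
  exact: integrable_abs_powR.
have i2 : mu.-integrable `[a, b] (EFin \o cst (1 : R)).
  by apply: (@bounded_measurable_integrable 1 _ _ a b) => //; split=> // s; rewrite normr1.
rewrite /kernel_integral (le_trans (le_normr_Rintegral _ iN))//.
apply: (@le_trans _ _ (\int[mu]_(s in `[a, b]) (M * C * (`|t - s| `^ (- A) + 1)))).
  apply: le_Rintegral => //; first exact: (integrable_norm iN).
    exact: weight_integrable.
  by move=> s _; rewrite normrM mulrC -mulrA ler_pM.
rewrite RintegralZl//; last first.
  by have := weight_integrable 1 ab hA tab; under [X in EFin \o X]eq_fun do rewrite mul1r.
rewrite RintegralD//.
have -> : \int[mu]_(s in `[a, b]) (1 : R) = b - a.
  by have := @Rintegral_cst _ _ _ mu `[a, b]%classic (measurable_itv _) 1; rewrite /= lebesgue_measure_itv/= lte_fin ab/= mul1r.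
by rewrite (mulrC M) [leRHS]mulrAC ler_wpM2l ?mulr_ge0// lerD2r HK.
Qed.

End weakly_singular.

(** * Continuity of weakly singular integrals *)

Section kernel_continuity.
Context {R : realType}.
Notation mu := (@lebesgue_measure R).
Local Notation RR := (measurableTypeR R * measurableTypeR R)%type.
Implicit Types (a b A C M t s eta u : R) (f k y : R -> R) (N : R -> R -> R).

(** For [u > 0] this is [1 - min (1, eta / u)]. It removes a strip around the diagonal continuously,
    and its distance to 1 is at most any power of [eta / u] with exponent in ]0, 1[. *)
Definition cutoff eta u : R := Num.max 0 (u - eta) / u.

Lemma cutoff_small eta u : u <= eta -> cutoff eta u = 0.
Proof. by move=> ue; rewrite /cutoff max_l ?mul0r// subr_le0. Qed.

Lemma cutoff_large eta u : eta < u -> cutoff eta u = (u - eta) / u.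
Proof. by move=> ue; rewrite /cutoff max_r// subr_ge0 ltW. Qed.

Lemma cutoff_itv eta u : 0 < eta -> 0 <= cutoff eta u <= 1.
Proof.
move=> e0; have [ue|eu] := leP u eta; first by rewrite cutoff_small// lexx ler01.
have u0 : 0 < u by exact: lt_trans eu.
rewrite cutoff_large// ler_pdivrMr// mul1r gerBl (ltW e0) andbT.
by apply: divr_ge0; rewrite ?subr_ge0 ltW.
Qed.

(* The error of the cutoff costs only the power [delta], which is spent on making
   the kernel slightly more singular. *)
Lemma cutoff_error eta u (delta : R) : 0 < eta -> 0 < u -> 0 < delta < 1 ->
  `|1 - cutoff eta u| <= eta `^ delta * u `^ (- delta).
Proof.
move=> e0 u0 /andP[d0 d1].
have -> : eta `^ delta * u `^ (- delta) = (eta / u) `^ delta.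
  rewrite powRM ?invr_ge0 ?ltW//; congr (_ * _).
  by rewrite -powR_inv1 ?ltW// -powRrM mulN1r.
have [ue|eu] := leP u eta.
  rewrite cutoff_small// subr0 normr1 -[leLHS](powRr0 (eta / u)).
  by apply: ler_powR; [rewrite ler_pdivlMr// mul1r|exact: ltW].
rewrite cutoff_large// ger0_norm; last first.
  by rewrite subr_ge0 ler_pdivrMr// mul1r gerBl ltW.
rewrite (_ : 1 - _ = eta / u); last by field; rewrite gt_eqF.
apply: ger1_powR; last exact: ltW.
by rewrite divr_gt0//= ler_pdivrMr// mul1r ltW.
Qed.

Lemma cutoff_kernel_le A C N eta t s : 0 < A -> weakly_singular A C N -> 0 < eta ->
  `|cutoff eta `|t - s| * N t s| <= C * (eta `^ (- A) + 1).
Proof.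
move=> A0 [mN N0 bN cN] e0; have /andP[c0 c1] := cutoff_itv `|t - s| e0.
have C0 : 0 <= C.
  have := bN 0 1; rewrite sub0r normrN normr1 powR1 => /(le_trans (normr_ge0 _)).
  by rewrite pmulr_lge0.
have [ue|eu] := leP `|t - s| eta.
  by rewrite cutoff_small// mul0r normr0 mulr_ge0// addr_ge0// powR_ge0.
rewrite normrM (ger0_norm c0) -[leRHS]mul1r ler_pM//.
rewrite (le_trans (bN t s))// ler_wpM2l// lerD2r.
rewrite !powRN lef_pV2 ?posrE ?powR_gt0//; last exact: lt_trans eu.
by rewrite ge0_ler_powR ?nnegrE// ltW.
Qed.

Lemma cutoff_kernel_continuous A C N eta t s : weakly_singular A C N -> 0 < eta ->
  {for t, continuous (fun u => cutoff eta `|u - s| * N u s)}.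
Proof.
move=> [mN N0 bN cN] e0.
have cu : (fun u => `|u - s|) @ t --> `|t - s|.
  by apply: cvg_norm; apply: cvgB; [exact: cvg_id|exact: cvg_cst].
have [->|ts] := eqVneq t s.
  rewrite /prop_for/continuous_at subrr normr0 cutoff_small ?(ltW e0)// mul0r.
  have H : (fun _ : R => 0 : R) @ s --> (0 : R) by exact: cvg_cst.
  apply: cvg_trans H; apply: near_eq_cvg; near=> u.
  rewrite cutoff_small ?mul0r// distrC; near: u.
apply: cvgM.
  have ts0 : `|t - s| != 0 by rewrite normr_eq0 subr_eq0.
  apply: cvgM; last exact: cvgV.
  apply: (@continuous_max _ _ (fun=> 0) (fun u => `|u - s| - eta)).
    exact: cst_continuous.
  by apply: cvgB => //; exact: cvg_cst.
have cNs := cN t s ts.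
apply: (@continuous2_cvg _ _ _ _ (nbhs t) _ (fun u => u) (fun=> s) N) => //.
exact: cvg_cst.
Unshelve. all: by end_near. Qed.

Lemma cutoff_kernel_continuousr A C N eta t : weakly_singular A C N -> 0 < eta ->
  continuous (fun s => cutoff eta `|t - s| * N t s).
Proof.
move=> hN e0 s; under eq_fun do rewrite distrC.
exact: (cutoff_kernel_continuous (weakly_singular_transpose hN) e0).
Qed.

Lemma cutoff_integral_continuous a b A C N M f eta : a < b -> 0 < A < 1 ->
  weakly_singular A C N -> bounded_measurable M f -> 0 < eta ->
  continuous (kernel_integral (fun t s => cutoff eta `|t - s| * N t s) a b f).
Proof.
move=> ab /andP[A0 A1] hN fM e0 t; have [mN N0 bN cN] := hN.
have [mf bf] := fM.
have t11 : t \in `]t - 1, t + 1[%classic.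
  by rewrite inE/= in_itv/=; apply/andP; split; lra.
apply: (@continuity_under_integral R _ (measurableTypeR R) mu
  (fun t s => cutoff eta `|t - s| * N t s * f s) `[a, b] _ (t - 1) (t + 1) _ _
  (cst (C * (eta `^ (- A) + 1) * M)) _ _ t t11) => //.
- move=> u _; apply: (@integrable_bounded _ a b _ _ (C * (eta `^ (- A) + 1) * M)) => //.
    apply: measurable_funTS; apply: measurable_funM => //.
    exact: (continuous_measurable_fun (cutoff_kernel_continuousr hN e0)).
  move=> s _; rewrite normrM ler_pM//; exact: cutoff_kernel_le hN _.
- apply: nearW => s _ u _; apply: cvgM; last exact: cvg_cst.
  exact: cutoff_kernel_continuous hN _.
- apply: (@integrable_bounded _ a b _ _ `|C * (eta `^ (- A) + 1) * M|) => //.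
- move=> u _; apply: nearW => s _.
  rewrite normrM ler_pM//; exact: cutoff_kernel_le hN _.
Qed.

(** A uniform limit of continuous functions: the integrals of the cut-off kernels are continuous by
    dominated convergence, and the error is at most [eta ^ d] times integrals of [|t - s| ^ (- d)]
    and [|t - s| ^ (- (A + d))], bounded uniformly in [t]. *)
Lemma kernel_integral_continuous a b A C N M f : a < b -> 0 < A < 1 ->
  weakly_singular A C N -> bounded_measurable M f ->
  {within `[a, b], continuous (kernel_integral N a b f)}.
Proof.
move=> ab hA hN fM; have [mN N0 bN cN] := hN; have [mf bf] := fM.
have /andP[A0 A1] := hA; have M0 := bounded_measurable_ge0 fM.
(* Half of the gap to 1 is spent: [A + d = (1 + A) / 2] is still below 1. *)
pose d := (1 - A) / 2.
have hd : 0 < d < 1 by rewrite /d; apply/andP; split; lra.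
have hAd : 0 < A + d < 1 by rewrite /d; apply/andP; split; lra.
have [K1 K10 HK1] := weight_integral_le ab hd.
have [K2 K20 HK2] := weight_integral_le ab hAd.
pose cN' eta := (fun t s => cutoff eta `|t - s| * N t s).
have C0 : 0 <= C.
  have := bN 0 1; rewrite sub0r normrN normr1 powR1 => /(le_trans (normr_ge0 _)).
  by rewrite pmulr_lge0.
have err eta t : 0 < eta -> a <= t <= b ->
    `|kernel_integral N a b f t - kernel_integral (cN' eta) a b f t| <=
    eta `^ d * (M * C * (K1 + K2)).
  move=> e0 tab.
  have i0 := kernel_integrable ab hA hN fM tab.
  have i1 : mu.-integrable `[a, b] (EFin \o (fun s => cN' eta t s * f s)).
    apply: le_integrable i0 => //.
      apply/measurable_EFinP; apply: measurable_funTS; apply: measurable_funM => //.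
      exact: (continuous_measurable_fun (cutoff_kernel_continuousr hN e0)).
    move=> s _; have /andP[c0 c1] := cutoff_itv `|t - s| e0.
    rewrite lee_fin /cN'/= -mulrA normrM (ger0_norm c0).
    by rewrite ler_piMl.
  pose w1 s : R := `|t - s| `^ (- d); pose w2 s : R := `|t - s| `^ (- (A + d)).
  have iw1 : mu.-integrable `[a, b] (EFin \o w1) by exact: integrable_abs_powR.
  have iw2 : mu.-integrable `[a, b] (EFin \o w2) by exact: integrable_abs_powR.
  have iw : mu.-integrable `[a, b] (EFin \o (fun s => w1 s + w2 s)).
    exact: (@integrableD _ (measurableTypeR R) R mu _ _ _ _ iw1 iw2).
  have iz : mu.-integrable `[a, b] (EFin \o (fun s => eta `^ d * (M * C) * (w1 s + w2 s))).
    exact: (@integrableZl _ (measurableTypeR R) R mu _ _ _ _ iw).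
  have id : mu.-integrable `[a, b] (EFin \o (fun s => N t s * f s - cN' eta t s * f s)).
    exact: (@integrableB _ (measurableTypeR R) R mu _ _ _ _ i0 i1).
  rewrite /kernel_integral -RintegralB// (le_trans (le_normr_Rintegral _ id))//.
  apply: (@le_trans _ _
      (\int[mu]_(s in `[a, b]) (eta `^ d * (M * C) * (w1 s + w2 s)))).
    apply: le_Rintegral => //; first exact: (integrable_norm id).
    move=> s _; rewrite -mulrBl /cN' /w1 /w2.
    have [->|ts] := eqVneq t s.
      by rewrite N0 mulr0 subrr mul0r normr0 !mulr_ge0// ?addr_ge0 ?powR_ge0.
    have u0 : 0 < `|t - s| by rewrite normr_gt0 subr_eq0.
    rewrite -{1}(mul1r (N t s)) -mulrBl !normrM.
    have -> : eta `^ d * (M * C) * (`|t - s| `^ (- d) + `|t - s| `^ (- (A + d))) =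
        (eta `^ d * `|t - s| `^ (- d)) * (C * (`|t - s| `^ (- A) + 1)) * M.
      by rewrite opprD powRD ?(gt_eqF u0) ?implybT//; ring.
    by rewrite !ler_pM ?mulr_ge0 ?bN//; exact: cutoff_error.
  rewrite RintegralZl// RintegralD// -!mulrA ler_wpM2l ?powR_ge0//.
  by rewrite !ler_wpM2l// lerD// ?HK1 ?HK2.
apply/subspace_continuousP => t tab.
have tab' : a <= t <= b by move: tab; rewrite /= in_itv.
apply/cvgrPdist_le => e e0.
(* One third of [e] for the cutoff error at each of the two points, one third for the continuity of
   the cut-off integral. *)
have [eta eta0 eta_e] : exists2 eta, 0 < eta & eta `^ d * (M * C * (K1 + K2)) <= e / 3.
  have d0 : 0 < d by case/andP: hd.
  have : (fun eta : R => eta `^ d * (M * C * (K1 + K2))) @ 0^'+ --> 0 * (M * C * (K1 + K2)).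
    by apply: cvgM; [exact: powR_cvg0|exact: cvg_cst].
  rewrite mul0r => /cvgrPdist_le/(_ (e / 3)); rewrite divr_gt0// => /(_ isT) H.
  have H0 : \forall eta \near 0^'+, (0 : R) < eta by exact: nbhs_right_gt.
  have [eta [eta0 /= He]] := @filter_ex _ _ (at_right_proper_filter (0 : R)) _ (filterI H0 H).
  exists eta => //; move: He; rewrite sub0r normrN; exact: le_trans (ler_norm _).
have ct := cutoff_integral_continuous ab hA hN fM eta0 (x := t).
near=> u.
have uab : a <= u <= b.
  have : `[a, b]%classic u by near: u; exact: withinT.
  by rewrite /= in_itv.
have := le_trans (err eta t eta0 tab') eta_e; have := le_trans (err eta u eta0 uab) eta_e.
have : `|kernel_integral (cN' eta) a b f t - kernel_integral (cN' eta) a b f u| <= e / 3.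
  near: u; apply: cvg_within; move: ct => /cvgrPdist_le; apply; exact: divr_gt0.
rewrite /from_subspace.
move: (kernel_integral N a b f t) (kernel_integral N a b f u)
  (kernel_integral (cN' eta) a b f t) (kernel_integral (cN' eta) a b f u) => p q p' q'.
by rewrite !ler_distl => /andP[? ?] /andP[? ?] /andP[? ?]; apply/andP; split; lra.
Unshelve. all: by end_near. Qed.

End kernel_continuity.

(** * Transposition of kernels by Fubini's theorem *)

Section kernel_Fubini.
Context {R : realType}.
Notation mu := (@lebesgue_measure R).
Local Notation RR := (measurableTypeR R * measurableTypeR R)%type.
Implicit Types (a b A C M t s : R) (f k y : R -> R) (N : R -> R -> R) (D : set R).

Lemma integrable_realD D f k :
  mu.-integrable D (EFin \o f) -> mu.-integrable D (EFin \o k) ->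
  measurable D -> mu.-integrable D (EFin \o (fun s => f s + k s)).
Proof. by move=> i1 i2 mD; exact: (@integrableD _ (measurableTypeR R) R mu _ mD _ _ i1 i2). Qed.

Lemma integrable_realB D f k :
  mu.-integrable D (EFin \o f) -> mu.-integrable D (EFin \o k) ->
  measurable D -> mu.-integrable D (EFin \o (fun s => f s - k s)).
Proof. by move=> i1 i2 mD; exact: (@integrableB _ (measurableTypeR R) R mu _ mD _ _ i1 i2). Qed.

Lemma integrable_realZ D f (c : R) :
  mu.-integrable D (EFin \o f) ->
  measurable D -> mu.-integrable D (EFin \o (fun s => c * f s)).
Proof. by move=> i1 mD; exact: (@integrableZl _ (measurableTypeR R) R mu _ mD _ _ i1). Qed.

Lemma weakly_singular_norm A C N :
  weakly_singular A C N -> weakly_singular A C (fun t s => `|N t s|).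
Proof.
move=> [mN N0 bN cN]; split.
- exact: measurableT_comp.
- by move=> t; rewrite N0 normr0.
- by move=> t s; rewrite normr_id.
- by move=> t s ts; apply: cvg_norm; exact: cN.
Qed.

Lemma bounded_measurable_norm M f :
  bounded_measurable M f -> bounded_measurable M (fun t => `|f t|).
Proof.
by move=> [mf bf]; split; [exact: measurableT_comp|move=> t; rewrite normr_id].
Qed.

Lemma kernel_integral_measurable a b A C N M f : a < b -> 0 < A < 1 ->
  weakly_singular A C N -> bounded_measurable M f ->
  measurable_fun (`[a, b]%classic : set (measurableTypeR R))
    (kernel_integral N a b f : measurableTypeR R -> measurableTypeR R).
Proof.
move=> ab hA hN hf; apply: subspace_continuous_measurable_fun => //.
exact: kernel_integral_continuous ab hA hN hf.
Qed.

(* Double integrals over the square [a, b]^2 are written as integrals over the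
   plane, as the library states Fubini's theorem for whole spaces. *)
Definition square_kernel N a b y k (p : RR) : R :=
  (\1_`[a, b] p.1 * \1_`[a, b] p.2) * (y p.1 * (N p.1 p.2 * k p.2)).

Lemma square_kernelE a b A C N M y k t : a < b -> 0 < A < 1 ->
  weakly_singular A C N -> bounded_measurable M k ->
  (\int[mu]_s (square_kernel N a b y k (t, s))%:E =
   ((fun t => (y t * kernel_integral N a b k t)%:E) \_ `[a, b]) t)%E.
Proof.
move=> ab hA hN bk; rewrite patchE /square_kernel/= indicE.
case: ifPn => tab; last first.
  by under eq_integral do rewrite !mul0r; rewrite integral0.
have tab' : a <= t <= b by move: tab; rewrite inE/= in_itv.
have iN := kernel_integrable ab hA hN bk tab'.
rewrite /kernel_integral -RintegralZl// /Rintegral fineK; last first.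
  by apply: integrable_fin_num => //; exact: integrable_realZ.
rewrite [RHS]integral_mkcond; apply: eq_integral => s _.
by rewrite patchE indicE mul1r; case: ifPn => _; rewrite ?mul1r ?mul0r.
Qed.

Lemma measurable_square_kernel a b A C N M1 M2 y k : weakly_singular A C N ->
  bounded_measurable M1 y -> bounded_measurable M2 k ->
  measurable_fun setT (square_kernel N a b y k).
Proof.
move=> [mN _ _ _] [my _] [mk _].
have m1 h : measurable_fun setT (h : measurableTypeR R -> measurableTypeR R) ->
    measurable_fun setT ((fun p => h p.1) : RR -> measurableTypeR R).
  by move=> mh; exact: (measurableT_comp mh measurable_fst).
have m2 h : measurable_fun setT (h : measurableTypeR R -> measurableTypeR R) ->
    measurable_fun setT ((fun p => h p.2) : RR -> measurableTypeR R).
  by move=> mh; exact: (measurableT_comp mh measurable_snd).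
have mI : measurable_fun setT (\1_`[a, b] : measurableTypeR R -> measurableTypeR R).
  exact: measurable_indic.
apply: measurable_funM; first by apply: measurable_funM; [exact: m1|exact: m2].
apply: measurable_funM; first exact: m1.
by apply: measurable_funM => //; exact: m2.
Qed.

(** Tonelli's criterion for absolute values: the inner integral is at most [K * M2] for every [t],
    by [kernel_integral_le] applied to the norm of the kernel, and the outer one runs over a bounded
    interval. *)
Lemma integrable_square_kernel a b A C N M1 M2 y k : a < b -> 0 < A < 1 ->
  weakly_singular A C N -> bounded_measurable M1 y -> bounded_measurable M2 k ->
  (mu \x mu)%E.-integrable setT (EFin \o square_kernel N a b y k).
Proof.
move=> ab hA hN hy hk.
have M10 := bounded_measurable_ge0 hy.
have hN' := weakly_singular_norm hN; have hk' := bounded_measurable_norm hk.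
have hy' := bounded_measurable_norm hy.
have [K K0 HK] := kernel_integral_le ab hA hN'.
apply/integrable12ltyP.
  apply/measurable_EFinP; exact: (measurable_square_kernel a b hN hy hk).
under eq_integral => t _.
  under eq_integral => s _.
    have -> : (`|(EFin \o square_kernel N a b y k) (t, s)| =
        (square_kernel (fun t s => `|N t s|) a b (fun t => `|y t|) (fun t => `|k t|) (t, s))%:E)%E.
      by rewrite /= /square_kernel/= !normrM !indicE !normr_nat.
    over.
  rewrite (square_kernelE _ _ ab hA hN' hk').
  over.
rewrite -integral_mkcond.
apply: (@le_lt_trans _ _ (\int[mu]_(t in `[a, b]) (M1 * (K * M2))%:E)%E).
  apply: ge0_le_integral => //.
  - move=> t /=; rewrite in_itv/= => tab; rewrite lee_fin mulr_ge0//.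
    by apply: Rintegral_ge0 => s _; rewrite mulr_ge0.
  - apply/measurable_EFinP; apply: measurable_funM.
      by apply: measurable_funTS; have [] := hy'.
    exact: kernel_integral_measurable ab hA hN' hk'.
  - move=> t /=; rewrite in_itv/= => tab; rewrite lee_fin ler_pM//.
    + by apply: Rintegral_ge0 => s _; rewrite mulr_ge0.
    + by have [_ ->] := hy.
    + exact: le_trans (ler_norm _) (HK _ _ _ hk' tab).
rewrite integral_cst//= lebesgue_measure_itv/= lte_fin ab -EFinD -EFinM.
exact: ltry.
Qed.

(** The adjoint operator has the transposed kernel. This takes the place of fractional integration
    by parts and puts no derivative on [y]. *)
Lemma kernel_FubiniE a b A C N M1 M2 y k : a < b -> 0 < A < 1 ->
  weakly_singular A C N -> bounded_measurable M1 y -> bounded_measurable M2 k ->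
  \int[mu]_(t in `[a, b]) (y t * kernel_integral N a b k t) =
  \int[mu]_(s in `[a, b]) (k s * kernel_integral (fun t s => N s t) a b y s).
Proof.
move=> ab hA hN hy hk; have hNt := weakly_singular_transpose hN.
have := Fubini (integrable_square_kernel ab hA hN hy hk).
under eq_integral do rewrite /= (square_kernelE _ _ ab hA hN hk).
rewrite -integral_mkcond.
under [in RHS]eq_integral => s _.
  under eq_integral => t _.
    have -> : ((EFin \o square_kernel N a b y k) (t, s) =
        (square_kernel (fun t s => N s t) a b k y (s, t))%:E)%E.
      rewrite /= /square_kernel/=; congr EFin.
      by rewrite (mulrC (\1_`[a, b] t)) mulrCA (mulrC (y t)) (mulrC (k s)) !mulrA; ring.
    over.
  rewrite /= (square_kernelE _ _ ab hA hNt hy).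
  over.
by rewrite -integral_mkcond /Rintegral => ->.
Qed.

End kernel_Fubini.

Lemma continuous_pair (U V W : topologicalType) (f : U -> V) (h : U -> W) (u : U) :
  {for u, continuous f} -> {for u, continuous h} ->
  {for u, continuous (fun x => (f x, h x))}.
Proof. by move=> cf ch; exact: (cvg_pair cf ch). Qed.

(** * Extension of functions from an interval to the line *)

Section clamp.
Context {R : realType}.
Implicit Types (a b t : R).

(** The projection onto [a, b]. Composition with it turns continuity within [a, b] into continuity
    on the line and keeps the values on [a, b]. *)
Definition clamp a b t : R := Num.max a (Num.min t b).

Lemma clamp_itv a b t : a <= b -> a <= clamp a b t <= b.
Proof. by move=> ab; rewrite /clamp le_max lexx/= ge_max ab ge_min lexx orbT. Qed.

Lemma clamp_id a b t : a <= t <= b -> clamp a b t = t.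
Proof. by move=> /andP[a_t tb]; rewrite /clamp min_l// max_r. Qed.

Lemma clamp_continuous a b : continuous (clamp a b).
Proof.
move=> t; apply: (@continuous_max _ _ (fun=> a) (fun t => Num.min t b)).
  exact: cst_continuous.
apply: (@continuous_min _ _ id (fun=> b)); last exact: cst_continuous.
exact: cvg_id.
Qed.

Lemma continuous_comp_within (U V W : topologicalType) (D : set V) (f : V -> W)
    (c : U -> V) (u : U) :
  {within D, continuous f} -> {for u, continuous c} -> (forall x, D (c x)) ->
  {for u, continuous (f \o c)}.
Proof.
move=> /subspace_continuousP cf cc Dc.
apply: (@cvg_comp _ _ _ c f _ (within D (nbhs (c u)))); last exact: cf.
move=> B /= nB; have H : nbhs u (c @^-1` [set x | D x -> B x]) := cc _ nB.
by apply: filterS H => x; apply.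
Qed.

Lemma continuous_clamp (V : topologicalType) a b (f : R -> V) : a <= b ->
  {within `[a, b], continuous f} -> continuous (f \o clamp a b).
Proof.
move=> ab cf t; apply: (continuous_comp_within cf); first exact: clamp_continuous.
by move=> x; rewrite /= in_itv/= clamp_itv.
Qed.

Lemma compact_norm_bounded (V : topologicalType) (A : set V) (f : V -> R) :
  compact A -> {within A, continuous f} ->
  exists2 M, 0 < M & forall x, A x -> `|f x| <= M.
Proof.
move=> cA cf; have [M [_ HM]] := compact_bounded (continuous_compact cf cA).
exists (Num.max M 0 + 1) => [|x Ax].
  by rewrite ltr_wpDl// le_max lexx orbT.
apply: (HM (Num.max M 0 + 1)); last by exists x.
by rewrite ltr_pwDr// le_max lexx.
Qed.

Lemma bounded_measurable_clamp a b (f : R -> R) : a <= b ->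
  {within `[a, b], continuous f} -> exists M, bounded_measurable M (f \o clamp a b).
Proof.
move=> ab cf.
have [M _ HM] := compact_norm_bounded (@segment_compact _ a b) cf.
exists M; split.
  exact: (continuous_measurable_fun (continuous_clamp ab cf)).
by move=> t; apply: HM; rewrite /= in_itv/= clamp_itv.
Qed.

End clamp.

(** * Fractional operators as weakly singular kernels *)

Section fractional_kernels.
Context {R : realType}.
Notation mu := (@lebesgue_measure R).
Local Notation RR := (measurableTypeR R * measurableTypeR R)%type.
Implicit Types (a b A C M t s : R) (f k y : R -> R) (alpha : R -> R -> R).

(* [ker_left] on the triangle s < t, extended by clamping the arguments of the order,
   so that it is a kernel on the whole plane. *)
Definition left_kernel a b alpha t s : R :=
  if s < t then ker_left (fun t s => alpha (clamp a b t) (clamp a b s)) t s else 0.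

Lemma frac_order_clamp a b alpha t s : a <= b -> frac_order a b alpha ->
  0 < alpha (clamp a b t) (clamp a b s) < 1.
Proof. by move=> ab [+ _]; apply; rewrite in_itv/= clamp_itv. Qed.

Lemma frac_order_continuous a b alpha : a <= b -> frac_order a b alpha ->
  continuous (fun p : R * R => alpha (clamp a b p.1) (clamp a b p.2)).
Proof.
move=> ab [_ ca] p.
have H := @continuous_comp_within (R * R)%type _ _ _ (fun p : R * R => alpha p.1 p.2)
  (fun p : R * R => (clamp a b p.1, clamp a b p.2)) p ca.
apply: H.
  apply: continuous_pair.
    by apply: (@continuous_comp _ _ _ fst (clamp a b)); [exact: cvg_fst|exact: clamp_continuous].
  by apply: (@continuous_comp _ _ _ snd (clamp a b)); [exact: cvg_snd|exact: clamp_continuous].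
by move=> x /=; rewrite !in_itv/= !clamp_itv.
Qed.

(** The maximum over the compact square is a value of [alpha], hence strictly below 1. This one
    exponent controls the kernel of variable order. *)
Lemma frac_order_sup a b alpha : a <= b -> frac_order a b alpha ->
  exists2 A, 0 < A < 1 & forall t s, alpha (clamp a b t) (clamp a b s) <= A.
Proof.
move=> ab ha; have ca := frac_order_continuous ab ha.
have cK := compact_setX (@segment_compact _ a b) (@segment_compact _ a b).
have [|p _ Hp] := compact_EVT_max _ cK (continuous_subspaceT ca).
  by exists (a, a); split; rewrite /= in_itv/= lexx.
exists (alpha (clamp a b p.1) (clamp a b p.2)); first exact: frac_order_clamp.
move=> t s; have := Hp (clamp a b t, clamp a b s); rewrite /= !(clamp_id (clamp_itv _ ab)).
by apply; rewrite inE; split; rewrite /= in_itv/= clamp_itv.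
Qed.

(** The inverse of [Gamma] is at most [expR 1] by [Gamma_ge]. The power is at most [(t - s) ^ (- A)]
    if [t - s <= 1] and at most 1 otherwise. *)
Lemma weakly_singular_left_kernel a b alpha A : a <= b -> frac_order a b alpha ->
  (forall t s, alpha (clamp a b t) (clamp a b s) <= A) -> A < 1 ->
  weakly_singular A (expR 1) (left_kernel a b alpha).
Proof.
move=> ab ha aA A1; have ca := frac_order_continuous ab ha.
have cG : continuous (fun p : R * R => Gamma (1 - alpha (clamp a b p.1) (clamp a b p.2))).
  move=> p; have /andP[a0 a1] := frac_order_clamp p.1 p.2 ab ha.
  apply: (@continuous_comp _ _ _ (fun p => 1 - alpha (clamp a b p.1) (clamp a b p.2)) (@Gamma R)).
    by apply: cvgB; [exact: cvg_cst|exact: ca].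
  by apply: Gamma_continuous; rewrite in_itv/=; apply/andP; split; lra.
have Gge t s : expR (- 1) <= Gamma (1 - alpha (clamp a b t) (clamp a b s)).
  have /andP[a0 a1] := frac_order_clamp t s ab ha.
  by apply: Gamma_ge; apply/andP; split; lra.
have Ggt t s : 0 < Gamma (1 - alpha (clamp a b t) (clamp a b s)).
  exact: lt_le_trans (expR_gt0 _) (Gge t s).
split.
(* Written with [expR] and [ln], the power is a measurable function on the whole plane, and the test
   [p.2 < p.1] is the only case distinction left. *)
- rewrite (_ : (fun p => _) = (fun p : RR => if p.2 < p.1 then
      expR (- alpha (clamp a b p.1) (clamp a b p.2) * ln (p.1 - p.2)) *
      (Gamma (1 - alpha (clamp a b p.1) (clamp a b p.2)))^-1 else 0)); last first.
    apply/funext => p; rewrite /left_kernel /ker_left /powR; case: ifPn => // ps.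
    by rewrite subr_eq0 gt_eqF.
  apply: measurable_fun_ifT => //; first exact: measurable_fun_ltr.
  apply: measurable_funM.
    apply: measurableT_comp => //; apply: measurable_funM.
      apply: continuous_measurable_plane => p; apply: cvgN; exact: ca.
    by apply: measurableT_comp; [exact: measurable_ln|exact: measurable_funB].
  apply: continuous_measurable_plane => p.
  by apply: cvgV; [rewrite gt_eqF|exact: cG].
- by move=> t; rewrite /left_kernel ltxx.
- move=> t s; rewrite /left_kernel; case: ifPn => [st|_]; last first.
    by rewrite normr0 mulr_ge0 ?expR_ge0// addr_ge0// powR_ge0.
  have ts0 : 0 < t - s by rewrite subr_gt0.
  have /andP[a0 a1] := frac_order_clamp t s ab ha.
  rewrite /ker_left ger0_norm; last by rewrite divr_ge0 ?powR_ge0// ltW.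
  rewrite ger0_norm ?(ltW ts0)// mulrC ler_pM ?invr_ge0 ?powR_ge0 ?(ltW (Ggt _ _))//.
    by rewrite -[expR 1]invrK -expRN lef_pV2 ?posrE ?expR_gt0 ?Ggt.
  have [ts1|ts1] := leP (t - s) 1.
    rewrite ler_wpDr// ger_powR ?ts0// lerN2; exact: aA.
  rewrite ler_wpDl ?powR_ge0// -[leRHS](powRr0 (t - s)).
  by apply: ler_powR; rewrite ?oppr_le0 ltW.
- move=> t s ts.
  have cd : (fun p : R * R => p.1 - p.2) @ (t, s) --> t - s.
    by apply: cvgB; [exact: cvg_fst|exact: cvg_snd].
  have [st|ts'] := ltP s t.
    have H : (fun p : R * R => (p.1 - p.2) `^ (- alpha (clamp a b p.1) (clamp a b p.2)) /
        Gamma (1 - alpha (clamp a b p.1) (clamp a b p.2))) @ (t, s) -->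
        (t - s) `^ (- alpha (clamp a b t) (clamp a b s)) /
        Gamma (1 - alpha (clamp a b t) (clamp a b s)).
      apply: cvgM.
        apply: cvg_powR => //; first by rewrite subr_gt0.
        by apply: cvgN; exact: (ca (t, s)).
      by apply: cvgV; [rewrite gt_eqF|exact: (cG (t, s))].
    rewrite /prop_for/continuous_at/= {2}/left_kernel st.
    apply: cvg_trans H; apply: near_eq_cvg; near=> p.
    rewrite /left_kernel ifT// -subr_gt0; near: p.
    by apply: (cvgr_gt _ cd); rewrite subr_gt0.
  have st : t < s by rewrite lt_neqAle ts.
  have H : (fun=> 0 : R) @ (t, s) --> (0 : R) by exact: cvg_cst.
  rewrite /prop_for/continuous_at/= {2}/left_kernel ltNge ts'/=.
  apply: cvg_trans H; apply: near_eq_cvg; near=> p.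
  rewrite /left_kernel ifF//; apply/negbTE; rewrite -leNgt -subr_le0 ltW//; near: p.
  by apply: (cvgr_lt _ cd); rewrite subr_lt0.
Unshelve. all: by end_near. Qed.

(** On the diagonal both sides are 0: [powR] sends the base 0 to 0 at a nonzero exponent, and
    [alpha t t > 0]. *)
Lemma left_kernelE a b alpha t s : frac_order a b alpha ->
  a <= t <= b -> a <= s <= b -> s <= t -> left_kernel a b alpha t s = ker_left alpha t s.
Proof.
move=> [ha _] tab sab; rewrite /left_kernel le_eqVlt => /predU1P[->|st]; last first.
  by rewrite st /ker_left !clamp_id.
have := ha t t; rewrite !in_itv/= tab => /(_ isT isT) /andP[a0 _].
by rewrite ltxx /ker_left subrr powR0 ?mul0r// oppr_eq0 gt_eqF.
Qed.

Lemma left_kernel_ge a b alpha t s : t <= s -> left_kernel a b alpha t s = 0.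
Proof. by rewrite /left_kernel ltNge => ->. Qed.

Lemma eq_Rintegral_sub (D E : set R) f k : D `<=` E ->
  (forall s, D s -> f s = k s) -> (forall s, E s -> ~ D s -> k s = 0) ->
  \int[mu]_(s in D) f s = \int[mu]_(s in E) k s.
Proof.
move=> DE fk k0; rewrite Rintegral_mkcond [RHS]Rintegral_mkcond.
suff -> : f \_ D = k \_ E by [].
apply/funext => s; rewrite !patchE; case: ifPn => [/set_mem Ds|/negP nDs].
  by rewrite mem_set ?fk//; exact: DE.
case: ifPn => // /set_mem Es; rewrite k0// => Ds; apply: nDs; exact: mem_set.
Qed.

Lemma kerint_leftE a b alpha y y' t : frac_order a b alpha -> a <= t <= b ->
  (forall s, a <= s <= b -> y s = y' s) ->
  kerint_left alpha a y t = kernel_integral (left_kernel a b alpha) a b y' t.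
Proof.
move=> ha tab yy'; have /andP[a_t tb] := tab; apply: eq_Rintegral_sub => s /=.
- by rewrite !in_itv/= => /andP[-> st]; exact: le_trans tb.
- rewrite in_itv/= => /andP[as_ st].
  have sab : a <= s <= b by rewrite as_ (le_trans st).
  by rewrite left_kernelE// yy'.
- rewrite !in_itv/= => /andP[as_ sb] /negP; rewrite as_/= -ltNge => ts.
  by rewrite left_kernel_ge ?mul0r// ltW.
Qed.

(** [ker_right alpha t s] is minus [ker_left alpha s t], so the right integral is minus the
    transposed operator; data that vanish after [T] let the integral run up to [b]. *)
Lemma kerint_rightE a b alpha A C M y y' T t : a < b -> frac_order a b alpha ->
  0 < A < 1 -> weakly_singular A C (left_kernel a b alpha) -> bounded_measurable M y' ->
  a <= t <= T -> T <= b ->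
  (forall s, a <= s <= T -> y s = y' s) -> (forall s, T < s <= b -> y' s = 0) ->
  kerint_right alpha T y t =
  - kernel_integral (fun t s => left_kernel a b alpha s t) a b y' t.
Proof.
move=> ab ha hA hK hy /andP[a_t tT] Tb yy' y'0.
have tab : a <= t <= b by rewrite a_t (le_trans tT).
have iN := kernel_integrable ab hA (weakly_singular_transpose hK) hy tab.
rewrite -mulN1r /kernel_integral -RintegralZl//; apply: eq_Rintegral_sub => s /=.
- by rewrite !in_itv/= => /andP[ts sT]; rewrite (le_trans a_t)// (le_trans sT).
- rewrite in_itv/= => /andP[ts sT].
  have as_ : a <= s by exact: le_trans ts.
  have sab : a <= s <= b by rewrite as_ (le_trans sT).
  by rewrite left_kernelE// yy' ?as_//= /ker_right /ker_left mulN1r !mulNr.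
- rewrite !in_itv/= => /andP[as_ sb] /negP; rewrite negb_and -!ltNge => /orP[st|Ts].
    by rewrite left_kernel_ge ?mul0r ?mulr0// ltW.
  by rewrite y'0 ?mulr0 ?Ts.
Qed.

(** The parts over [T, t] cancel and leave the integral over [a, T], that is, the operator on data
    cut off at [T]. In this form [diff_fun] can be recognised inside [EL_function]. *)
Lemma kerint_left_tail a b alpha A C M y y' T t : a < b -> frac_order a b alpha ->
  0 < A < 1 -> weakly_singular A C (left_kernel a b alpha) -> bounded_measurable M y' ->
  a <= T <= t -> t <= b -> (forall s, a <= s <= b -> y s = y' s) ->
  kerint_left alpha a y t - kerint_left alpha T y t =
  kernel_integral (left_kernel a b alpha) a b (fun s => if s <= T then y' s else 0) t.
Proof.
move=> ab ha hA hK hy /andP[aT Tt] tb yy'.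
have tab : a <= t <= b by rewrite (le_trans aT).
have iy : mu.-integrable `[a, t] (EFin \o (fun s => ker_left alpha t s * y s)).
  have H : mu.-integrable `[a, t] (EFin \o (fun s => left_kernel a b alpha t s * y' s)).
    apply: integrableS (kernel_integrable ab hA hK hy tab) => //.
    by apply: subset_itvl.
  apply: eq_integrable H => // s; rewrite inE/= in_itv/= => /andP[as_ st].
  have sab : a <= s <= b by rewrite as_ (le_trans st).
  by rewrite left_kernelE// yy'.
have <- : \int[mu]_(s in `[a, T]) (ker_left alpha t s * y s) =
    kernel_integral (left_kernel a b alpha) a b (fun s => if s <= T then y' s else 0) t.
  apply: eq_Rintegral_sub => s /=.
  - by rewrite !in_itv/= => /andP[-> sT]; rewrite (le_trans sT)// (le_trans Tt).
  - rewrite in_itv/= => /andP[as_ sT].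
    have sab : a <= s <= b by rewrite as_ (le_trans sT)// (le_trans Tt).
    by rewrite sT left_kernelE ?yy'// (le_trans sT).
  - by rewrite !in_itv/= => /andP[-> sb]/= /negP/negbTE ->; rewrite mulr0.
have := Rintegral_itvB iy (x := T); rewrite !bnd_simp => /(_ aT Tt).
rewrite Rintegral_itv_obnd_cbnd; last by apply: integrableS iy => //; apply: subset_itvr; rewrite bnd_simp.
rewrite /kerint_left => <-; ring.
Qed.

Lemma RL_left_int_compl alpha p y t :
  RL_left_int (compl_order alpha) p y t = kerint_left alpha p y t.
Proof.
rewrite /RL_left_int /kerint_left /ker_left /compl_order.
by apply: eq_Rintegral => s _; rewrite (_ : 1 - alpha t s - 1 = - alpha t s)//; ring.
Qed.

End fractional_kernels.

(** * Derivatives within an interval, and primitives *)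

Section interval_derivatives.
Context {R : realType}.
Notation mu := (@lebesgue_measure R).
Implicit Types (a b p q t s : R) (f h k : R -> R).

Lemma is_derive_deriv_in p q t f d : p < q -> t \in `[p, q] ->
  is_derive t 1 f d ->
  derivable_in `[p, q] f t /\ deriv_in `[p, q] f t = d.
Proof.
move=> pq tpq /is_derive1_caratheodory[g [fg cg gt_]].
have PF := within_itv_dnbhs_proper pq tpq.
suff H : (fun s => (f s - f t) / (s - t)) @ within `[p, q] t^' --> d.
  by split; [apply/cvg_ex; exists d|exact: cvg_lim H].
have Hg : g @ within `[p, q] t^' --> d.
  rewrite -gt_; apply: cvg_trans cg; apply: cvg_app.
  by apply: cvg_trans (cvg_within _) _; exact: cvg_within.
apply: cvg_trans Hg; apply: near_eq_cvg.
have nst : within `[p, q] t^' [set s | s != t] := cvg_within _ (nbhs_dnbhs_neq t).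
by near=> s; rewrite fg mulfK// subr_eq0; near: s; exact: nst.
Unshelve. all: by end_near. Qed.

Lemma eq_deriv_in (D : set R) f h t : D t -> (forall s, D s -> f s = h s) ->
  (derivable_in D f t <-> derivable_in D h t) /\ deriv_in D f t = deriv_in D h t.
Proof.
move=> Dt fh.
have E : (fun s => (f s - f t) / (s - t)) @ within D t^' =
         (fun s => (h s - h t) / (s - t)) @ within D t^'.
  have FF : Filter (within D t^') by exact: within_filter.
  have wD : \forall s \near within D t^', D s by exact: withinT.
  by apply/seteqP; split; apply: near_eq_cvg; near=> s; rewrite !fh//; near: s; exact: wD.
by split; rewrite /derivable_in /deriv_in E.
Unshelve. all: by end_near. Qed.

Lemma derivable_in_continuous (D : set R) f : 
  (forall t, D t -> derivable_in D f t) -> {within D, continuous f}.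
Proof.
move=> df; apply/subspace_continuousP => t Dt.
have FF : Filter (within D t^') by exact: within_filter.
have fs : f @ within D t^' --> f t.
  have H : (fun s => (f s - f t) / (s - t) * (s - t) + f t) @ within D t^' -->
      deriv_in D f t * (t - t) + f t.
    apply: cvgD; last exact: cvg_cst.
    apply: cvgM; first exact: df.
    apply: cvgB; last exact: cvg_cst.
    by apply: cvg_trans (cvg_within _) _; exact: cvg_within.
  rewrite subrr mulr0 add0r in H.
  apply: cvg_trans H; apply: near_eq_cvg.
  have nst : within D t^' [set s | s != t] := cvg_within _ (nbhs_dnbhs_neq t).
  by near=> s; rewrite divfK ?subrK// subr_eq0; near: s; exact: nst.
apply/cvgrPdist_le => e e0.
move/cvgrPdist_le : fs => /(_ e e0) H.
have {H} : nbhs t [set s | D s -> s != t -> `|f t - f s| <= e].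
  have H' : nbhs t [set s | s != t -> D s -> `|f t - f s| <= e] by exact: H.
  by apply: filterS H' => s Hs Ds st; exact: Hs.
move=> H; have W : within D (nbhs t) [set s | `|f t - f s| <= e].
  apply: filterS H => s Hs Ds /=; have [->|st] := eqVneq s t; last exact: Hs.
  by rewrite subrr normr0 ltW.
exact: W.
Unshelve. all: by end_near. Qed.

(* The lower limit a - 1 instead of a makes [primitive a k] differentiable at [a] in
   the two-sided sense. *)
Definition primitive a k t : R :=
  \int[mu]_(s in `[a - 1, t]) k s - \int[mu]_(s in `[a - 1, a]) k s.

Lemma primitive_id a k : primitive a k a = 0.
Proof. exact: subrr. Qed.

Lemma continuous_integrable_itv a b k : continuous k ->
  mu.-integrable `[a, b] (EFin \o k).
Proof.
move=> ck; apply: continuous_compact_integrable; first exact: segment_compact.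
exact: continuous_subspaceT.
Qed.

Lemma primitive_derive a k t : continuous k -> a <= t ->
  is_derive t 1 (primitive a k) (k t).
Proof.
move=> ck a_t.
have ik : mu.-integrable `[a - 1, t + 1] (EFin \o k).
  exact: continuous_integrable_itv.
have [||dF Fk] := @continuous_FTC1_closed R k (a - 1) t (t + 1) _ ik _ (ck t).
- by rewrite ltrDl.
- lra.
- have dF' : is_derive t 1 (fun x => \int[mu]_(s in `[a - 1, x]) k s) (k t).
    by split; [exact: dF|rewrite -Fk derive1E].
  by rewrite -[k t]subr0; exact: is_deriveB.
Qed.

Lemma primitive_le a b k r t : continuous k -> a <= t <= b ->
  (forall s, a <= s <= b -> `|k s| <= r) -> `|primitive a k t| <= r * (b - a).
Proof.
move=> ck /andP[a_t tb] kr.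
have [c] : exists2 c, c \in `[a, t] & primitive a k t - primitive a k a = k c * (t - a).
  apply: MVT_segment => //.
    by move=> s; rewrite in_itv/= => /andP[as_ _]; apply: primitive_derive => //; exact: ltW.
  apply: derivable_within_continuous => s; rewrite in_itv/= => /andP[as_ _].
  by have [] := primitive_derive ck as_.
rewrite primitive_id subr0 in_itv/= => /andP[ac ct] ->.
rewrite normrM (ger0_norm (_ : 0 <= t - a)) ?subr_ge0//.
by rewrite ler_pM ?subr_ge0 ?kr ?ac ?(le_trans ct)// lerB.
Qed.

End interval_derivatives.

(** * Differentiability of the functional under uniform perturbations *)

Section uniform_differentiability.
Context {R : realType}.
Notation mu := (@lebesgue_measure R).
Implicit Types (a b s t u v du dv eps M : R).

Lemma mean_value_at (f df : R -> R) u du :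
  (forall w : R, is_derive w 1 f (df w)) ->
  exists2 c, `|c - u| <= `|du| & f (u + du) - f u = df c * du.
Proof.
move=> dfE.
have cf p q : {within `[p, q], continuous f}.
  by apply: derivable_within_continuous => s _; have [] := dfE s.
have [du0|du0] := leP 0 du.
  have [|c] := @MVT_segment _ f df u (u + du) _ _ (cf _ _); rewrite ?lerDl//.
  rewrite in_itv/= => /andP[uc cu]; rewrite addrAC subrr add0r => fE.
  by exists c => //; rewrite !ger0_norm ?subr_ge0//; lra.
have [|c] := @MVT_segment _ f df (u + du) u _ _ (cf _ _) => //; first lra.
rewrite in_itv/= => /andP[uc cu] fE.
exists c; first by rewrite ler0_norm ?subr_le0// ltr0_norm//; lra.
by rewrite -opprB fE; ring.
Qed.

(** A Heine argument in which only the base point ranges over a compact box, while [u'] and [v'] may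
    leave it. Compactness in its near-covering form yields one radius for all base points. *)
Lemma uniformly_continuous_box a b M eps (f : R * R * R -> R) :
  continuous f -> 0 < eps ->
  exists2 d, 0 < d & forall t u v u' v', a <= t <= b -> `|u| <= M -> `|v| <= M ->
    `|u' - u| <= d -> `|v' - v| <= d -> `|f (t, u', v') - f (t, u, v)| <= eps.
Proof.
move=> cf e0.
have cK := compact_setX (compact_setX (@segment_compact R a b) (@segment_compact R (- M) M))
  (@segment_compact R (- M) M).
pose P d (w : R * R * R) := forall u' v', `|u' - w.1.2| <= d -> `|v' - w.2| <= d ->
  `|f (w.1.1, u', v') - f w| <= eps.
have /compact_near_coveringP H := cK.
have HP : forall w, (`[a, b] `*` `[- M, M] `*` `[- M, M])%classic w ->
    \forall w' \near w & d \near (0 : R)^'+, P d w'.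
  move=> w _; have e20 : 0 < eps / 2 by rewrite divr_gt0.
  have /cvgrPdist_le/(_ _ e20)/nbhs_ballP[r /= r0 Hr] := cf w.
  have r20 : 0 < r / 2 by rewrite divr_gt0.
  (* Half of [r] for the base point and half for the displacement keep both evaluation points within
     [r] of [w]. *)
  exists (ball w (r / 2), [set d | d < r / 2]) => /=.
    by split; [exact: nbhsx_ballx|exact: nbhs_right_lt].
  move=> -[w' d] /= [[[w1 w2] w3] dr] u' v' u'd v'd.
  have B1 : ball w r w'.
    by split; [split|]; move: w1 w2 w3; rewrite /ball/= => *; lra.
  have B2 : ball w r (w'.1.1, u', v').
    split; [split|] => /=; move: w1 w2 w3; rewrite /ball/= => w1 w2 w3; first lra.
      rewrite (_ : w.1.2 - u' = (w.1.2 - w'.1.2) - (u' - w'.1.2)); last by ring.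
      by rewrite (le_lt_trans (ler_normB _ _))//; lra.
    rewrite (_ : w.2 - v' = (w.2 - w'.2) - (v' - w'.2)); last by ring.
    by rewrite (le_lt_trans (ler_normB _ _))//; lra.
  have := Hr _ B1; have := Hr _ B2; rewrite /=.
  move: (f w) (f w') (f _) => p q p'.
  by rewrite !ler_distl => /andP[? ?] /andP[? ?]; apply/andP; split; lra.
have FF : Filter (0 : R)^'+ by exact: at_right_proper_filter.
have [d [d0 /= Hd]] := @filter_ex _ _ (at_right_proper_filter (0 : R)) _
  (filterI (nbhs_right_gt (0 : R)) (H R (0 : R)^'+ P FF HP)).
exists d => // t u v u' v' tab uM vM.
apply: (Hd (t, u, v)); rewrite /= !in_itv/= -!ler_norml tab; split => //.
Qed.

Lemma C1_3_is_derive2 a b z t u v : C1_3 a b z -> a <= t <= b ->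
  is_derive u 1 (fun w : R => z t w v) (partial2 z t u v).
Proof.
move=> [dz _ _ _] tab; have [|_ d2 _] := dz t u v; first by rewrite in_itv.
by split => //; rewrite /partial2 derive1E.
Qed.

Lemma C1_3_is_derive3 a b z t u v : C1_3 a b z -> a <= t <= b ->
  is_derive v 1 (fun w : R => z t u w) (partial3 z t u v).
Proof.
move=> [dz _ _ _] tab; have [|_ _ d3] := dz t u v; first by rewrite in_itv.
by split => //; rewrite /partial3 derive1E.
Qed.

Lemma continuous_clamp3 a b (f : R -> R -> R -> R) : a <= b ->
  {within [set w : R * R * R | w.1.1 \in `[a, b]],
    continuous (fun w => f w.1.1 w.1.2 w.2)} ->
  continuous (fun w : R * R * R => f (clamp a b w.1.1) w.1.2 w.2).
Proof.
move=> ab cf w.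
have H := @continuous_comp_within (R * R * R)%type _ _ _
  (fun w : R * R * R => f w.1.1 w.1.2 w.2)
  (fun w : R * R * R => (clamp a b w.1.1, w.1.2, w.2)) w cf.
apply: H; last by move=> x /=; rewrite in_itv/= clamp_itv.
have c1 : {for w, continuous (fun w : R * R * R => w.1)} by exact: cvg_fst.
apply: continuous_pair; last exact: cvg_snd.
apply: continuous_pair.
  apply: (@continuous_comp _ _ _ (fun w : R * R * R => w.1.1) (clamp a b)).
    by apply: (@continuous_comp _ _ _ fst fst); [exact: c1|exact: cvg_fst].
  exact: clamp_continuous.
by apply: (@continuous_comp _ _ _ fst snd); [exact: c1|exact: cvg_snd].
Qed.

Lemma C1_3_partial_bound a b z M : a <= b -> C1_3 a b z ->
  exists2 B, 0 < B & forall t u v, a <= t <= b -> `|u| <= M -> `|v| <= M ->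
    `|partial2 z t u v| <= B /\ `|partial3 z t u v| <= B.
Proof.
move=> ab [_ _ c2 c3].
have cK := compact_setX (compact_setX (@segment_compact R a b) (@segment_compact R (- M) M))
  (@segment_compact R (- M) M).
have [B2 B20 H2] := compact_norm_bounded cK (continuous_subspaceT (continuous_clamp3 ab c2)).
have [B3 B30 H3] := compact_norm_bounded cK (continuous_subspaceT (continuous_clamp3 ab c3)).
exists (B2 + B3); first exact: addr_gt0.
move=> t u v tab uM vM.
have Ktuv : (`[a, b] `*` `[- M, M] `*` `[- M, M])%classic (t, u, v).
  by rewrite /= !in_itv/= -!ler_norml.
have := H2 _ Ktuv; have := H3 _ Ktuv; rewrite /= clamp_id//.
move=> h3 h2; split; first by rewrite (le_trans h2)// lerDl ltW.
by rewrite (le_trans h3)// lerDr ltW.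
Qed.

(** The increment is split at [(u, v + dv)] and the mean value theorem is applied in each variable;
    the partial derivatives vary little by [uniformly_continuous_box]. The radius [d] does not
    depend on [t], so that the estimate can be integrated. *)
Lemma C1_3_taylor a b z M eps : a <= b -> C1_3 a b z -> 0 < eps ->
  exists2 d, 0 < d & forall t u v du dv, a <= t <= b -> `|u| <= M -> `|v| <= M ->
    `|du| <= d -> `|dv| <= d ->
    `|z t (u + du) (v + dv) - z t u v -
       (partial2 z t u v * du + partial3 z t u v * dv)| <= eps * (`|du| + `|dv|).
Proof.
move=> ab hz e0; have [_ _ c2 c3] := hz.
have [d2 d20 H2] := uniformly_continuous_box a b M (continuous_clamp3 ab c2) e0.
have [d3 d30 H3] := uniformly_continuous_box a b M (continuous_clamp3 ab c3) e0.
exists (Num.min d2 d3) => [|t u v du dv tab uM vM]; first by rewrite lt_min d20.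
rewrite !le_min => /andP[du2 du3] /andP[dv2 dv3].
have [c cu zc] := mean_value_at u du (fun w => C1_3_is_derive2 w (v + dv) hz tab).
have [e ev ze] := mean_value_at v dv (fun w => C1_3_is_derive3 u w hz tab).
have := H2 t u v c (v + dv) tab uM vM; rewrite /= clamp_id// (addrC v) addrK.
move=> /(_ (le_trans cu du2) dv2) h2.
have := H3 t u v u e tab uM vM; rewrite /= clamp_id// subrr normr0 (ltW d30).
move=> /(_ isT (le_trans ev dv3)) h3.
rewrite (_ : _ - _ = (partial2 z t c (dv + v) - partial2 z t u v) * du +
   (partial3 z t u e - partial3 z t u v) * dv); last first.
  by rewrite !mulrBl (addrC dv) -zc -ze; ring.
by rewrite (le_trans (ler_normD _ _))// mulrDr !normrM lerD// ler_wpM2r.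
Qed.

Lemma C1_3_lipschitz a b z M : a <= b -> C1_3 a b z ->
  exists d B, [/\ 0 < d, 0 < B & forall t u v du dv,
    a <= t <= b -> `|u| <= M -> `|v| <= M -> `|du| <= d -> `|dv| <= d ->
    `|z t (u + du) (v + dv) - z t u v| <= B * (`|du| + `|dv|)].
Proof.
move=> ab hz.
have [B B0 HB] := C1_3_partial_bound M ab hz.
have [d d0 Hd] := C1_3_taylor M ab hz ltr01.
exists d, (1 + B); split => //; first exact: addr_gt0.
move=> t u v du dv tab uM vM dud dvd.
have [h2 h3] := HB t u v tab uM vM; have := Hd _ _ _ _ _ tab uM vM dud dvd.
rewrite -[z t (u + du) (v + dv) - z t u v](subrK (partial2 z t u v * du + partial3 z t u v * dv)).
move: (_ - _ - _) => r; rewrite addrK => hr.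
rewrite (le_trans (ler_normD _ _))// [leRHS]mulrDl lerD//.
rewrite (le_trans (ler_normD _ _))// mulrDr !normrM.
by rewrite lerD// ler_wpM2r.
Qed.

(** [C1_3] asks for derivatives in each variable separately. Joint continuity combines a Lipschitz
    bound in the last two variables, uniform in the first, with continuity in the first at fixed
    [u0] and [v0]. *)
Lemma C1_3_continuous a b z : a <= b -> C1_3 a b z ->
  continuous (fun w : R * R * R => z (clamp a b w.1.1) w.1.2 w.2).
Proof.
move=> ab hz [[t0 u0] v0].
have [d [B [d0 B0 HB]]] := C1_3_lipschitz (`|u0| + `|v0|) ab hz.
have ct : (fun w : R * R * R => z (clamp a b w.1.1) u0 v0) @ (t0, u0, v0) -->
    z (clamp a b t0) u0 v0.
  have cz : {within `[a, b], continuous (fun s => z s u0 v0)}.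
    apply: derivable_in_continuous => s sab.
    by have [dz _ _ _] := hz; have [] := dz s u0 v0 sab.
  apply: (@cvg_comp _ _ _ (fun w : R * R * R => w.1.1) (fun s => z (clamp a b s) u0 v0) _ (nbhs t0)).
    by apply: (@cvg_comp _ _ _ fst fst _ (nbhs (t0, u0))); exact: cvg_fst.
  exact: (continuous_clamp ab cz).
have cu : (fun w : R * R * R => `|w.1.2 - u0|) @ (t0, u0, v0) --> `|u0 - u0|.
  apply: cvg_norm; apply: cvgB; last exact: cvg_cst.
  by apply: (@cvg_comp _ _ _ fst snd _ (nbhs (t0, u0))); [exact: cvg_fst|exact: cvg_snd].
have cv : (fun w : R * R * R => `|w.2 - v0|) @ (t0, u0, v0) --> `|v0 - v0|.
  by apply: cvg_norm; apply: cvgB; [exact: cvg_snd|exact: cvg_cst].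
apply/cvgrPdist_le => e e0.
have [r [r0 rd re]] : exists r, [/\ 0 < r, r <= d & B * (r + r) <= e / 2].
  exists (Num.min d (e / (4 * B))); split; last 2 first.
  - by rewrite ge_min lexx.
  - have : Num.min d (e / (4 * B)) <= e / (4 * B) by rewrite ge_min lexx orbT.
    move: (Num.min _ _) => m hm; rewrite -ler_pdivlMl// (le_trans (lerD hm hm))//.
    by rewrite le_eqVlt; apply/orP; left; apply/eqP; field; rewrite gt_eqF.
  - by rewrite lt_min d0 divr_gt0// mulr_gt0.
near=> w.
have wu : `|w.1.2 - u0| <= r.
  by apply: ltW; near: w; apply: (cvgr_lt _ cu); rewrite subrr normr0.
have wv : `|w.2 - v0| <= r.
  by apply: ltW; near: w; apply: (cvgr_lt _ cv); rewrite subrr normr0.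
have wt : `|z (clamp a b t0) u0 v0 - z (clamp a b w.1.1) u0 v0| <= e / 2.
  by near: w; move/cvgrPdist_le : ct; apply; rewrite divr_gt0.
have := HB (clamp a b w.1.1) u0 v0 (w.1.2 - u0) (w.2 - v0) (clamp_itv _ ab).
rewrite lerDl lerDr !normr_ge0 => /(_ isT isT (le_trans wu rd) (le_trans wv rd)).
rewrite !(addrC u0) !(addrC v0) !subrK => hB.
have {hB} := le_trans hB (le_trans (ler_wpM2l (ltW B0) (lerD wu wv)) re).
move: wt => /=; move: (z _ _ _) (z _ _ _) (z _ _ _) => p q p'.
by rewrite !ler_distl => /andP[? ?] /andP[? ?]; apply/andP; split; lra.
Unshelve. all: by end_near. Qed.

End uniform_differentiability.

(** * Integral functionals with a moving end time *)

Section integral_functionals.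
Context {R : realType}.
Notation mu := (@lebesgue_measure R).
Implicit Types (a b s t eps M : R) (k : R -> R) (z : R -> R -> R -> R).

Lemma Rintegral_primitive a k t : continuous k -> a <= t ->
  \int[mu]_(s in `[a, t]) k s = primitive a k t.
Proof.
move=> ck a_t; rewrite /primitive.
have ik : mu.-integrable `[a - 1, t] (EFin \o k) by exact: continuous_integrable_itv.
have := Rintegral_itvB ik (x := a); rewrite !bnd_simp => ->//; last by rewrite gerBl.
rewrite Rintegral_itv_obnd_cbnd//.
by apply: integrableS ik => //; apply: subset_itvr; rewrite bnd_simp gerBl.
Qed.

Lemma primitive_mean_value a b k p q : continuous k -> a <= p <= b -> a <= q <= b ->
  exists c, [/\ a <= c <= b, `|c - p| <= `|q - p| &
    primitive a k q - primitive a k p = k c * (q - p)].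
Proof.
move=> ck /andP[ap pb] /andP[aq qb].
have seg u v : a <= u -> u <= v -> v <= b ->
    exists2 c, c \in `[u, v] & primitive a k v - primitive a k u = k c * (v - u).
  move=> au uv vb; apply: MVT_segment => //.
    move=> s; rewrite in_itv/= => /andP[us _]; apply: primitive_derive => //.
    exact: le_trans (ltW us).
  apply: derivable_within_continuous => s; rewrite in_itv/= => /andP[us _].
  by have [] := primitive_derive ck (le_trans au us).
have [pq|qp] := leP p q.
  have [c] := seg p q ap pq qb; rewrite in_itv/= => /andP[pc cq] E; exists c; split => //.
    by rewrite (le_trans ap)// (le_trans cq).
  by rewrite !ger0_norm ?subr_ge0// lerB.
have [c] := seg q p aq (ltW qp) pb; rewrite in_itv/= => /andP[qc cp] E; exists c; split => //.
- by rewrite (le_trans aq)// (le_trans cp).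
- by rewrite !ler0_norm ?subr_le0 ?(ltW qp)// lerN2 lerB.
- by rewrite -opprB E; ring.
Qed.

Lemma continuous_nemytskii a b (f : R -> R -> R -> R) (U V : R -> R) :
  continuous (fun w : R * R * R => f (clamp a b w.1.1) w.1.2 w.2) ->
  continuous U -> continuous V -> continuous (fun t => f (clamp a b t) (U t) (V t)).
Proof.
move=> cf cU cV t.
apply: (@continuous_comp _ _ _ (fun t => (t, U t, V t))
  (fun w : R * R * R => f (clamp a b w.1.1) w.1.2 w.2)); last exact: cf.
apply: continuous_pair; last exact: cV.
by apply: continuous_pair; [exact: cvg_id|exact: cU].
Qed.

(** The motion of the end time contributes a mean value of the perturbed integrand near [T], the
    motion of the state a Taylor expansion under the integral over [a, T]. The errors are
    [eps * |sigma|] and [eps / 2 * r]. *)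
Lemma integral_frechet a b T z (U V : R -> R) eps : a < b -> a <= T <= b ->
  C1_3 a b z -> continuous U -> continuous V -> 0 < eps ->
  exists2 d, 0 < d & forall (sigma r : R) (du dv : R -> R),
    continuous du -> continuous dv ->
    (forall t, a <= t <= b -> `|du t| <= r /\ `|dv t| <= r) ->
    `|sigma| <= d -> r <= d -> a <= T + sigma <= b ->
    `|\int[mu]_(t in `[a, T + sigma]) z t (U t + du t) (V t + dv t) -
      \int[mu]_(t in `[a, T]) z t (U t) (V t) -
      (sigma * z T (U T) (V T) +
       \int[mu]_(t in `[a, T]) (partial2 z t (U t) (V t) * du t +
                                partial3 z t (U t) (V t) * dv t))| <=
    eps * (`|sigma| + r).
Proof.
move=> ab Tab hz cU cV e0; have /andP[aT Tb] := Tab; have abW := ltW ab.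
have ba0 : 0 < b - a by rewrite subr_gt0.
have [M1 M10 HM1] := compact_norm_bounded (@segment_compact R a b) (continuous_subspaceT cU).
have [M2 M20 HM2] := compact_norm_bounded (@segment_compact R a b) (continuous_subspaceT cV).
have UM t : a <= t <= b -> `|U t| <= M1 + M2.
  by move=> tab; rewrite (le_trans (HM1 t _)) ?lerDl ?ltW//= in_itv.
have VM t : a <= t <= b -> `|V t| <= M1 + M2.
  by move=> tab; rewrite (le_trans (HM2 t _)) ?lerDr ?ltW//= in_itv.
(* With increments of at most [r] in both variables, integration over a length of at most [b - a]
   turns this into [eps / 2 * r]. *)
have e10 : 0 < eps / (4 * (b - a)) by rewrite divr_gt0// mulr_gt0.
have [d1 d10 H1] := C1_3_taylor (M1 + M2) abW hz e10.
have [d2 [B [d20 B0 H2]]] := C1_3_lipschitz (M1 + M2) abW hz.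
have cz := C1_3_continuous abW hz.
pose k0 t := z (clamp a b t) (U t) (V t).
have ck0 : continuous k0 by exact: continuous_nemytskii.
have [d3 d30 H3] : exists2 d, 0 < d & forall t, `|t - T| <= d -> `|k0 t - k0 T| <= eps / 2.
  have e20 : 0 < eps / 2 by rewrite divr_gt0.
  have /cvgrPdist_le/(_ _ e20)/nbhs_ballP[d /= d0 Hd] := ck0 T.
  exists (d / 2) => [|t tT]; first by rewrite divr_gt0.
  by rewrite distrC; apply: Hd; rewrite /ball/= distrC; lra.
(* The bound [eps / (4 * B)] is for the Lipschitz estimate at a common time:
   [B * (r + r) <= eps / 2]. *)
pose d := Num.min (Num.min d1 d2) (Num.min d3 (eps / (4 * B))).
have d0 : 0 < d by rewrite !lt_min d10 d20 d30/= divr_gt0// mulr_gt0.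
exists d => // sigma r du dv cdu cdv Hr; rewrite /d.
rewrite !le_min => /andP[/andP[sd1 sd2] /andP[sd3 sd4]] /andP[/andP[rd1 rd2] /andP[rd3 rd4]] Tsab.
have r0 : 0 <= r by have [+ _] := Hr T Tab; exact: le_trans.
pose k1 t := z (clamp a b t) (U t + du t) (V t + dv t).
have ck1 : continuous k1.
  by apply: continuous_nemytskii => // t; apply: cvgD; [exact: cU|exact: cdu|exact: cV|exact: cdv].
pose l t := partial2 z (clamp a b t) (U t) (V t) * du t +
  partial3 z (clamp a b t) (U t) (V t) * dv t.
have cl : continuous l.
  have [_ _ c2 c3] := hz.
  have cp2 := continuous_nemytskii (continuous_clamp3 abW c2) cU cV.
  have cp3 := continuous_nemytskii (continuous_clamp3 abW c3) cU cV.
  by move=> t; apply: cvgD; apply: cvgM; [exact: cp2|exact: cdu|exact: cp3|exact: cdv].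
have -> : \int[mu]_(t in `[a, T + sigma]) z t (U t + du t) (V t + dv t) =
    \int[mu]_(t in `[a, T + sigma]) k1 t.
  apply: eq_Rintegral => t; rewrite inE/= in_itv/= => /andP[a_t tT].
  by rewrite /k1 clamp_id// a_t (le_trans tT)//; case/andP: Tsab.
have -> : \int[mu]_(t in `[a, T]) z t (U t) (V t) = \int[mu]_(t in `[a, T]) k0 t.
  apply: eq_Rintegral => t; rewrite inE/= in_itv/= => /andP[a_t tT].
  by rewrite /k0 clamp_id// a_t (le_trans tT).
have -> : \int[mu]_(t in `[a, T]) (partial2 z t (U t) (V t) * du t +
    partial3 z t (U t) (V t) * dv t) = \int[mu]_(t in `[a, T]) l t.
  apply: eq_Rintegral => t; rewrite inE/= in_itv/= => /andP[a_t tT].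
  by rewrite /l clamp_id// a_t (le_trans tT).
have -> : z T (U T) (V T) = k0 T by rewrite /k0 clamp_id.
pose m t := k1 t - k0 t - l t.
have cm : continuous m.
  by move=> t; apply: cvgB; [apply: cvgB; [exact: ck1|exact: ck0]|exact: cl].
have mE : \int[mu]_(t in `[a, T]) m t = \int[mu]_(t in `[a, T]) k1 t -
    \int[mu]_(t in `[a, T]) k0 t - \int[mu]_(t in `[a, T]) l t.
  have i1 := @continuous_integrable_itv R a T _ ck1.
  have i0 := @continuous_integrable_itv R a T _ ck0.
  have il := @continuous_integrable_itv R a T _ cl.
  by rewrite RintegralB//; [rewrite RintegralB|exact: integrable_realB].
have mle : `|\int[mu]_(t in `[a, T]) m t| <= eps / 2 * r.
  rewrite Rintegral_primitive//.
  have Hm s : a <= s <= b -> `|m s| <= eps / (4 * (b - a)) * (r + r).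
    move=> sab; have [dur dvr] := Hr s sab.
    rewrite /m /k1 /k0 /l clamp_id// (le_trans (H1 s _ _ _ _ sab _ _ _ _)) ?UM ?VM//.
    - exact: le_trans rd1.
    - exact: le_trans rd1.
    - by rewrite ler_wpM2l ?(ltW e10)// lerD.
  apply: le_trans (primitive_le cm Tab Hm) _.
  by rewrite le_eqVlt; apply/orP; left; apply/eqP; field; rewrite gt_eqF.
have sle : `|\int[mu]_(t in `[a, T + sigma]) k1 t - \int[mu]_(t in `[a, T]) k1 t -
    sigma * k0 T| <= eps * `|sigma|.
  rewrite !Rintegral_primitive//; last by case/andP: Tsab.
  have [c [cab cT ->]] := primitive_mean_value ck1 Tab Tsab.
  rewrite (_ : _ - _ = (k1 c - k0 T) * sigma); last by ring.
  move: cT; rewrite addrAC subrr add0r => cT.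
  rewrite normrM ler_wpM2r//.
  have [dur dvr] := Hr c cab.
  have k1c : `|k1 c - k0 c| <= eps / 2.
    rewrite /k1 /k0 clamp_id//; apply: (@le_trans _ _ (B * (r + r))).
      apply: le_trans (H2 c _ _ _ _ cab (UM c cab) (VM c cab) _ _) _.
      - exact: le_trans rd2.
      - exact: le_trans rd2.
      - by rewrite ler_wpM2l ?(ltW B0)// lerD.
    rewrite -ler_pdivlMl// (le_trans (lerD rd4 rd4))//.
    by rewrite le_eqVlt; apply/orP; left; apply/eqP; field; rewrite gt_eqF.
  have k0c := H3 c (le_trans cT sd3).
  rewrite -(subrK (k0 c) (k1 c)) -addrA (le_trans (ler_normD _ _))//.
  by rewrite (splitr eps) lerD.
rewrite (_ : _ - _ - _ = (\int[mu]_(t in `[a, T + sigma]) k1 t - \int[mu]_(t in `[a, T]) k1 t -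
    sigma * k0 T) + \int[mu]_(t in `[a, T]) m t); last by rewrite mE; ring.
rewrite (le_trans (ler_normD _ _))// mulrDr lerD// (le_trans mle)// ler_wpM2r//.
by rewrite ler_pdivrMr// ler_peMr ?(ltW e0)// ler1n.
Qed.

End integral_functionals.

(** * A multiplier rule for two parameters *)

Section multiplier_rule.
Context {R : realType}.

Definition frechet_at0 (J : R -> R -> R) (P Q : R) : Prop :=
  forall eps : R, 0 < eps -> exists2 d : R, 0 < d & forall e1 e2 : R,
    `|e1| <= d -> `|e2| <= d ->
    `|J e1 e2 - J 0 0 - (P * e1 + Q * e2)| <= eps * (`|e1| + `|e2|).

(* The constraint is only differentiable at the origin, so the implicit function
   theorem does not apply; the intermediate value theorem on the segment of
   radius [eta * tau] around the tangent direction replaces it. *)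
Lemma multiplier_rule (J G : R -> R -> R) (P Q A B : R) :
  G 0 0 = 0 -> B != 0 -> frechet_at0 J P Q -> frechet_at0 G A B ->
  (exists2 d : R, 0 < d & forall e1 e2, `|e1| <= d -> `|e2| <= d ->
    {for e2, continuous (G e1)}) ->
  (exists2 d : R, 0 < d & forall e1 e2, `|e1| <= d -> `|e2| <= d ->
    G e1 e2 = 0 -> J 0 0 <= J e1 e2) ->
  P - Q / B * A = 0.
Proof.
move=> G0 B0 JPQ GAB [dc dc0 Gc] [dm dm0 Jm].
apply/eqP/negPn/negP => c0.
(* The vector [(1, m)] spans the kernel of the derivative of [G], and [c] is the derivative of [J]
   along it. *)
pose c := P - Q / B * A; pose m := - (A / B).
have c0' : c != 0 by [].
have cE : P + Q * m = c by rewrite /c /m; field.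
have ABm : A + B * m = 0 by rewrite /m; field.
have ac0 : 0 < `|c| by rewrite normr_gt0.
have aB0 : 0 < `|B| by rewrite normr_gt0.
(* A deviation of [eta * tau] from the tangent changes the linear part of [J] by at most
   [|c| / 4 * tau]. *)
pose eta := `|c| / (4 * (`|Q| + 1)).
have Q10 : 0 < `|Q| + 1 by rewrite ltr_wpDl.
have eta0 : 0 < eta by rewrite divr_gt0// mulr_gt0.
have Qeta : `|Q| * eta <= `|c| / 4.
  rewrite /eta (_ : `|Q| * _ = `|c| / 4 * (`|Q| / (`|Q| + 1))); last by field; rewrite gt_eqF.
  by rewrite ler_piMr ?divr_ge0// ler_pdivrMr// mul1r lerDl.
pose K := 1 + `|m| + eta.
have K0 : 0 < K by rewrite /K ltr_wpDl// addr_ge0.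
(* The first bound keeps the remainder of [J] within [|c| / 4 * tau], the second that of [G] within
   half of [|B| * eta * tau], the size of its linear part at the ends of the segment. *)
pose eps := Num.min (`|c| / (4 * K)) (`|B| * eta / (2 * K)).
have eps0 : 0 < eps by rewrite lt_min !divr_gt0 ?mulr_gt0.
have [d1 d10 H1] := JPQ eps eps0.
have [d2 d20 H2] := GAB eps eps0.
pose d := Num.min (Num.min d1 d2) (Num.min dc dm).
have d0 : 0 < d by rewrite !lt_min d10 d20 dc0.
pose tau := d / K.
have tau0 : 0 < tau by rewrite divr_gt0.
have tauK : tau * K = d by rewrite /tau divfK// gt_eqF.
(* The sign is chosen so that [c * e1 = - (|c| * tau)], a decrease of [J]. *)
pose e1 := - (Num.sg c * tau).
have ae1 : `|e1| = tau.
  by rewrite /e1 normrN normrM normr_sg c0' mul1r gtr0_norm.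
have e1d : `|e1| <= d.
  by rewrite ae1 -tauK -[leLHS]mulr1 ler_wpM2l ?(ltW tau0)// /K -addrA lerDl addr_ge0 ?(ltW eta0).
have e2K e2 : `|e2 - m * e1| <= eta * tau -> `|e2| <= `|m| * tau + eta * tau.
  move=> h; rewrite -(subrK (m * e1) e2) (le_trans (ler_normD _ _))// addrC.
  by rewrite lerD// normrM ae1.
have e12K e2 : `|e2 - m * e1| <= eta * tau -> `|e1| + `|e2| <= d.
  move=> /e2K h; rewrite -tauK ae1 (le_trans (lerD (lexx tau) h))//.
  by rewrite le_eqVlt; apply/orP; left; apply/eqP; rewrite /K; ring.
have e2d e2 : `|e2 - m * e1| <= eta * tau -> `|e2| <= d.
  by move=> /e12K; apply: le_trans; rewrite lerDr.
have [dd1 dd2 ddc ddm] : [/\ d <= d1, d <= d2, d <= dc & d <= dm].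
  by split; rewrite /d !ge_min lexx ?orbT.
have epsd : eps * d <= `|c| / 4 * tau /\ eps * d <= `|B| * eta / 2 * tau.
  have E1 : eps <= `|c| / (4 * K) by rewrite /eps ge_min lexx.
  have E2 : eps <= `|B| * eta / (2 * K) by rewrite /eps ge_min lexx orbT.
  split.
    apply: le_trans (ler_wpM2r (ltW d0) E1) _; rewrite -tauK.
    by rewrite le_eqVlt; apply/orP; left; apply/eqP; field; rewrite gt_eqF.
  apply: le_trans (ler_wpM2r (ltW d0) E2) _; rewrite -tauK.
  by rewrite le_eqVlt; apply/orP; left; apply/eqP; field; rewrite gt_eqF.
have [epsd1 epsd2] := epsd.
have Gest e2 : `|e2 - m * e1| <= eta * tau ->
    `|G e1 e2 - B * (e2 - m * e1)| <= `|B| * eta / 2 * tau.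
  move=> h; have := H2 e1 e2 (le_trans e1d dd2) (le_trans (e2d _ h) dd2).
  rewrite G0 subr0 (_ : A * e1 + B * e2 = B * (e2 - m * e1)); last first.
    by rewrite -[RHS]addr0 -(mul0r e1) -ABm; ring.
  move=> /le_trans; apply; apply: le_trans epsd2.
  by rewrite ler_wpM2l ?(ltW eps0)// e12K.
have [e2 e2near Ge2] : exists2 e2, `|e2 - m * e1| <= eta * tau & G e1 e2 = 0.
  pose p := m * e1 - eta * tau; pose q := m * e1 + eta * tau.
  have et0 : 0 < eta * tau by exact: mulr_gt0.
  have pq : p <= q by rewrite /p /q; lra.
  have pn : `|p - m * e1| <= eta * tau.
    by rewrite /p addrAC subrr add0r normrN gtr0_norm.
  have qn : `|q - m * e1| <= eta * tau.
    by rewrite /q addrAC subrr add0r gtr0_norm.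
  have near_pq e2 : e2 \in `[p, q] -> `|e2 - m * e1| <= eta * tau.
    by rewrite in_itv/= /p /q ler_distl.
  have cG : {within `[p, q], continuous (G e1)}.
    apply: continuous_in_subspaceT => e2; rewrite inE/= => /near_pq h.
    by apply: Gc; [exact: le_trans ddc|exact: le_trans (e2d _ h) ddc].
  (* At the two ends the linear part of [G] is plus or minus [B * (eta * tau)] and outweighs the
     remainder, so [G e1] changes sign. *)
  have [] := @IVT _ (G e1) p q 0 pq cG.
    have := Gest p pn; have := Gest q qn.
    rewrite (_ : p - m * e1 = - (eta * tau)); last by rewrite /p; ring.
    rewrite (_ : q - m * e1 = eta * tau); last by rewrite /q; ring.
    have B_et : `|B * (eta * tau)| = `|B| * eta * tau.
      by rewrite normrM (gtr0_norm et0) mulrA.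
    have Bet0 : 0 < `|B| * eta * tau by rewrite -mulrA mulr_gt0.
    have -> : `|B| * eta / 2 * tau = `|B| * eta * tau / 2 by rewrite mulrAC.
    have [Bp|Bn] := leP 0 (B * (eta * tau)).
      move: B_et; rewrite ger0_norm// => B_et.
      rewrite mulrN B_et !ler_distl => /andP[h1 h2] /andP[h3 h4].
      rewrite ge_min le_max; apply/andP; split; apply/orP; [left|right]; clear - Bet0 h1 h2 h3 h4; lra.
    move: B_et; rewrite ltr0_norm// => B_et.
    have {}B_et : B * (eta * tau) = - (`|B| * eta * tau) by rewrite -B_et opprK.
    rewrite mulrN B_et !ler_distl => /andP[h1 h2] /andP[h3 h4].
    rewrite ge_min le_max; apply/andP; split; apply/orP; [right|left]; clear - Bet0 h1 h2 h3 h4; lra.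
  by move=> e2 /near_pq h Ge2; exists e2.
(* Slope, deviation and remainder add up to at most [- (|c| * tau) / 2], against minimality. *)
have := Jm e1 e2 (le_trans e1d ddm) (le_trans (e2d _ e2near) ddm) Ge2.
have := H1 e1 e2 (le_trans e1d dd1) (le_trans (e2d _ e2near) dd1).
move=> /le_trans-/(_ _ (ler_wpM2l (ltW eps0) (e12K _ e2near))) /le_trans-/(_ _ epsd1).
rewrite (_ : P * e1 + Q * e2 = c * e1 + Q * (e2 - m * e1)); last by rewrite -cE; ring.
have -> : c * e1 = - (`|c| * tau).
  by rewrite /e1 normrEsg; ring.
have : `|Q * (e2 - m * e1)| <= `|c| / 4 * tau.
  rewrite normrM (le_trans (ler_wpM2l _ e2near))// mulrA ler_wpM2r// ltW//.
have ct0 : 0 < `|c| * tau by exact: mulr_gt0.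
by rewrite ler_norml ler_distl => /andP[h1 h2] /andP[h3 h4] h5; clear - ct0 h1 h2 h3 h4 h5; lra.
Qed.

End multiplier_rule.

(** * First-order expansion of the terminal cost *)

Section endpoint_expansions.
Context {R : realType}.
Implicit Types (a b s t eps T : R) (f x : R -> R).

Lemma derivable_in_expansion (D : set R) f t eps : derivable_in D f t -> 0 < eps ->
  exists2 d, 0 < d & forall s, D s -> `|s - t| <= d ->
    `|f s - f t - deriv_in D f t * (s - t)| <= eps * `|s - t|.
Proof.
move=> df e0; move/cvgrPdist_le : df => /(_ eps e0) H.
have H' : nbhs t [set s | s != t -> D s ->
  `|deriv_in D f t - (f s - f t) / (s - t)| <= eps] by exact: H.
have /nbhs_ballP[d /= d0 Hd] := H'.
exists (d / 2) => [|s Ds sd]; first by rewrite divr_gt0.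
have [->|st] := eqVneq s t; first by rewrite !subrr mulr0 subr0 normr0 mulr0.
have st0 : s - t != 0 by rewrite subr_eq0.
have -> : f s - f t - deriv_in D f t * (s - t) =
    - (deriv_in D f t - (f s - f t) / (s - t)) * (s - t) by field.
rewrite normrM normrN ler_wpM2r//; apply: Hd => //.
by rewrite /ball/= distrC; lra.
Qed.

(** The time moves at the fixed state [x T], by derivability there; the state moves at the fixed
    time [T + sigma], by the mean value theorem and the joint continuity of [dphi2]. The chain rule
    for [x] supplies the third error term. *)
Lemma C1_2_expansion a b phi x T eps : a < T < b -> C1_2 a b phi ->
  derivable_in `[a, b] x T -> 0 < eps ->
  exists2 d, 0 < d & forall sigma dd : R, `|sigma| <= d -> `|dd| <= d ->
    `|phi (T + sigma) (x (T + sigma) + dd) - phi T (x T) -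
      ((dphi1 a b phi T (x T) + dphi2 phi T (x T) * deriv_in `[a, b] x T) * sigma +
       dphi2 phi T (x T) * dd)| <= eps * (`|sigma| + `|dd|).
Proof.
move=> /andP[aT Tb] [dphi _ c2] dx e0.
have Tab : T \in `[a, b] by rewrite in_itv/= !ltW.
pose x' := deriv_in `[a, b] x T; pose u := x T; pose p2 := dphi2 phi T u.
(* Near [T] the variation of [x] is at most [K * |sigma|]; the minimum with 1 in [e20] serves this
   bound. *)
pose K := `|x'| + 1.
have K1 : 1 <= K by rewrite /K lerDr.
have K0 : 0 < K by exact: lt_le_trans ltr01 K1.
have p0 : 0 < `|p2| + 1 by rewrite ltr_wpDl.
have e30 : 0 < eps / (3 * K) by rewrite divr_gt0// mulr_gt0.
have e20 : 0 < Num.min 1 (eps / (3 * (`|p2| + 1))).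
  by rewrite lt_min ltr01 divr_gt0// mulr_gt0.
have e3 : 0 < eps / 3 by rewrite divr_gt0.
have [d1 d10 H1] := derivable_in_expansion dx e20.
have [d2 d20 H2] := derivable_in_expansion (proj1 (dphi T u Tab)) e3.
have [d3 d30 H3] : exists2 d, 0 < d & forall t w, t \in `[a, b] -> `|t - T| <= d ->
    `|w - u| <= d -> `|dphi2 phi t w - p2| <= eps / (3 * K).
  move/subspace_continuousP : c2 => /(_ (T, u) Tab)/cvgrPdist_le/(_ _ e30).
  move=> H; have /nbhs_ballP[d /= d0 Hd] : nbhs (T, u) [set w : R * R | w.1 \in `[a, b] ->
    `|p2 - dphi2 phi w.1 w.2| <= eps / (3 * K)] by exact: H.
  exists (d / 2) => [|t w tab td wd]; first by rewrite divr_gt0.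
  rewrite distrC; apply: (Hd (t, w)) => //.
  by split => /=; rewrite /ball/= distrC; lra.
pose d4 := Num.min (T - a) (b - T).
have d40 : 0 < d4 by rewrite lt_min !subr_gt0 aT.
pose d := Num.min (Num.min d1 d2) (Num.min (d3 / (K + 1)) d4).
exists d => [|sigma dd].
  by rewrite !lt_min d10 d20 !subr_gt0 aT Tb !andbT divr_gt0// addr_gt0.
rewrite !le_min => /andP[/andP[s1 s2] /andP[s3 /andP[s4 s5]]] /andP[_ /andP[dd3 _]].
have Tsab : T + sigma \in `[a, b].
  by move: s4 s5; rewrite in_itv/= !ler_norml => /andP[h1 _] /andP[_ h2]; apply/andP; clear - h1 h2; split; lra.
have s3' : `|sigma| <= d3.
  apply: (le_trans s3); have K10 : 0 < K + 1 by exact: addr_gt0.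
  by rewrite ler_pdivrMr// ler_peMr ?(ltW d30)// lerDr ltW.
pose dy := x (T + sigma) + dd - u.
have Hx : `|x (T + sigma) - u - x' * sigma| <= Num.min 1 (eps / (3 * (`|p2| + 1))) * `|sigma|.
  by have := H1 (T + sigma) Tsab; rewrite (addrC T) addrK addrC; apply.
have Hx1 : `|x (T + sigma) - u - x' * sigma| <= `|sigma|.
  by apply: le_trans Hx _; rewrite -[leRHS]mul1r ler_wpM2r// ge_min lexx.
have Hx2 : `|p2| * `|x (T + sigma) - u - x' * sigma| <= eps / 3 * `|sigma|.
  apply: le_trans (ler_wpM2l _ Hx) _ => //; rewrite mulrA ler_wpM2r//.
  apply: (@le_trans _ _ (`|p2| * (eps / (3 * (`|p2| + 1))))).
    by rewrite ler_wpM2l// ge_min lexx orbT.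
  have -> : `|p2| * (eps / (3 * (`|p2| + 1))) = eps / 3 * (`|p2| / (`|p2| + 1)).
    by field; rewrite gt_eqF.
  by rewrite ler_piMr ?(ltW e3)// ler_pdivrMr// mul1r lerDl.
have dyle : `|dy| <= K * `|sigma| + `|dd|.
  rewrite (_ : dy = (x (T + sigma) - u - x' * sigma) + x' * sigma + dd); last by rewrite /dy; ring.
  rewrite (le_trans (ler_normD _ _))// lerD2r (le_trans (ler_normD _ _))//.
  by rewrite /K mulrDl mul1r normrM addrC lerD2l.
have dyd3 : `|dy| <= d3.
  rewrite (le_trans dyle)//; apply: (@le_trans _ _ (K * (d3 / (K + 1)) + d3 / (K + 1))).
    by rewrite lerD// ler_wpM2l// ltW.
  by rewrite le_eqVlt; apply/orP; left; apply/eqP; field; rewrite gt_eqF// addr_gt0.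
have dp (w : R) : is_derive w 1 (fun v : R => phi (T + sigma) v) (dphi2 phi (T + sigma) w).
  have [_ dphi2_] := dphi _ w Tsab.
  by split => //; rewrite /dphi2 derive1E.
have [c cu pE] := mean_value_at u dy dp.
have Hc : `|dphi2 phi (T + sigma) c - p2| <= eps / (3 * K).
  by apply: H3 => //; [rewrite (addrC T) addrK|exact: le_trans dyd3].
have Hp := H2 (T + sigma) Tsab; rewrite (addrC T) addrK addrC in Hp.
have {}Hp := Hp s2.
rewrite -/u -/x' -/p2.
have -> : x (T + sigma) + dd = u + dy by rewrite /dy; ring.
rewrite (_ : _ - _ = (dphi2 phi (T + sigma) c - p2) * dy +
  p2 * (x (T + sigma) - u - x' * sigma) +
  (phi (T + sigma) u - phi T u - dphi1 a b phi T u * sigma)); last first.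
  by rewrite mulrBl -pE /dy; ring.
apply: (@le_trans _ _ (eps / (3 * K) * (K * `|sigma| + `|dd|) + eps / 3 * `|sigma| + eps / 3 * `|sigma|)).
  rewrite (le_trans (ler_normD _ _))// lerD//.
  rewrite (le_trans (ler_normD _ _))// lerD// normrM//.
  by rewrite ler_pM.
have -> : eps / (3 * K) * (K * `|sigma| + `|dd|) = eps / 3 * `|sigma| + eps / (3 * K) * `|dd|.
  by field; rewrite gt_eqF.
have : eps / (3 * K) * `|dd| <= eps * `|dd|.
  rewrite ler_wpM2r// ler_pdivrMr ?mulr_gt0// ler_peMr ?(ltW e0)//; clear - K1; lra.
by move=> h; clear - h; lra.
Qed.

End endpoint_expansions.

(** * The adjoint form of the first variation *)

Section fundamental_lemma.
Context {R : realType}.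
Notation mu := (@lebesgue_measure R).
Local Notation RR := (measurableTypeR R * measurableTypeR R)%type.
Implicit Types (a b s t A C M : R) (f k w y : R -> R) (N : R -> R -> R).

Definition bump s0 r s : R := Num.max 0 (r - `|s - s0|).

Lemma bump_continuous s0 r : continuous (bump s0 r).
Proof.
move=> s; apply: (@continuous_max _ _ (fun=> 0) (fun s => r - `|s - s0|)).
  exact: cst_continuous.
apply: cvgB; first exact: cvg_cst.
by apply: cvg_norm; apply: cvgB; [exact: cvg_id|exact: cvg_cst].
Qed.

Lemma bump_ge0 s0 r s : 0 <= bump s0 r s.
Proof. by rewrite /bump le_max lexx. Qed.

Lemma bump_out s0 r s : r <= `|s - s0| -> bump s0 r s = 0.
Proof. by move=> rs; rewrite /bump max_l// subr_le0. Qed.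

Lemma integral_bump_gt0 a b s0 r : 0 < r -> a <= s0 - r -> s0 + r <= b ->
  0 < \int[mu]_(s in `[a, b]) bump s0 r s.
Proof.
move=> r0 ar rb; have cB := @bump_continuous s0 r.
(* On the middle half of its support the tent is at least [r / 2], so this step function with
   positive integral lies below it. *)
pose g s : R := if s \in `[s0 - r / 2, s0 + r / 2] then r / 2 else 0.
have mg : measurable_fun setT (g : measurableTypeR R -> measurableTypeR R).
  apply: measurable_fun_ifT => //.
  apply: (measurable_fun_bool true); rewrite setTI.
  rewrite (_ : _ @^-1` _ = `[s0 - r / 2, s0 + r / 2]%classic)//.
have r20 : 0 < r / 2 by rewrite divr_gt0.
have gE : \int[mu]_(s in `[s0 - r / 2, s0 + r / 2]) (r / 2) = \int[mu]_(s in `[a, b]) g s.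
  apply: eq_Rintegral_sub => s /=.
  - by rewrite !in_itv/= => /andP[? ?]; apply/andP; split; lra.
  - by rewrite /g => ->.
  - by rewrite /g => _ /negP/negbTE ->.
have ge : \int[mu]_(s in `[a, b]) g s <= \int[mu]_(s in `[a, b]) bump s0 r s.
  apply: le_Rintegral => //.
  - apply: (@bounded_measurable_integrable _ (r / 2) _ _ a b) => //; split => // s.
    by rewrite /g; case: ifP => _; rewrite ?normr0 ?gtr0_norm// ltW.
  - exact: continuous_integrable_itv.
  - move=> s _; rewrite /g; case: ifPn => [|_]; last exact: bump_ge0.
    rewrite in_itv/= => /andP[h1 h2]; rewrite /bump le_max; apply/orP; right.
    have : `|s - s0| <= r / 2 by rewrite ler_distl h1.
    lra.
apply: lt_le_trans ge; rewrite -gE.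
have := @Rintegral_cst _ _ _ mu `[s0 - r / 2, s0 + r / 2]%classic (measurable_itv _) (r / 2).
rewrite /= => ->; rewrite lebesgue_measure_itv/= lte_fin ifT; last lra.
by rewrite -EFinD/= mulr_gt0//; lra.
Qed.

(** The form is local because the density it is applied to may jump at [T]. A tent supported where
    [w] stays within [|w s0| / 2] of [w s0] would force [|w s0| <= |w s0| / 2]. *)
Lemma fundamental_lemma a b w M s0 : bounded_measurable M w -> a < s0 < b ->
  {for s0, continuous w} ->
  (forall k, continuous k -> \int[mu]_(s in `[a, b]) (k s * w s) = 0) -> w s0 = 0.
Proof.
move=> hw /andP[as0 s0b] cw w0; apply/eqP/negPn/negP => ws0.
have e0 : 0 < `|w s0| / 2 by rewrite divr_gt0// normr_gt0.
move/cvgrPdist_le : cw => /(_ _ e0)/nbhs_ballP[d /= d0 Hd].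
pose r := Num.min (d / 2) (Num.min (s0 - a) (b - s0)).
have r0 : 0 < r by rewrite !lt_min divr_gt0// !subr_gt0 as0.
have [rd [ra rb]] : r <= d / 2 /\ r <= s0 - a /\ r <= b - s0.
  by rewrite /r !ge_min !lexx !orbT.
pose k := bump s0 r; have ck : continuous k := @bump_continuous s0 r.
have Ik0 : 0 < \int[mu]_(s in `[a, b]) k s by apply: integral_bump_gt0 => //; lra.
have ik : mu.-integrable `[a, b] (EFin \o k) by exact: continuous_integrable_itv.
have ikw0 : mu.-integrable `[a, b] (EFin \o (fun s => w s0 * k s)).
  exact: integrable_realZ.
have ikw : mu.-integrable `[a, b] (EFin \o (fun s => k s * w s)).
  have [mw bw] := hw; have M0 := bounded_measurable_ge0 hw.
  apply: le_integrable (integrable_realZ M ik _) => //.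
    apply/measurable_EFinP; apply: measurable_funTS; apply: measurable_funM => //.
    exact: continuous_measurable_fun.
  move=> s _; rewrite lee_fin/= !normrM mulrC ler_wpM2r//.
  by rewrite (le_trans (bw s))// ler_norm.
have id := integrable_realB ikw0 ikw (measurable_itv _).
have kd s : `|w s0 * k s - k s * w s| <= `|w s0| / 2 * k s.
  have [rs|rs] := leP r `|s - s0|.
    by rewrite /k bump_out// mulr0 mul0r mulr0 subrr normr0.
  rewrite (mulrC (k s)) -mulrBl normrM (ger0_norm (bump_ge0 _ _ _)).
  rewrite ler_wpM2r ?bump_ge0//; apply: Hd.
  by rewrite /ball/= distrC; lra.
have : `|w s0 * \int[mu]_(s in `[a, b]) k s| <= `|w s0| / 2 * \int[mu]_(s in `[a, b]) k s.
  rewrite -RintegralZl// -[X in `|X|]subr0 -(w0 k ck) -RintegralB//.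
  rewrite -[leRHS]RintegralZl//; apply: le_trans (le_normr_Rintegral _ id) _ => //.
  by apply: le_Rintegral => //; [exact: (integrable_norm id)|exact: integrable_realZ].
rewrite normrM (gtr0_norm Ik0) ler_pM2r//.
by move: e0; lra.
Qed.

(** The kernel of the primitive operator. It is weakly singular for every exponent, so the
    [partial2] term of the first variation is transposed, and its adjoint shown continuous, by the
    same lemmas as the fractional term. *)
Definition volterra_kernel t s : R := if s < t then 1 else 0.

Lemma weakly_singular_volterra A : weakly_singular A 1 volterra_kernel.
Proof.
split.
- by apply: measurable_fun_ifT => //; exact: measurable_fun_ltr.
- by move=> t; rewrite /volterra_kernel ltxx.
- move=> t s; rewrite mul1r /volterra_kernel ler_wpDl ?powR_ge0//.
  by case: ifP => _; rewrite ?normr0 ?normr1.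
- move=> t s ts.
  have cd : (fun p : R * R => p.1 - p.2) @ (t, s) --> t - s.
    by apply: cvgB; [exact: cvg_fst|exact: cvg_snd].
  have [st|ts'] := ltP s t.
    have H : (fun=> 1 : R) @ (t, s) --> (1 : R) by exact: cvg_cst.
    rewrite /prop_for/continuous_at/= {2}/volterra_kernel st.
    apply: cvg_trans H; apply: near_eq_cvg; near=> p.
    rewrite /volterra_kernel ifT// -subr_gt0; near: p.
    by apply: (cvgr_gt _ cd); rewrite subr_gt0.
  have st : t < s by rewrite lt_neqAle ts.
  have H : (fun=> 0 : R) @ (t, s) --> (0 : R) by exact: cvg_cst.
  rewrite /prop_for/continuous_at/= {2}/volterra_kernel ltNge ts'/=.
  apply: cvg_trans H; apply: near_eq_cvg; near=> p.
  rewrite /volterra_kernel ifF//; apply/negbTE; rewrite -leNgt -subr_le0 ltW//; near: p.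
  by apply: (cvgr_lt _ cd); rewrite subr_lt0.
Unshelve. all: by end_near. Qed.

Lemma kernel_integral_volterra a b k t : continuous k -> a <= t <= b ->
  kernel_integral volterra_kernel a b k t = primitive a k t.
Proof.
move=> ck /andP[a_t tb]; rewrite -Rintegral_primitive//.
rewrite -Rintegral_itv_bndo_bndc; last first.
  apply: integrableS (@continuous_integrable_itv _ a t _ ck) => //.
  by apply: subset_itvl; rewrite bnd_simp.
apply/esym/eq_Rintegral_sub => s /=.
- by rewrite !in_itv/= => /andP[-> st]; rewrite (le_trans (ltW st)).
- by rewrite in_itv/= /volterra_kernel => /andP[_ ->]; rewrite mul1r.
- by rewrite !in_itv/= /volterra_kernel => /andP[-> _]/= /negP/negbTE ->; rewrite mul0r.
Qed.

Lemma kernel_integral_comb a b A C1 C2 N1 N2 M f (k l : R) t : a < b -> 0 < A < 1 ->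
  weakly_singular A C1 N1 -> weakly_singular A C2 N2 -> bounded_measurable M f ->
  a <= t <= b ->
  kernel_integral (fun t s => k * N1 t s + l * N2 t s) a b f t =
  k * kernel_integral N1 a b f t + l * kernel_integral N2 a b f t.
Proof.
move=> ab hA h1 h2 hf tab.
have i1 := kernel_integrable ab hA h1 hf tab; have i2 := kernel_integrable ab hA h2 hf tab.
rewrite /kernel_integral -!RintegralZl// -RintegralD//; try exact: integrable_realZ.
by apply: eq_Rintegral => s _; rewrite mulrDl !mulrA.
Qed.

Lemma kernel_integral_lin a b A C N M1 M2 M3 f1 f2 f3 (k l : R) t : a < b -> 0 < A < 1 ->
  weakly_singular A C N -> bounded_measurable M1 f1 -> bounded_measurable M2 f2 ->
  bounded_measurable M3 f3 -> a <= t <= b ->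
  kernel_integral N a b (fun s => f1 s + k * f2 s + l * f3 s) t =
  kernel_integral N a b f1 t + k * kernel_integral N a b f2 t + l * kernel_integral N a b f3 t.
Proof.
move=> ab hA hN h1 h2 h3 tab.
have i1 := kernel_integrable ab hA hN h1 tab.
have i2 := kernel_integrable ab hA hN h2 tab.
have i3 := kernel_integrable ab hA hN h3 tab.
have i2' := integrable_realZ k i2 (measurable_itv _).
have i3' := integrable_realZ l i3 (measurable_itv _).
rewrite /kernel_integral -!RintegralZl// -RintegralD// -RintegralD//; last exact: integrable_realD.
by apply: eq_Rintegral => s _; ring.
Qed.

End fundamental_lemma.

(** * From the weak equation to a pointwise one *)

Section weak_to_strong.
Context {R : realType}.
Notation mu := (@lebesgue_measure R).
Implicit Types (a b s t T A C M : R) (f k w y E : R -> R).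

Lemma continuous_frequently_eq f T (v : R) : {for T, continuous f} ->
  (forall d, 0 < d -> exists2 s, `|s - T| < d & f s = v) -> f T = v.
Proof.
move=> cf fv; apply/eqP; rewrite -subr_eq0 -normr_le0.
apply/ler_addgt0Pr => e e0; rewrite add0r.
move/cvgrPdist_le : cf => /(_ e e0)/nbhs_ballP[d /= d0 Hd].
have [s sT <-] := fv d d0; apply: Hd.
by rewrite /ball/= distrC.
Qed.

Lemma continuous_eq_on_itv f p q (v : R) s : p < q -> continuous f ->
  (forall u, p < u < q -> f u = v) -> p <= s <= q -> f s = v.
Proof.
move=> pq cf fv /andP[ps sq]; apply: continuous_frequently_eq; first exact: cf.
move=> d d0.
(* The witness is [s] moved towards the midpoint [m]: any fraction [l] in ]0, 1 / 2] brings it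
   strictly inside ]p, q[, and a small one keeps it within [d] of [s]. *)
pose m := (p + q) / 2; pose l := Num.min (1 / 2) (d / (2 * (q - p))).
have qp0 : 0 < q - p by rewrite subr_gt0.
have l0 : 0 < l by rewrite lt_min !divr_gt0// mulr_gt0.
have l1 : l <= 1 / 2 by rewrite /l ge_min lexx.
have l2 : l * (q - p) <= d / 2.
  rewrite -ler_pdivlMr// (_ : _ / _ = d / (2 * (q - p))).
    by rewrite /l ge_min lexx orbT.
  by field; rewrite gt_eqF.
exists (s + l * (m - s)); last first.
  apply: fv; rewrite /m; apply/andP; split; nra.
rewrite addrAC subrr add0r normrM gtr0_norm//.
have : `|m - s| <= q - p by rewrite /m ler_norml; apply/andP; split; lra.
move=> ms; apply: le_lt_trans (_ : d / 2 < d); last lra.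
by apply: le_trans l2; rewrite ler_wpM2l// ltW.
Qed.

(* [E] is continuous at [T], whereas [c \1_]-oo, T[] jumps there by [c]. *)
Lemma weak_to_strong a b T E (c : R) : a < T < b -> {within `[a, b], continuous E} ->
  (forall k, continuous k ->
    \int[mu]_(s in `[a, b]) (k s * E s) + c * primitive a k T = 0) ->
  c = 0 /\ forall s, a <= s <= b -> E s = 0.
Proof.
move=> /andP[aT Tb] cE HE; have ab : a < b by exact: lt_trans Tb.
have abW := ltW ab.
pose F := E \o clamp a b.
have cF : continuous F by exact: continuous_clamp.
have [M hF] := bounded_measurable_clamp abW cE.
have FE s : a <= s <= b -> F s = E s by move=> sab; rewrite /F/= clamp_id.
(* [c * primitive a k T] is the integral of [k] against [c] up to [T], so [w] is the density of the
   whole functional. *)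
pose w s := F s + (if s < T then c else 0).
have hw : bounded_measurable (M + `|c|) w.
  have [mF bF] := hF; split; first by apply: measurable_funD => //; apply: measurable_fun_ifT => //; exact: measurable_fun_ltr.
  move=> s; rewrite (le_trans (ler_normD _ _))// lerD//.
  by case: ifP => _; rewrite ?normr0.
have step_cont s : s != T -> {for s, continuous w}.
  move=> sT; apply: cvgD; first exact: cF.
  have [lt|ge] := ltP s T.
    have H : (fun=> c) @ s --> c by exact: cvg_cst.
    apply: cvg_trans H; apply: near_eq_cvg; near=> u.
    rewrite ifT//; near: u; exact: lt_nbhsl.
  have Ts : T < s by rewrite lt_neqAle eq_sym sT.
  have H : (fun=> 0 : R) @ s --> (0 : R) by exact: cvg_cst.
  apply: cvg_trans H; apply: near_eq_cvg; near=> u.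
  rewrite ifF//; apply/negbTE; rewrite -leNgt ltW//; near: u; exact: lt_nbhsr.
have w0 s : a < s < b -> s != T -> w s = 0.
  move=> sab sT; apply: (fundamental_lemma hw sab (step_cont s sT)) => k ck.
  rewrite -(HE k ck).
  have ik : mu.-integrable `[a, b] (EFin \o k) by exact: continuous_integrable_itv.
  have ikF : mu.-integrable `[a, b] (EFin \o (fun s => k s * F s)).
    apply: continuous_integrable_itv => u; apply: cvgM; [exact: ck|exact: cF].
  have iv : mu.-integrable `[a, b] (EFin \o (fun s => volterra_kernel T s * k s)).
    apply: le_integrable ik => //.
      apply/measurable_EFinP; apply: measurable_funTS; apply: measurable_funM.
        by apply: measurable_fun_ifT => //; exact: measurable_fun_ltr.
      exact: continuous_measurable_fun.
    move=> u _; rewrite lee_fin/= /volterra_kernel.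
    by case: ifP => _; rewrite ?mul1r ?mul0r ?normr0.
  have iks := integrable_realZ c iv (measurable_itv _).
  have -> : \int[mu]_(s in `[a, b]) (k s * E s) = \int[mu]_(s in `[a, b]) (k s * F s).
    by apply: eq_Rintegral => u; rewrite inE/= in_itv/= => uab; rewrite FE.
  rewrite -(@kernel_integral_volterra _ a b)//; last by rewrite !ltW.
  rewrite /kernel_integral -RintegralZl//.
  rewrite -RintegralD//; apply: eq_Rintegral => u _.
  by rewrite /w /volterra_kernel; case: ifP => _; ring.
have left s : a < s < T -> F s = - c.
  move=> /andP[as_ sT]; have := w0 s; rewrite as_ (lt_trans sT)// (lt_eqF sT) => /(_ isT isT).
  by rewrite /w sT => /eqP; rewrite addr_eq0 => /eqP.
have right s : T < s < b -> F s = 0.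
  move=> /andP[Ts sb]; have := w0 s; rewrite sb (lt_trans aT)// (gt_eqF Ts) => /(_ isT isT).
  by rewrite /w ltNge (ltW Ts)/= addr0.
have FTl : F T = - c.
  by apply: (continuous_eq_on_itv aT cF left); rewrite lexx ltW.
have FTr : F T = 0.
  by apply: (continuous_eq_on_itv Tb cF right); rewrite lexx ltW.
have c0 : c = 0 by apply/eqP; rewrite -oppr_eq0 -FTl FTr.
split => // s sab; rewrite -FE//; have /andP[as_ sb] := sab.
have [sT|Ts] := leP s T.
  by rewrite (continuous_eq_on_itv aT cF left) ?as_// c0 oppr0.
by rewrite (continuous_eq_on_itv Tb cF right)// (ltW Ts).
Unshelve. all: by end_near. Qed.

End weak_to_strong.

(** * The Euler-Lagrange equations in integrated form *)

Section extremals.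
Context {R : realType} (a b : R) (alpha beta : R -> R -> R) (gam : R * R) (A C T : R).
Context (ab : a < b) (halpha : frac_order a b alpha) (hbeta : frac_order a b beta)
  (hA : 0 < A < 1) (hKalpha : weakly_singular A C (left_kernel a b alpha))
  (hKbeta : weakly_singular A C (left_kernel a b beta)) (aTb : a < T < b).
Notation mu := (@lebesgue_measure R).
Implicit Types (s t M : R) (f k w y x U V : R -> R) (z : R -> R -> R -> R).

(** The combined Caputo derivative as an operator on the derivative of the state; the minus sign is
    the one inside [ker_right]. *)
Definition caputo_kernel t s : R :=
  gam.1 * left_kernel a b alpha t s + (- gam.2) * left_kernel a b beta s t.

Lemma weakly_singular_caputo_kernel :
  weakly_singular A (`|gam.1| * C + `|- gam.2| * C) caputo_kernel.
Proof. exact: weakly_singular_comb hKalpha (weakly_singular_transpose hKbeta). Qed.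

Let hN := weakly_singular_caputo_kernel.
Let hNt := weakly_singular_transpose hN.
Let hV := @weakly_singular_volterra R A.
Let hVt := weakly_singular_transpose hV.
Let abW := ltW ab.

Lemma combined_caputoE x f M t : bounded_measurable M f -> a <= t <= b ->
  (forall s, a <= s <= b -> deriv_in `[a, b] x s = f s) ->
  combined_caputo a b alpha beta gam x t = kernel_integral caputo_kernel a b f t.
Proof.
move=> hf tab xf.
rewrite (kernel_integral_comb _ _ ab hA hKalpha (weakly_singular_transpose hKbeta) hf tab).
rewrite /combined_caputo /caputo_left /caputo_right.
rewrite (kerint_leftE halpha tab xf).
rewrite (kerint_rightE ab hbeta hA hKbeta hf tab (lexx b) xf) ?mulrN ?mulNr//.
by move=> s /andP[bs sb]; have := lt_le_trans bs sb; rewrite ltxx.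
Qed.

Lemma combined_caputo_exists_bounded x f M t : bounded_measurable M f -> a <= t <= b ->
  (forall s, a <= s <= b -> deriv_in `[a, b] x s = f s) ->
  combined_caputo_exists a b alpha beta x t.
Proof.
move=> hf tab xf; have /andP[a_t tb] := tab; split.
- have H : mu.-integrable `[a, t] (EFin \o (fun s => left_kernel a b alpha t s * f s)).
    apply: integrableS (kernel_integrable ab hA hKalpha hf tab) => //.
    exact: subset_itvl.
  apply: eq_integrable H => // s; rewrite inE/= in_itv/= => /andP[as_ st].
  have sab : a <= s <= b by rewrite as_ (le_trans st).
  by rewrite left_kernelE// xf.
- have H : mu.-integrable `[t, b] (EFin \o (fun s => -1 * (left_kernel a b beta s t * f s))).
    apply: integrable_realZ => //.
    apply: integrableS (kernel_integrable ab hA (weakly_singular_transpose hKbeta) hf tab) => //.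
    exact: subset_itvr.
  apply: eq_integrable H => // s; rewrite inE/= in_itv/= => /andP[ts sb].
  have sab : a <= s <= b by rewrite sb (le_trans a_t).
  by rewrite left_kernelE// xf// /ker_right /ker_left mulN1r !mulNr.
Qed.

Definition cut f s : R := if s <= T then f s else 0.

Definition frozen (p : R -> R -> R -> R) U V s : R :=
  p (clamp a b s) (U (clamp a b s)) (V (clamp a b s)).

(* The density of [first_variation] with respect to [k]; see [first_variationE]. *)
Definition EL_function z U V s : R :=
  kernel_integral (fun t s => caputo_kernel s t) a b (cut (frozen (partial3 z) U V)) s +
  kernel_integral (fun t s => volterra_kernel s t) a b (cut (frozen (partial2 z) U V)) s.

Definition first_variation z U V k : R :=
  \int[mu]_(t in `[a, T])
    (partial2 z t (U t) (V t) * primitive a k t +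
     partial3 z t (U t) (V t) * kernel_integral caputo_kernel a b (k \o clamp a b) t).

Lemma cut_bounded_measurable f M : bounded_measurable M f -> bounded_measurable M (cut f).
Proof.
move=> hf; have M0 := bounded_measurable_ge0 hf; have [mf bf] := hf; split.
  by apply: measurable_fun_ifT => //; exact: measurable_fun_ler.
by move=> t; rewrite /cut; case: ifP => _; rewrite ?normr0.
Qed.

Section fixed_state.
Context (z : R -> R -> R -> R) (hz : C1_3 a b z) (U V : R -> R)
  (cU : {within `[a, b], continuous U}) (cV : {within `[a, b], continuous V}).

Lemma frozen_continuous (p : R -> R -> R -> R) :
  {within [set w : R * R * R | w.1.1 \in `[a, b]],
    continuous (fun w : R * R * R => p w.1.1 w.1.2 w.2)} ->
  continuous (frozen p U V).
Proof.
move=> cp; apply: (continuous_nemytskii (continuous_clamp3 abW cp)).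
  exact: (continuous_clamp abW cU).
exact: (continuous_clamp abW cV).
Qed.

Lemma frozen_bounded (p : R -> R -> R -> R) :
  {within [set w : R * R * R | w.1.1 \in `[a, b]],
    continuous (fun w : R * R * R => p w.1.1 w.1.2 w.2)} ->
  exists M, bounded_measurable M (frozen p U V).
Proof.
move=> /frozen_continuous cf.
have [M hM] := bounded_measurable_clamp abW (continuous_subspaceT cf).
exists M; suff <- : frozen p U V \o clamp a b = frozen p U V by [].
by apply/funext => s; rewrite /frozen/= (clamp_id (clamp_itv _ abW)).
Qed.

Lemma EL_function_continuous : {within `[a, b], continuous (EL_function z U V)}.
Proof.
have [_ _ c2 c3] := hz.
have [M2 h2] := frozen_bounded c2; have [M3 h3] := frozen_bounded c3.
have k3 := kernel_integral_continuous ab hA hNt (cut_bounded_measurable h3).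
have k2 := kernel_integral_continuous ab hA hVt (cut_bounded_measurable h2).
by apply: within_continuousD; [exact: k3|exact: k2].
Qed.

(** [cut] turns the integral over [a, T] into one over [a, b], where [kernel_FubiniE] moves both
    operators off [k]. *)
Lemma first_variationE k : continuous k ->
  first_variation z U V k = \int[mu]_(s in `[a, b]) (k s * EL_function z U V s).
Proof.
move=> ck; have [_ _ c2 c3] := hz; have /andP[aT Tb] := aTb.
have [M2 h2] := frozen_bounded c2; have [M3 h3] := frozen_bounded c3.
have [Mk hk] := bounded_measurable_clamp abW (continuous_subspaceT ck).
have hc2 := cut_bounded_measurable h2; have hc3 := cut_bounded_measurable h3.
have int_prod A' C' N M f M' y : 0 < A' < 1 -> weakly_singular A' C' N ->
    bounded_measurable M f -> bounded_measurable M' y ->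
    mu.-integrable `[a, b] (EFin \o (fun s => y s * kernel_integral N a b f s)).
  move=> hA' hN' hf hy; have [K K0 HK] := kernel_integral_le ab hA' hN'.
  have M'0 := bounded_measurable_ge0 hy; have [my yM] := hy.
  apply: (@integrable_bounded _ a b _ _ (M' * (K * M))) => //.
    apply: measurable_funM; first exact: measurable_funTS.
    exact: kernel_integral_measurable ab hA' hN' hf.
  move=> s; rewrite /= in_itv/= => sab; rewrite normrM ler_pM//; exact: HK.
have F3 := kernel_FubiniE ab hA hN hc3 hk; have F2 := kernel_FubiniE ab hA hV hc2 hk.
have j2 := int_prod _ _ _ _ _ _ _ hA hVt hc2 hk.
have j3 := int_prod _ _ _ _ _ _ _ hA hNt hc3 hk.
have i2 := int_prod _ _ _ _ _ _ _ hA hV hk hc2.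
have i3 := int_prod _ _ _ _ _ _ _ hA hN hk hc3.
have Sj := @RintegralD _ (measurableTypeR R) _ mu _ _ _ (measurable_itv _) j2 j3.
have Si := @RintegralD _ (measurableTypeR R) _ mu _ _ _ (measurable_itv _) i2 i3.
rewrite F2 F3 -Sj in Si; apply: (etrans _ (etrans Si _)); last first.
  apply: eq_Rintegral => s; rewrite inE/= in_itv/= => sab.
  have cs : clamp a b s = s by exact: clamp_id.
  rewrite /EL_function cs.
  move: (kernel_integral _ _ _ _ _)
    (kernel_integral (fun t s => volterra_kernel s t) _ _ _ _) => q p.
  by rewrite -mulrDr addrC.
clear - abW aT Tb ck hA.
apply: eq_Rintegral_sub => s /=.
- by rewrite !in_itv/= => /andP[-> sT]; rewrite (le_trans sT)// ltW.
- rewrite in_itv/= => /andP[as_ sT].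
  have sab : a <= s <= b by rewrite as_ (le_trans sT)// ltW.
  rewrite /cut sT /frozen clamp_id//; congr (_ * _ + _).
  rewrite -(kernel_integral_volterra ck sab); apply: eq_Rintegral => u.
  by rewrite inE/= in_itv/= => uab; rewrite clamp_id.
- by rewrite !in_itv/= /cut => /andP[-> sb]/= /negP/negbTE ->; rewrite !mul0r addr0.
Qed.

(** Used with [c = 0] for the constraint, to find a direction of nonzero variation, and with
    [c = dphi2 phi T (x T)] for the integrand with multiplier. *)
Lemma first_variation_eq0 c : (forall k, continuous k ->
    first_variation z U V k + c * primitive a k T = 0) ->
  c = 0 /\ forall s, a <= s <= b -> EL_function z U V s = 0.
Proof.
move=> H; apply: (weak_to_strong aTb EL_function_continuous) => k ck.
by rewrite -first_variationE// H.
Qed.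

Section Euler_Lagrange.
Context (x : R -> R) (hEL : forall s, a <= s <= b -> EL_function z U V s = 0)
  (xU : forall s, a <= s <= b -> x s = U s)
  (xV : forall s, a <= s <= b -> combined_caputo a b alpha beta gam x s = V s).

Let along_frozen p s : a <= s <= b ->
  along a b alpha beta gam x p s = frozen p U V s.
Proof. by move=> sab; rewrite /along /frozen clamp_id// xU// xV. Qed.

Let y := along a b alpha beta gam x (partial3 z).

Lemma volterra_transposeE s : a <= s <= T ->
  kernel_integral (fun t s => volterra_kernel s t) a b (cut (frozen (partial2 z) U V)) s =
  primitive a (frozen (partial2 z) U V) T - primitive a (frozen (partial2 z) U V) s.
Proof.
move=> /andP[as_ sT]; have /andP[aT Tb] := aTb; have [_ _ c2 _] := hz.
have cq := frozen_continuous c2.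
have iq : mu.-integrable `[a, T] (EFin \o frozen (partial2 z) U V).
  exact: continuous_integrable_itv.
rewrite -!Rintegral_primitive ?(ltW aT)//.
have := Rintegral_itvB iq (x := s); rewrite !bnd_simp => ->//.
apply/esym/eq_Rintegral_sub => u /=.
- by rewrite !in_itv/= => /andP[su uT]; rewrite (le_trans as_ (ltW su)) (le_trans uT)// ltW.
- by rewrite in_itv/= /volterra_kernel /cut => /andP[-> ->]; rewrite mul1r.
- rewrite !in_itv/= /volterra_kernel /cut => _ /negP; rewrite negb_and.
  by move=> /orP[|] /negbTE ->; rewrite ?mul0r ?mulr0.
Qed.

(** The equation [EL_function = 0] solved for its fractional part, which on [a, T] is minus the dual
    function: the right integral stops at [T] anyway, and the left one, up to [t <= T], does not see
    the cut. *)
Lemma dual_funE t : a <= t <= T ->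
  dual_fun (gam.2, gam.1) beta alpha a T y t =
  primitive a (frozen (partial2 z) U V) T - primitive a (frozen (partial2 z) U V) t.
Proof.
move=> tT; have /andP[aT Tb] := aTb; have /andP[a_t tT'] := tT.
have tab : a <= t <= b by rewrite a_t (le_trans tT')// ltW.
have [_ _ _ c3] := hz; have [M3 h3] := frozen_bounded c3.
have hc3 := cut_bounded_measurable h3.
have yE s : a <= s <= T -> y s = cut (frozen (partial3 z) U V) s.
  by move=> /andP[as_ sT]; rewrite /cut sT /y along_frozen// as_ (le_trans sT)// ltW.
apply: etrans (volterra_transposeE tT).
have := hEL tab; rewrite /EL_function => /eqP; rewrite addrC addr_eq0 => /eqP ->.
rewrite (kernel_integral_comb _ _ ab hA (weakly_singular_transpose hKalpha) hKbeta hc3 tab).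
rewrite /dual_fun/= (kerint_rightE ab halpha hA hKalpha hc3 tT (ltW Tb) yE); last first.
  by move=> s /andP[Ts _]; rewrite /cut leNgt Ts.
rewrite (@kerint_leftE _ a b beta y (frozen (partial3 z) U V)) //; last first.
  by move=> s sab; exact: along_frozen.
have cutE : kernel_integral (left_kernel a b beta) a b (frozen (partial3 z) U V) t =
    kernel_integral (left_kernel a b beta) a b (cut (frozen (partial3 z) U V)) t.
  apply: eq_Rintegral => s _; rewrite /cut; case: leP => // Ts.
  by rewrite left_kernel_ge ?mul0r// (le_trans tT')// ltW.
rewrite [X in _ * X + _]cutE.
move: (kernel_integral _ _ _ _ _) (kernel_integral (left_kernel a b beta) _ _ _ _) => p q.
by ring.
Qed.

(** From [T] on, the primitive term and the [alpha] term of [EL_function] only involve [s > t >= T],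
    where the data are cut to 0. The [beta] term remains, and [kerint_left_tail] identifies it. *)
Lemma diff_funE t : T <= t <= b -> diff_fun gam beta a T y t = 0.
Proof.
move=> /andP[Tt tb]; have /andP[aT Tb] := aTb.
have tab : a <= t <= b by rewrite (le_trans (ltW aT)).
have [_ _ _ c3] := hz; have [M3 h3] := frozen_bounded c3.
have hc3 := cut_bounded_measurable h3.
have yE s : a <= s <= b -> y s = frozen (partial3 z) U V s by exact: along_frozen.
rewrite /diff_fun (kerint_left_tail ab hbeta hA hKbeta h3 _ tb yE) ?Tt ?andbT ?(ltW aT)//.
have := hEL tab; rewrite /EL_function.
rewrite (kernel_integral_comb _ _ ab hA (weakly_singular_transpose hKalpha) hKbeta hc3 tab).
have -> : kernel_integral (fun t s => volterra_kernel s t) a b (cut (frozen (partial2 z) U V)) t = 0.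
  rewrite /kernel_integral -[RHS](@Rintegral_set0 _ _ _ mu (fun=> 0)).
  apply/esym/eq_Rintegral_sub => // s _ _; rewrite /volterra_kernel /cut.
  by case: (leP s T) => [sT|_]; rewrite ?mulr0// ltNge (le_trans sT Tt) mul0r.
have -> : kernel_integral (fun t s => left_kernel a b alpha s t) a b
    (cut (frozen (partial3 z) U V)) t = 0.
  rewrite /kernel_integral -[RHS](@Rintegral_set0 _ _ _ mu (fun=> 0)).
  apply/esym/eq_Rintegral_sub => // s _ _; rewrite /cut.
  by case: (leP s T) => [sT|_]; rewrite ?mulr0// left_kernel_ge ?mul0r// (le_trans sT).
by rewrite mulr0 add0r addr0 mulNr => /eqP; rewrite oppr_eq0 => /eqP.
Qed.

(** Equality with a primitive on all of [a, T] gives derivability at both end points, where the two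
    fractional integrals taken separately may have infinite slope. *)
Lemma EL_left_of_EL_function : EL_left a b alpha beta gam x T z.
Proof.
move=> t tT; have /andP[aT Tb] := aTb; have tT' : a <= t <= T by move: tT; rewrite in_itv.
have /andP[a_t t_T] := tT'.
have tab : a <= t <= b by rewrite a_t (le_trans t_T)// ltW.
have [_ _ c2 _] := hz; have cq := frozen_continuous c2.
pose q := frozen (partial2 z) U V.
have d : is_derive t 1 (fun s => primitive a q T - primitive a q s) (- q t).
  have dq := primitive_derive cq a_t.
  by rewrite -[- q t]add0r; exact: is_deriveB.
have [d1 d2] := is_derive_deriv_in aT tT d.
have E s : `[a, T]%classic s -> dual_fun (gam.2, gam.1) beta alpha a T y s =
    primitive a q T - primitive a q s.
  by rewrite /= in_itv/= => sT; exact: dual_funE.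
have [e1 e2] := eq_deriv_in tT E.
split; first exact/e1.
by rewrite /dual_deriv e2 d2 along_frozen// subrr.
Qed.

Lemma EL_right_of_EL_function : EL_right a b alpha beta gam x T z.
Proof.
move=> t tb; have /andP[aT Tb] := aTb.
have [d1 d2] := is_derive_deriv_in Tb tb (is_derive_cst (0 : R) t 1).
have E s : `[T, b]%classic s -> diff_fun gam beta a T y s = cst 0 s.
  by rewrite /= in_itv/= => sT; exact: diff_funE.
have [e1 e2] := eq_deriv_in tb E.
by split; [exact/e1|rewrite /diff_deriv e2 d2].
Qed.

Lemma transversality_b_of_EL_function :
  gam.2 * (RL_left_int (compl_order beta) T y b - RL_left_int (compl_order beta) a y b) = 0.
Proof.
have /andP[aT Tb] := aTb.
rewrite !RL_left_int_compl; have := @diff_funE b; rewrite lexx ltW// => /(_ isT).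
by rewrite /diff_fun => H; rewrite -opprB mulrN H oppr0.
Qed.

End Euler_Lagrange.
End fixed_state.
End extremals.

(** * Admissible perturbations *)

Section perturbations.
Context {R : realType} (a b : R) (alpha beta : R -> R -> R) (gam : R * R) (A C : R).
Context (ab : a < b) (halpha : frac_order a b alpha) (hbeta : frac_order a b beta)
  (hA : 0 < A < 1) (hKalpha : weakly_singular A C (left_kernel a b alpha))
  (hKbeta : weakly_singular A C (left_kernel a b beta)).
Notation mu := (@lebesgue_measure R).
Implicit Types (s t T M e tau : R) (f k y x : R -> R) (z : R -> R -> R -> R).

Let abW := ltW ab.
Let hN := weakly_singular_caputo_kernel gam hKalpha hKbeta.
Let N := caputo_kernel a b alpha beta gam.
Let caputo := combined_caputo a b alpha beta gam.

Lemma eq_within_continuous (U V : topologicalType) (D : set U) (f g : U -> V) :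
  (forall u, D u -> f u = g u) -> {within D, continuous f} -> {within D, continuous g}.
Proof.
move=> fg /subspace_continuousP cf; apply/subspace_continuousP => u Du.
rewrite /from_subspace -fg//; have := cf u Du.
apply: cvg_trans; apply: near_eq_cvg.
have FF : Filter (within D (nbhs u)) by exact: within_filter.
have wD : \forall s \near within D (nbhs u), D s by exact: withinT.
by near=> s; rewrite /from_subspace fg//; near: s; exact: wD.
Unshelve. all: by end_near. Qed.

Definition perturbed x k1 k0 e1 e2 t : R :=
  x t + e1 * primitive a k1 t + e2 * primitive a k0 t.

Lemma perturbed_deriv x k1 k0 e1 e2 t : C1_on a b x -> continuous k1 -> continuous k0 ->
  a <= t <= b ->
  derivable_in `[a, b] (perturbed x k1 k0 e1 e2) t /\
  deriv_in `[a, b] (perturbed x k1 k0 e1 e2) t =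
    deriv_in `[a, b] x t + e1 * k1 t + e2 * k0 t.
Proof.
move=> [dx _] c1 c0 tab; have /andP[a_t tb] := tab.
have tab' : t \in `[a, b] by rewrite in_itv.
have [d1 e1'] := is_derive_deriv_in ab tab' (primitive_derive c1 a_t).
have [d0 e0'] := is_derive_deriv_in ab tab' (primitive_derive c0 a_t).
have [d2 e2'] := deriv_in_comb e1 e2 ab tab' d1 d0.
have [d3 e3'] := deriv_in_comb 1 1 ab tab' (dx t tab') d2.
have -> : perturbed x k1 k0 e1 e2 = fun s => 1 * x s + 1 *
    (e1 * primitive a k1 s + e2 * primitive a k0 s).
  by apply/funext => s; rewrite /perturbed; ring.
by split; [exact: d3|rewrite e3' e2' e1' e0'; ring].
Qed.

Lemma bounded_measurable_lin M1 M2 M3 (f1 f2 f3 : R -> R) (k l : R) :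
  bounded_measurable M1 f1 -> bounded_measurable M2 f2 -> bounded_measurable M3 f3 ->
  bounded_measurable (M1 + `|k| * M2 + `|l| * M3) (fun s => f1 s + k * f2 s + l * f3 s).
Proof.
move=> [m1 b1] [m2 b2] [m3 b3]; split.
  by apply: measurable_funD; [apply: measurable_funD => //|]; apply: measurable_funM.
move=> t; rewrite (le_trans (ler_normD _ _))// lerD//; last by rewrite normrM ler_wpM2l.
by rewrite (le_trans (ler_normD _ _))// lerD// normrM ler_wpM2l.
Qed.

Definition direction k t : R := kernel_integral N a b (k \o clamp a b) t.

Lemma direction_continuous k : continuous k -> {within `[a, b], continuous (direction k)}.
Proof.
move=> ck; have [M hk] := bounded_measurable_clamp abW (continuous_subspaceT ck).
exact: (kernel_integral_continuous ab hA hN hk).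
Qed.

Lemma primitive_continuous k : continuous k -> {within `[a, b], continuous (primitive a k)}.
Proof.
move=> ck; apply: derivable_within_continuous => s; rewrite in_itv/= => /andP[as_ _].
by have [] := primitive_derive ck as_.
Qed.

Lemma perturbed_caputo x k1 k0 e1 e2 : C1_on a b x -> continuous k1 -> continuous k0 ->
  forall t, a <= t <= b ->
  combined_caputo_exists a b alpha beta (perturbed x k1 k0 e1 e2) t /\
  caputo (perturbed x k1 k0 e1 e2) t = caputo x t + e1 * direction k1 t + e2 * direction k0 t.
Proof.
move=> hx c1 c0 t tab; have [dx cx] := hx.
have [M hM] := bounded_measurable_clamp abW cx.
have [M1 hM1] := bounded_measurable_clamp abW (continuous_subspaceT c1).
have [M0 hM0] := bounded_measurable_clamp abW (continuous_subspaceT c0).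
have hl := bounded_measurable_lin e1 e2 hM hM1 hM0.
have dE s : a <= s <= b -> deriv_in `[a, b] (perturbed x k1 k0 e1 e2) s =
    (deriv_in `[a, b] x \o clamp a b) s + e1 * (k1 \o clamp a b) s + e2 * (k0 \o clamp a b) s.
  move=> sab; have [_ ->] := perturbed_deriv e1 e2 hx c1 c0 sab.
  by rewrite /= clamp_id.
split; first exact: (combined_caputo_exists_bounded ab halpha hbeta hA hKalpha hKbeta hl tab dE).
have xE s : a <= s <= b -> deriv_in `[a, b] x s = (deriv_in `[a, b] x \o clamp a b) s.
  by move=> sab; rewrite /= clamp_id.
rewrite /caputo (combined_caputoE gam ab halpha hbeta hA hKalpha hKbeta hl tab dE).
rewrite (combined_caputoE gam ab halpha hbeta hA hKalpha hKbeta hM tab xE).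
exact: (kernel_integral_lin e1 e2 ab hA hN hM hM1 hM0 tab).
Qed.

Lemma perturbed_inD x k1 k0 e1 e2 T T' : inD a b alpha beta gam x T ->
  continuous k1 -> continuous k0 -> a <= T' <= b ->
  inD a b alpha beta gam (perturbed x k1 k0 e1 e2) T'.
Proof.
move=> [hx _ _ cx] c1 c0 T'ab; have [dx cdx] := hx.
split.
- split; first by move=> t; rewrite in_itv/= => tab; have [] := perturbed_deriv e1 e2 hx c1 c0 tab.
  apply: (@eq_within_continuous _ _ _ (fun t => deriv_in `[a, b] x t + e1 * k1 t + e2 * k0 t)).
    by move=> t; rewrite /= in_itv/= => tab; have [_ ->] := perturbed_deriv e1 e2 hx c1 c0 tab.
  apply: within_continuousD; first apply: within_continuousD => //.
    by apply: continuous_subspaceT => s; apply: cvgM; [exact: cvg_cst|exact: c1].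
  by apply: continuous_subspaceT => s; apply: cvgM; [exact: cvg_cst|exact: c0].
- exact: T'ab.
- by move=> t; rewrite in_itv/= => tab; have [] := perturbed_caputo e1 e2 hx c1 c0 tab.
- apply: (@eq_within_continuous _ _ _ (fun t => caputo x t + e1 * direction k1 t + e2 * direction k0 t)).
    move=> t; rewrite /= in_itv/= => tab.
    exact: (esym (perturbed_caputo e1 e2 hx c1 c0 tab).2).
  have cs (e : R) : {within `[a, b], continuous (fun=> e)}.
    by apply: continuous_subspaceT => s; exact: cvg_cst.
  apply: within_continuousD; first apply: within_continuousD => //.
    move=> s; apply: cvgM; [exact: cs|exact: (direction_continuous c1)].
  by move=> s; apply: cvgM; [exact: cs|exact: (direction_continuous c0)].
Qed.

(** A perturbed state can serve as a new base state; this carries results at the origin of the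
    parameters to other points. *)
Lemma perturbed_rebase x k1 k0 e1 e2 e3 e4 :
  perturbed (perturbed x k1 k0 e1 e2) k1 k0 e3 e4 = perturbed x k1 k0 (e1 + e3) (e2 + e4).
Proof. by apply/funext => t; rewrite /perturbed; ring. Qed.

Lemma directions_bounded k1 k0 : continuous k1 -> continuous k0 ->
  exists2 B, 0 < B & forall t, a <= t <= b ->
    [/\ `|primitive a k1 t| <= B, `|primitive a k0 t| <= B,
        `|direction k1 t| <= B & `|direction k0 t| <= B].
Proof.
move=> c1 c0; have cK := @segment_compact R a b.
have [B1 B10 H1] := compact_norm_bounded cK (primitive_continuous c1).
have [B2 B20 H2] := compact_norm_bounded cK (primitive_continuous c0).
have [B3 B30 H3] := compact_norm_bounded cK (direction_continuous c1).
have [B4 B40 H4] := compact_norm_bounded cK (direction_continuous c0).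
exists (B1 + B2 + (B3 + B4)) => [|t tab]; first by rewrite !addr_gt0.
have tK : `[a, b]%classic t by rewrite /= in_itv.
by split; [move: (H1 t tK)|move: (H2 t tK)|move: (H3 t tK)|move: (H4 t tK)] => H;
  apply: (le_trans H); lra.
Qed.

Lemma perturbation_le (B e1 e2 p q : R) : `|p| <= B -> `|q| <= B ->
  `|e1 * p + e2 * q| <= B * (`|e1| + `|e2|).
Proof.
move=> pB qB; rewrite (le_trans (ler_normD _ _))// [leRHS]mulrC mulrDl !normrM.
by rewrite lerD// ler_wpM2l.
Qed.

Lemma perturbed_normD x k1 k0 (delta : R) tau T : 0 < delta -> C1_on a b x ->
  continuous k1 -> continuous k0 ->
  exists2 d : R, 0 < d & forall e1 e2, `|e1| <= d -> `|e2| <= d ->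
    normD a b alpha beta gam (perturbed x k1 k0 e1 e2 \- x) (T + e1 * tau - T) < delta.
Proof.
move=> delta0 hx c1 c0; have [B B0 HB] := directions_bounded c1 c0.
(* Each of the two suprema costs at most [2 * B * d] and the time [d * |tau|]; the summand 1 keeps
   the denominator positive. *)
have K0 : 0 < 4 * B + `|tau| + 1 by rewrite ltr_wpDl// addr_ge0// mulr_ge0// ltW.
exists (delta / 2 / (4 * B + `|tau| + 1)) => [|e1 e2 e1d e2d].
  by rewrite !divr_gt0.
set d := delta / 2 / _ in e1d e2d *.
have dK : d * (4 * B + `|tau| + 1) = delta / 2 by rewrite /d divfK// gt_eqF.
have d0 : 0 <= d by exact: le_trans e1d.
(* The increment is a perturbation of the zero state, so [perturbed_caputo] computes its Caputo
   derivative as well. *)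
have h0 : C1_on a b (fun=> 0).
  have dz t : t \in `[a, b] -> derivable_in `[a, b] (fun=> 0 : R) t /\
      deriv_in `[a, b] (fun=> 0 : R) t = 0.
    by move=> tab; exact: (is_derive_deriv_in ab tab (is_derive_cst (0 : R) t 1)).
  split; first by move=> t /dz[].
  apply: (@eq_within_continuous _ _ _ (fun=> 0)); last by apply: continuous_subspaceT => s; exact: cvg_cst.
  by move=> t /dz[].
have diffE : perturbed x k1 k0 e1 e2 \- x = perturbed (fun=> 0) k1 k0 e1 e2.
  by apply/funext => t; rewrite /perturbed/=; ring.
have S1 : sup [set `|(perturbed x k1 k0 e1 e2 \- x) t| | t in `[a, b]] <= B * (`|e1| + `|e2|).
  apply: ge_sup; first by exists `|(perturbed x k1 k0 e1 e2 \- x) a|, a => //=; rewrite in_itv/= lexx.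
  move=> _ [t + <-]; rewrite /= in_itv/= => tab; have [H1 H2 _ _] := HB t tab.
  rewrite (_ : _ - _ = e1 * primitive a k1 t + e2 * primitive a k0 t); last by rewrite /perturbed; ring.
  exact: perturbation_le.
have S2 : sup [set `|caputo (perturbed x k1 k0 e1 e2 \- x) t| | t in `[a, b]] <= B * (`|e1| + `|e2|).
  apply: ge_sup; first by exists `|caputo (perturbed x k1 k0 e1 e2 \- x) a|, a => //=; rewrite in_itv/= lexx.
  move=> _ [t + <-]; rewrite /= in_itv/= => tab; have [_ _ H1 H2] := HB t tab.
  rewrite diffE; have [_ ->] := perturbed_caputo e1 e2 h0 c1 c0 tab.
  have -> : caputo (fun=> 0) t = 0.
    have hz : bounded_measurable 0 (fun=> 0 : R) by split => // s; rewrite normr0.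
    rewrite /caputo (combined_caputoE gam ab halpha hbeta hA hKalpha hKbeta hz tab).
      rewrite /kernel_integral -[RHS](@Rintegral_set0 _ _ _ mu (fun=> 0)).
      by apply/esym/eq_Rintegral_sub => // s _ _; rewrite mulr0.
    move=> s sab; have sab' : s \in `[a, b] by rewrite in_itv.
    exact: (is_derive_deriv_in ab sab' (is_derive_cst (0 : R) s 1)).2.
  by rewrite add0r; exact: perturbation_le.
rewrite /normD (_ : T + e1 * tau - T = e1 * tau) ?normrM; last by ring.
have et : `|e1| * `|tau| <= d * `|tau| by rewrite ler_wpM2r.
have eB : B * (`|e1| + `|e2|) <= B * (d + d) by rewrite ler_wpM2l ?(ltW B0)// lerD.
apply: le_lt_trans (lerD (lerD (le_trans S1 eB) (le_trans S2 eB)) et) _.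
have -> : B * (d + d) + B * (d + d) + d * `|tau| = delta / 2 - d by rewrite -dK; ring.
lra.
Qed.

End perturbations.

(** * Calculus of differentiability at the origin of the parameters *)

Section frechet_calculus.
Context {R : realType}.
Implicit Types (J : R -> R -> R) (P Q e : R).

Lemma frechet_at0D J1 J2 P1 P2 Q1 Q2 : frechet_at0 J1 P1 Q1 -> frechet_at0 J2 P2 Q2 ->
  frechet_at0 (fun e1 e2 => J1 e1 e2 + J2 e1 e2) (P1 + P2) (Q1 + Q2).
Proof.
move=> h1 h2 e e0; have e20 : 0 < e / 2 by rewrite divr_gt0.
have [d1 d10 H1] := h1 _ e20; have [d2 d20 H2] := h2 _ e20.
exists (Num.min d1 d2) => [|e1 e2]; first by rewrite lt_min d10.
rewrite !le_min => /andP[e11 e12] /andP[e21 e22].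
rewrite (_ : _ - _ = (J1 e1 e2 - J1 0 0 - (P1 * e1 + Q1 * e2)) +
  (J2 e1 e2 - J2 0 0 - (P2 * e1 + Q2 * e2))); last by ring.
rewrite (le_trans (ler_normD _ _))// (splitr e) mulrDl.
by rewrite lerD// ?H1 ?H2.
Qed.

Lemma frechet_at0N J P Q : frechet_at0 J P Q ->
  frechet_at0 (fun e1 e2 => - J e1 e2) (- P) (- Q).
Proof.
move=> h e e0; have [d d0 H] := h e e0; exists d => // e1 e2 e1d e2d.
rewrite (_ : _ - _ = - (J e1 e2 - J 0 0 - (P * e1 + Q * e2))); last by ring.
by rewrite normrN H.
Qed.

Lemma frechet_at0_continuous J P Q : frechet_at0 J P Q -> {for 0, continuous (J 0)}.
Proof.
move=> /(_ 1 ltr01)[d d0 H]; apply/cvgrPdist_le => e e0.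
have K0 : 0 < 1 + `|Q| by rewrite ltr_pwDl.
pose m : R := Num.min d (e / (1 + `|Q|)).
have m0 : 0 < m by rewrite lt_min d0 divr_gt0.
have Hm : \forall u \near (0 : R), `|u| <= m.
  by apply/nbhs_ballP; exists m => //= u; rewrite /ball/= sub0r normrN => /ltW.
near=> u.
have : `|u| <= m by near: u; exact: Hm.
rewrite le_min => /andP[ud ue].
have := H 0 u; rewrite normr0 (ltW d0) mulr0 add0r mul1r add0r => /(_ isT ud) h.
rewrite distrC -[J 0 u - J 0 0](subrK (Q * u)) (le_trans (ler_normD _ _))//.
rewrite (le_trans (lerD h (lexx _)))// normrM -[X in X + _]mul1r -mulrDl.
by rewrite mulrC -ler_pdivlMr.
Unshelve. all: by end_near. Qed.

End frechet_calculus.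

(** * Differentiability of integral functionals in the two parameters *)

Section functional_frechet.
Context {R : realType} (a b : R) (alpha beta : R -> R -> R) (gam : R * R) (A C : R).
Context (ab : a < b) (halpha : frac_order a b alpha) (hbeta : frac_order a b beta)
  (hA : 0 < A < 1) (hKalpha : weakly_singular A C (left_kernel a b alpha))
  (hKbeta : weakly_singular A C (left_kernel a b beta)).
Notation mu := (@lebesgue_measure R).
Implicit Types (s t T M e tau : R) (f k x psi : R -> R) (z : R -> R -> R -> R).

Let abW := ltW ab.
Let caputo := combined_caputo a b alpha beta gam.

Definition variation_along x T z k : R :=
  first_variation a b alpha beta gam T z (x \o clamp a b) (caputo x \o clamp a b) k.

Lemma C1_on_continuous x : C1_on a b x -> {within `[a, b], continuous x}.
Proof. by move=> [dx _]; exact: derivable_in_continuous. Qed.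

Lemma integral_frechet_at0 x T T0 z k1 k0 tau : inD a b alpha beta gam x T0 ->
  a < T < b -> C1_3 a b z -> continuous k1 -> continuous k0 ->
  frechet_at0 (fun e1 e2 => \int[mu]_(t in `[a, T + e1 * tau])
      along a b alpha beta gam (perturbed a x k1 k0 e1 e2) z t)
    (tau * along a b alpha beta gam x z T + variation_along x T z k1)
    (variation_along x T z k0).
Proof.
move=> [hx _ _ cV] /andP[aT Tb] hz c1 c0 e e0.
have Tab : a <= T <= b by rewrite !ltW.
have cU := C1_on_continuous hx.
pose U := x \o clamp a b; pose V := caputo x \o clamp a b.
have cUc : continuous U by exact: continuous_clamp abW cU.
have cVc : continuous V by exact: continuous_clamp abW cV.
have [B B0 HB] := directions_bounded gam ab hA hKalpha hKbeta c1 c0.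
pose D := direction a b alpha beta gam.
(* The end-time shift plus the size of the increments is at most [(1 + |tau| + B) * (|e1| + |e2|)],
   which fixes the tolerance given to [integral_frechet]. *)
have K0 : 0 < 1 + `|tau| + B by rewrite ltr_pwDr// addr_ge0.
have e'0 : 0 < e / (1 + `|tau| + B) by rewrite divr_gt0.
have [d d0 Hd] := integral_frechet ab Tab hz cUc cVc e'0.
pose m := Num.min d (Num.min (T - a) (b - T)).
have m0 : 0 < m by rewrite !lt_min d0 !subr_gt0 aT.
have [md [ma mb]] : m <= d /\ m <= T - a /\ m <= b - T by rewrite /m !ge_min !lexx !orbT.
(* Within this radius both [|e1 * tau|] and [B * (|e1| + |e2|)] are at most [m], so the moved time
   stays in [a, b]. *)
exists (m / (1 + `|tau| + 2 * B)) => [|e1 e2 e1d e2d].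
  by rewrite divr_gt0// ltr_pwDr// ?mulr_gt0// addr_ge0.
set c := m / _ in e1d e2d.
have c0' : 0 <= c by exact: le_trans e1d.
have K20 : 0 < 1 + `|tau| + 2 * B by rewrite ltr_pwDr// ?mulr_gt0// addr_ge0.
have cm : c * (1 + `|tau| + 2 * B) = m by rewrite /c divfK// gt_eqF.
have sm : `|e1 * tau| <= m.
  rewrite normrM -cm; apply: (@le_trans _ _ (c * `|tau|)); first by rewrite ler_wpM2r.
  by rewrite ler_wpM2l//; lra.
have rm : B * (`|e1| + `|e2|) <= m.
  rewrite -cm; apply: (@le_trans _ _ (B * (c + c))); first by rewrite ler_wpM2l ?(ltW B0)// lerD.
  rewrite (_ : B * (c + c) = c * (2 * B)); last by ring.
  by rewrite ler_wpM2l//; have := normr_ge0 tau; lra.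
have Tsab : a <= T + e1 * tau <= b.
  by move: sm; rewrite ler_norml => /andP[? ?]; apply/andP; split; lra.
pose du := (fun t => e1 * primitive a k1 t + e2 * primitive a k0 t) \o clamp a b.
pose dv := (fun t => e1 * D k1 t + e2 * D k0 t) \o clamp a b.
have cp1 := continuous_clamp abW (@primitive_continuous _ a b _ c1).
have cp0 := continuous_clamp abW (@primitive_continuous _ a b _ c0).
have cd1 := continuous_clamp abW (@direction_continuous _ a b alpha beta gam A C ab hA hKalpha hKbeta _ c1).
have cd0 := continuous_clamp abW (@direction_continuous _ a b alpha beta gam A C ab hA hKalpha hKbeta _ c0).
have cdu : continuous du.
  by move=> t; apply: cvgD; apply: cvgM; [exact: cvg_cst|exact: cp1|exact: cvg_cst|exact: cp0].
have cdv : continuous dv.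
  by move=> t; apply: cvgD; apply: cvgM; [exact: cvg_cst|exact: cd1|exact: cvg_cst|exact: cd0].
have Hr t : a <= t <= b -> `|du t| <= B * (`|e1| + `|e2|) /\ `|dv t| <= B * (`|e1| + `|e2|).
  move=> tab; have [H1 H2 H3 H4] := HB t tab.
  by rewrite /du /dv/= clamp_id//; split; exact: perturbation_le.
have := Hd (e1 * tau) (B * (`|e1| + `|e2|)) du dv cdu cdv Hr (le_trans sm md) (le_trans rm md) Tsab.
have alongE t : a <= t <= b -> along a b alpha beta gam (perturbed a x k1 k0 e1 e2) z t =
    z t (U t + du t) (V t + dv t).
  move=> tab; rewrite /along (perturbed_caputo gam ab halpha hbeta hA hKalpha hKbeta e1 e2 hx c1 c0 tab).2.
  by rewrite /U /V /du /dv /perturbed/= clamp_id// !addrA.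
have alongE0 t : a <= t <= b -> along a b alpha beta gam x z t = z t (U t) (V t).
  by move=> tab; rewrite /along /U /V/= clamp_id.
have -> : \int[mu]_(t in `[a, T + e1 * tau]) z t (U t + du t) (V t + dv t) =
    \int[mu]_(t in `[a, T + e1 * tau]) along a b alpha beta gam (perturbed a x k1 k0 e1 e2) z t.
  apply: eq_Rintegral => t; rewrite inE/= in_itv/= => /andP[a_t tT].
  by rewrite alongE// a_t (le_trans tT)//; case/andP: Tsab.
have -> : \int[mu]_(t in `[a, T]) z t (U t) (V t) =
    \int[mu]_(t in `[a, T + 0 * tau]) along a b alpha beta gam (perturbed a x k1 k0 0 0) z t.
  rewrite mul0r addr0; apply: eq_Rintegral => t; rewrite inE/= in_itv/= => /andP[a_t tT].
  have -> : perturbed a x k1 k0 0 0 = x by apply/funext => s; rewrite /perturbed; ring.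
  by rewrite alongE0// a_t (le_trans tT)// ltW.
rewrite -alongE0//.
have -> : \int[mu]_(t in `[a, T]) (partial2 z t (U t) (V t) * du t + partial3 z t (U t) (V t) * dv t) =
    e1 * variation_along x T z k1 + e2 * variation_along x T z k0.
  pose g k t := partial2 z (clamp a b t) (U t) (V t) * primitive a k (clamp a b t) +
    partial3 z (clamp a b t) (U t) (V t) * D k (clamp a b t).
  have [_ _ cz2 cz3] := hz.
  have cp2 := continuous_nemytskii (continuous_clamp3 abW cz2) cUc cVc.
  have cp3 := continuous_nemytskii (continuous_clamp3 abW cz3) cUc cVc.
  have ig1 : mu.-integrable `[a, T] (EFin \o g k1).
    apply: continuous_integrable_itv => t; apply: cvgD; apply: cvgM;
      [exact: cp2|exact: cp1|exact: cp3|exact: cd1].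
  have ig0 : mu.-integrable `[a, T] (EFin \o g k0).
    apply: continuous_integrable_itv => t; apply: cvgD; apply: cvgM;
      [exact: cp2|exact: cp0|exact: cp3|exact: cd0].
  have vE k : variation_along x T z k = \int[mu]_(t in `[a, T]) g k t.
    apply: eq_Rintegral => t; rewrite inE/= in_itv/= => /andP[a_t tT].
    have ct : clamp a b t = t by rewrite clamp_id// a_t (le_trans tT)// ltW.
    by rewrite /g /U /V /= !ct.
  rewrite !vE -!RintegralZl//.
  have ig1' := integrable_realZ e1 ig1 (measurable_itv _).
  have ig0' := integrable_realZ e2 ig0 (measurable_itv _).
  rewrite -RintegralD//; apply: eq_Rintegral => t; rewrite inE/= in_itv/= => /andP[a_t tT].
  have tab : a <= t <= b by rewrite a_t (le_trans tT)// ltW.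
  have ct : clamp a b t = t by exact: clamp_id.
  have Edu : du t = e1 * primitive a k1 t + e2 * primitive a k0 t by rewrite /du/= ct.
  have Edv : dv t = e1 * D k1 t + e2 * D k0 t by rewrite /dv/= ct.
  rewrite /g Edu Edv ct.
  move: (D k1 t) (D k0 t) => p q; ring.
set LHS := (X in `|X| <= _) => H.
have -> : \int[mu]_(t in `[a, T + e1 * tau]) along a b alpha beta gam (perturbed a x k1 k0 e1 e2) z t -
    \int[mu]_(t in `[a, T + 0 * tau]) along a b alpha beta gam (perturbed a x k1 k0 0 0) z t -
    ((tau * along a b alpha beta gam x z T + variation_along x T z k1) * e1 +
       variation_along x T z k0 * e2) = LHS.
  rewrite /LHS; move: (Rintegral _ _ _) (Rintegral _ _ _) => p q.
  move: (along _ _ _ _ _ _ _ _) (variation_along _ _ _ k1) (variation_along _ _ _ k0) => u v w.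
  by congr (_ - _); ring.
apply: (le_trans H); rewrite normrM.
apply: (@le_trans _ _ (e / (1 + `|tau| + B) * ((1 + `|tau| + B) * (`|e1| + `|e2|)))).
  rewrite ler_wpM2l ?(ltW e'0)// mulrDl lerD2r.
  rewrite mulrDl mul1r mulrDr; have := normr_ge0 tau; have := normr_ge0 e1; have := normr_ge0 e2.
  by move=> *; rewrite (mulrC `|e1|); nra.
by rewrite mulrA divfK// gt_eqF.
Qed.

End functional_frechet.

(** * Terminal cost, constraint level and combined integrand *)

Section extremal_conditions.
Context {R : realType} (a b : R) (alpha beta : R -> R -> R) (gam : R * R) (A C : R).
Context (ab : a < b) (halpha : frac_order a b alpha) (hbeta : frac_order a b beta)
  (hA : 0 < A < 1) (hKalpha : weakly_singular A C (left_kernel a b alpha))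
  (hKbeta : weakly_singular A C (left_kernel a b beta)).
Notation mu := (@lebesgue_measure R).
Implicit Types (s t T M e tau l : R) (f k x psi : R -> R) (z L g : R -> R -> R -> R).

Let abW := ltW ab.

Lemma Rintegral_0 (D : set R) f : (forall s, D s -> f s = 0) -> \int[mu]_(s in D) f s = 0.
Proof.
move=> f0; rewrite -[RHS](@Rintegral_set0 _ _ _ mu (fun=> 0)).
by apply/esym/eq_Rintegral_sub => // s /f0.
Qed.

(** [C1_2_expansion] involves the increment of the state at the moved time, the derivative the one
    at [T]. By continuity of the primitives at [T] the difference is of smaller order than the
    parameters. *)
Lemma terminal_cost_frechet_at0 phi x T k1 k0 tau : C1_2 a b phi -> C1_on a b x ->
  a < T < b -> continuous k1 -> continuous k0 ->
  frechet_at0 (fun e1 e2 => phi (T + e1 * tau) (perturbed a x k1 k0 e1 e2 (T + e1 * tau)))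
    ((dphi1 a b phi T (x T) + dphi2 phi T (x T) * deriv_in `[a, b] x T) * tau +
      dphi2 phi T (x T) * primitive a k1 T)
    (dphi2 phi T (x T) * primitive a k0 T).
Proof.
move=> hphi [dx _] aTb c1 c0 e e0; have /andP[aT Tb] := aTb.
have Tab : T \in `[a, b] by rewrite in_itv/= !ltW.
have cp1 := continuous_clamp abW (@primitive_continuous _ a b _ c1).
have cp0 := continuous_clamp abW (@primitive_continuous _ a b _ c0).
pose p1 := primitive a k1 \o clamp a b; pose p0 := primitive a k0 \o clamp a b.
have [B1 B10 H1] := compact_norm_bounded (@segment_compact R a b) (@primitive_continuous _ a b _ c1).
have [B2 B20 H2] := compact_norm_bounded (@segment_compact R a b) (@primitive_continuous _ a b _ c0).
pose B := B1 + B2; have B0 : 0 < B by exact: addr_gt0.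
pose q := dphi2 phi T (x T).
have K0 : 0 < 2 * (`|tau| + B + 1) by rewrite mulr_gt0// ltr_pwDr// addr_ge0// ltW.
have [d1 d10 Hd1] := C1_2_expansion aTb hphi (dx T Tab) (divr_gt0 e0 K0).
have Q0 : 0 < 2 * (`|q| + 1) by rewrite mulr_gt0// ltr_pwDr.
have eQ : 0 < e / (2 * (`|q| + 1)) by rewrite divr_gt0.
have [d2 d20 Hd2] : exists2 d, 0 < d & forall s, `|s - T| <= d ->
    `|p1 s - p1 T| <= e / (2 * (`|q| + 1)) /\ `|p0 s - p0 T| <= e / (2 * (`|q| + 1)).
  have /cvgrPdist_le/(_ _ eQ)/nbhs_ballP[d3 /= d30 Hd3] := cp1 T.
  have /cvgrPdist_le/(_ _ eQ)/nbhs_ballP[d4 /= d40 Hd4] := cp0 T.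
  exists (Num.min d3 d4 / 2) => [|s sT]; first by rewrite divr_gt0// lt_min d30.
  have sm : `|T - s| < Num.min d3 d4.
    by rewrite distrC (le_lt_trans sT)// ltr_pdivrMr// ltr_pMr ?ltr1n// lt_min d30.
  move: sm; rewrite lt_min => /andP[s3 s4].
  by split; rewrite distrC; [exact: Hd3|exact: Hd4].
pose m := Num.min (Num.min d1 d2) (Num.min (T - a) (b - T)).
have m0 : 0 < m by rewrite !lt_min d10 d20 !subr_gt0 aT.
have [[md1 md2] [ma mb]] : (m <= d1 /\ m <= d2) /\ m <= T - a /\ m <= b - T.
  by rewrite /m !ge_min !lexx !orbT.
have K20 : 0 < 1 + `|tau| + 2 * B by rewrite ltr_pwDr// ?mulr_gt0// addr_ge0.
exists (m / (1 + `|tau| + 2 * B)) => [|e1 e2 e1d e2d]; first by rewrite divr_gt0.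
set c := m / _ in e1d e2d.
have c0' : 0 <= c by exact: le_trans e1d.
have cm : c * (1 + `|tau| + 2 * B) = m by rewrite /c divfK// gt_eqF.
have sm : `|e1 * tau| <= m.
  rewrite normrM -cm; apply: (@le_trans _ _ (c * `|tau|)); first by rewrite ler_wpM2r.
  by rewrite ler_wpM2l//; lra.
have Tsab : a <= T + e1 * tau <= b.
  by move: sm; rewrite ler_norml => /andP[? ?]; apply/andP; split; lra.
pose dd := e1 * p1 (T + e1 * tau) + e2 * p0 (T + e1 * tau).
have tK : `[a, b]%classic (T + e1 * tau) by rewrite /= in_itv.
have h1 : `|p1 (T + e1 * tau)| <= B.
  by rewrite /p1/= clamp_id// (le_trans (H1 _ tK))// /B lerDl ltW.
have h2 : `|p0 (T + e1 * tau)| <= B.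
  by rewrite /p0/= clamp_id// (le_trans (H2 _ tK))// /B lerDr ltW.
have ddB : `|dd| <= B * (`|e1| + `|e2|) by exact: perturbation_le.
have ddm : `|dd| <= m.
  apply: (le_trans ddB); rewrite -cm; apply: (@le_trans _ _ (B * (c + c))).
    by rewrite ler_wpM2l ?(ltW B0)// lerD.
  rewrite (_ : B * (c + c) = c * (2 * B)); last by ring.
  by rewrite ler_wpM2l//; have := normr_ge0 tau; lra.
have := Hd1 (e1 * tau) dd (le_trans sm md1) (le_trans ddm md1).
have -> : x (T + e1 * tau) + dd = perturbed a x k1 k0 e1 e2 (T + e1 * tau).
  by rewrite /dd /p1 /p0 /perturbed/= clamp_id// addrA.
have -> : phi T (x T) = phi (T + 0 * tau) (perturbed a x k1 k0 0 0 (T + 0 * tau)).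
  by rewrite /perturbed !mul0r !addr0.
rewrite -/q => H.
have sd2 : `|T + e1 * tau - T| <= d2 by rewrite addrAC subrr add0r (le_trans sm).
have [hp1 hp0] := Hd2 _ sd2.
have p1T : p1 T = primitive a k1 T by rewrite /p1/= clamp_id// !ltW.
have p0T : p0 T = primitive a k0 T by rewrite /p0/= clamp_id// !ltW.
have Hq : `|q * (e1 * (p1 (T + e1 * tau) - p1 T) + e2 * (p0 (T + e1 * tau) - p0 T))| <=
    e / 2 * (`|e1| + `|e2|).
  rewrite normrM; apply: le_trans (ler_wpM2l (normr_ge0 q) (perturbation_le e1 e2 hp1 hp0)) _.
  rewrite mulrA ler_wpM2r ?addr_ge0//.
  have -> : `|q| * (e / (2 * (`|q| + 1))) = e / 2 * (`|q| / (`|q| + 1)).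
    by field; rewrite gt_eqF// ltr_pwDr.
  rewrite ler_piMr ?divr_ge0 ?(ltW e0)// ler_pdivrMr ?ltr_pwDr//.
  by rewrite mul1r lerDl.
have He : e / (2 * (`|tau| + B + 1)) * (`|e1 * tau| + `|dd|) <= e / 2 * (`|e1| + `|e2|).
  apply: (@le_trans _ _ (e / (2 * (`|tau| + B + 1)) * ((`|tau| + B + 1) * (`|e1| + `|e2|)))).
    rewrite ler_wpM2l ?divr_ge0 ?(ltW e0) ?(ltW K0)//.
    apply: le_trans (lerD (lexx _) ddB) _; rewrite normrM.
    rewrite -subr_ge0 (_ : _ - _ = `|tau| * `|e2| + (`|e1| + `|e2|)); last by ring.
    by rewrite !addr_ge0// mulr_ge0.
  rewrite mulrA le_eqVlt; apply/orP; left; apply/eqP; field.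
  by rewrite gt_eqF// ltr_pwDr// addr_ge0// ltW.
set LHS := (X in `|X| <= _) in H.
have -> : phi (T + e1 * tau) (perturbed a x k1 k0 e1 e2 (T + e1 * tau)) -
    phi (T + 0 * tau) (perturbed a x k1 k0 0 0 (T + 0 * tau)) -
   (((dphi1 a b phi T (x T) + q * deriv_in `[a, b] x T) * tau + q * primitive a k1 T) * e1 +
    q * primitive a k0 T * e2) =
   LHS + q * (e1 * (p1 (T + e1 * tau) - p1 T) + e2 * (p0 (T + e1 * tau) - p0 T)).
  rewrite /LHS /dd p1T p0T; ring.
apply: (le_trans (ler_normD _ _)); rewrite (splitr e) mulrDl lerD//.
exact: le_trans H He.
Qed.

Lemma constraint_level_frechet_at0 psi T tau : a < T < b -> derivable_in `[a, b] psi T ->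
  frechet_at0 (fun e1 _ => psi (T + e1 * tau)) (deriv_in `[a, b] psi T * tau) 0.
Proof.
move=> /andP[aT Tb] dpsi e e0.
have K0 : 0 < `|tau| + 1 by rewrite ltr_pwDr.
have [d d0 Hd] := derivable_in_expansion dpsi (divr_gt0 e0 K0).
pose m := Num.min d (Num.min (T - a) (b - T)).
have m0 : 0 < m by rewrite !lt_min d0 !subr_gt0 aT.
have [md [ma mb]] : m <= d /\ m <= T - a /\ m <= b - T by rewrite /m !ge_min !lexx !orbT.
exists (m / (`|tau| + 1)) => [|e1 e2 e1d _]; first by rewrite divr_gt0.
have sm : `|e1 * tau| <= m.
  rewrite normrM; apply: (@le_trans _ _ (m / (`|tau| + 1) * (`|tau| + 1))); last by rewrite divfK// gt_eqF.
  by rewrite ler_pM// lerDl.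
have Tsab : `[a, b]%classic (T + e1 * tau).
  by move: sm; rewrite /= in_itv/= ler_norml => /andP[? ?]; apply/andP; split; lra.
have := Hd _ Tsab; rewrite (addrC T) addrK addrC => /(_ (le_trans sm md)) H.
rewrite !mul0r !addr0 -[deriv_in _ _ _ * tau * e1]mulrA (mulrC tau).
apply: (le_trans H); rewrite normrM.
apply: (@le_trans _ _ (e / (`|tau| + 1) * (`|e1| * (`|tau| + 1)))).
  by rewrite !ler_wpM2l ?lerDl// divr_ge0 ?(ltW e0) ?(ltW K0).
have -> : e / (`|tau| + 1) * (`|e1| * (`|tau| + 1)) = e * `|e1|.
  by field; rewrite gt_eqF.
by rewrite ler_wpM2l ?(ltW e0)// lerDl.
Qed.

Lemma C1_3_comb L g l : C1_3 a b L -> C1_3 a b g ->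
  let F := fun t u v => L t u v - l * g t u v in
  [/\ C1_3 a b F,
    forall t u v, a <= t <= b -> partial2 F t u v = partial2 L t u v - l * partial2 g t u v &
    forall t u v, a <= t <= b -> partial3 F t u v = partial3 L t u v - l * partial3 g t u v].
Proof.
move=> hL hg F; have [dL c1L c2L c3L] := hL; have [dg c1g c2g c3g] := hg.
have d2 t (u v : R) : a <= t <= b ->
    is_derive u 1 (fun w : R => F t w v) (partial2 L t u v - l * partial2 g t u v).
  move=> tab; have dL2 := C1_3_is_derive2 u v hL tab; have dg2 := C1_3_is_derive2 u v hg tab.
  exact: (@is_deriveB _ _ _ _ _ u 1 _ _ dL2 (is_deriveZ l dg2)).
have d3 t (u v : R) : a <= t <= b ->
    is_derive v 1 (fun w : R => F t u w) (partial3 L t u v - l * partial3 g t u v).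
  move=> tab; have dL3 := C1_3_is_derive3 u v hL tab; have dg3 := C1_3_is_derive3 u v hg tab.
  exact: (@is_deriveB _ _ _ _ _ v 1 _ _ dL3 (is_deriveZ l dg3)).
have p2 t (u v : R) : a <= t <= b -> partial2 F t u v = partial2 L t u v - l * partial2 g t u v.
  by move=> tab; rewrite {1}/partial2 derive1E; have [_ ->] := d2 t u v tab.
have p3 t (u v : R) : a <= t <= b -> partial3 F t u v = partial3 L t u v - l * partial3 g t u v.
  by move=> tab; rewrite {1}/partial3 derive1E; have [_ ->] := d3 t u v tab.
have d1 t (u v : R) : t \in `[a, b] -> derivable_in `[a, b] (fun s => F s u v) t /\
    partial1 a b F t u v = partial1 a b L t u v - l * partial1 a b g t u v.
  move=> tab; have [dL1 _ _] := dL t u v tab; have [dg1 _ _] := dg t u v tab.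
  have [D E] := deriv_in_comb 1 (- l) ab tab dL1 dg1.
  rewrite /partial1 (_ : (fun s => F s u v) = fun s => 1 * L s u v + - l * g s u v); last first.
    by apply/funext => s; rewrite /F; ring.
  by split => //; rewrite E; ring.
have comb (pL pg : R -> R -> R -> R) (pF : R -> R -> R -> R) :
    let dom := [set w : R * R * R | w.1.1 \in `[a, b]] in
    (forall t u v, t \in `[a, b] -> pF t u v = pL t u v - l * pg t u v) ->
    {within dom, continuous (fun w : R * R * R => pL w.1.1 w.1.2 w.2)} ->
    {within dom, continuous (fun w : R * R * R => pg w.1.1 w.1.2 w.2)} ->
    {within dom, continuous (fun w : R * R * R => pF w.1.1 w.1.2 w.2)}.
  move=> dom pE cL cg.
  apply: (@eq_within_continuous _ _ _ (fun w : R * R * R => pL w.1.1 w.1.2 w.2 - l * pg w.1.1 w.1.2 w.2)).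
    by move=> w wd; rewrite pE.
  apply: within_continuousB => // w; apply: cvgM; [exact: cvg_cst|exact: cg].
split; [split|exact: p2|exact: p3].
- move=> t u v tab; have tab' : a <= t <= b by move: tab; rewrite in_itv.
  by split; [exact: (d1 t u v tab).1|have [] := d2 t u v tab'|have [] := d3 t u v tab'].
- by apply: comb c1L c1g => t u v tab; exact: (d1 t u v tab).2.
- by apply: comb c2L c2g => t u v; rewrite in_itv; exact: p2.
- by apply: comb c3L c3g => t u v; rewrite in_itv; exact: p3.
Qed.

End extremal_conditions.

(** * The multiplier along admissible perturbations *)

Section extremals.
Context {R : realType} (a b : R) (alpha beta : R -> R -> R) (gam : R * R) (A C : R).
Context (ab : a < b) (halpha : frac_order a b alpha) (hbeta : frac_order a b beta)
  (hA : 0 < A < 1) (hKalpha : weakly_singular A C (left_kernel a b alpha))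
  (hKbeta : weakly_singular A C (left_kernel a b beta)).
Notation mu := (@lebesgue_measure R).
Implicit Types (s t T M e tau l : R) (f k x psi : R -> R) (z L g : R -> R -> R -> R).

Let abW := ltW ab.
Let caputo := combined_caputo a b alpha beta gam.
Let along := along a b alpha beta gam.
Let variation := variation_along a b alpha beta gam.

Lemma variation_along_comb x T0 T L g l k : inD a b alpha beta gam x T0 -> a < T < b ->
  C1_3 a b L -> C1_3 a b g -> continuous k ->
  variation x T (fun t u v => L t u v - l * g t u v) k =
  variation x T L k - l * variation x T g k.
Proof.
move=> [hx _ _ cV] /andP[aT Tb] hL hg ck.
have cUc : continuous (x \o clamp a b) := continuous_clamp abW (C1_on_continuous hx).
have cVc : continuous (caputo x \o clamp a b) := continuous_clamp abW cV.
have cp := continuous_clamp abW (@primitive_continuous _ a b _ ck).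
have cd := continuous_clamp abW (@direction_continuous _ a b alpha beta gam A C ab hA hKalpha hKbeta _ ck).
pose D := direction a b alpha beta gam.
pose q z t := partial2 z (clamp a b t) (x (clamp a b t)) (caputo x (clamp a b t)) *
    primitive a k (clamp a b t) +
  partial3 z (clamp a b t) (x (clamp a b t)) (caputo x (clamp a b t)) * D k (clamp a b t).
have ct t : t \in `[a, T] -> clamp a b t = t.
  by rewrite in_itv/= => /andP[a_t tT]; rewrite clamp_id// a_t (le_trans tT)// ltW.
have qi z : C1_3 a b z -> mu.-integrable `[a, T] (EFin \o q z).
  move=> [_ _ cz2 cz3].
  have cp2 := continuous_nemytskii (continuous_clamp3 abW cz2) cUc cVc.
  have cp3 := continuous_nemytskii (continuous_clamp3 abW cz3) cUc cVc.
  apply: continuous_integrable_itv => t; apply: cvgD; apply: cvgM;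
    [exact: cp2|exact: cp|exact: cp3|exact: cd].
have vE z : variation x T z k = \int[mu]_(t in `[a, T]) q z t.
  apply: eq_Rintegral => t; rewrite inE => /ct tE.
  by rewrite /q /= !tE.
have [_ p2 p3] := C1_3_comb ab l hL hg.
rewrite !vE -RintegralZl; [|exact: measurable_itv|exact: qi].
have iL := qi _ hL; have ig := integrable_realZ l (qi _ hg) (measurable_itv _).
rewrite -(@RintegralB _ (measurableTypeR R) _ mu _ _ _ (measurable_itv _) iL ig).
apply: eq_Rintegral => t _; rewrite /q p2 ?clamp_itv// p3 ?clamp_itv//.
move: (D k _) => d; ring.
Qed.

Lemma variation_along0 x T z : variation x T z (fun=> 0) = 0.
Proof.
apply: Rintegral_0 => t _; rewrite /primitive /kernel_integral !Rintegral_0 ?subrr ?mulr0 ?addr0//.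
by move=> s _; rewrite /= mulr0.
Qed.

(** [multiplier_rule] asks for continuity at all small parameters, while differentiability is known
    at the origin. The perturbed state with its own end time is taken as a new origin, with time
    direction 0, and [frechet_at0_continuous] applies there. *)
Lemma constraint_continuous x T0 T z c k1 k0 tau : inD a b alpha beta gam x T0 ->
  a < T < b -> C1_3 a b z -> continuous k1 -> continuous k0 ->
  exists2 d : R, 0 < d & forall e1 e2, `|e1| <= d -> `|e2| <= d ->
    {for e2, continuous (fun e2 =>
      \int[mu]_(t in `[a, T + e1 * tau]) along (perturbed a x k1 k0 e1 e2) z t - c e1)}.
Proof.
move=> hD /andP[aT Tb] hz c1 c0.
pose m := Num.min (T - a) (b - T).
have m0 : 0 < m by rewrite lt_min !subr_gt0 aT.
have [ma mb] : m <= T - a /\ m <= b - T by rewrite /m !ge_min !lexx !orbT.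
have K0 : 0 < `|tau| + 1 by rewrite ltr_pwDr.
exists (m / 2 / (`|tau| + 1)) => [|e1 e2 e1d _]; first by rewrite !divr_gt0.
have sm : `|e1 * tau| <= m / 2.
  rewrite normrM; apply: (@le_trans _ _ (m / 2 / (`|tau| + 1) * (`|tau| + 1))); last by rewrite divfK// gt_eqF.
  by rewrite ler_pM// lerDl.
have Tsab : a < T + e1 * tau < b.
  by move: sm; rewrite ler_norml => /andP[? ?]; apply/andP; split; lra.
have Tsab' : a <= T + e1 * tau <= b by case/andP: Tsab => ? ?; rewrite !ltW.
have hD' := perturbed_inD ab halpha hbeta hA hKalpha hKbeta e1 e2 hD c1 c0 Tsab'.
have := integral_frechet_at0 ab halpha hbeta hA hKalpha hKbeta 0 hD' Tsab hz c1 c0.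
move=> /frechet_at0_continuous H.
pose h e := \int[mu]_(t in `[a, T + e1 * tau + 0 * 0]) along (perturbed a (perturbed a x k1 k0 e1 e2) k1 k0 0 e) z t.
have hE : (fun e => \int[mu]_(t in `[a, T + e1 * tau]) along (perturbed a x k1 k0 e1 e) z t - c e1) =
    fun e => h (e - e2) - c e1.
  apply/funext => e; rewrite /h mulr0 addr0 perturbed_rebase addr0 (addrC e2) subrK.
  by [].
rewrite hE; apply: cvgB; last exact: cvg_cst.
have ch : h e @[e --> 0] --> h 0 by exact: H.
have sh : (e - e2) @[e --> e2] --> (0 : R).
  by rewrite -(subrr e2); apply: cvgB; [exact: cvg_id|exact: cvg_cst].
rewrite subrr; exact: cvg_comp sh ch.
Qed.

Section extremal.
Context (L g : R -> R -> R -> R) (phi : R -> R -> R) (psi : R -> R) (xa : R) (x : R -> R) (T : R).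
Context (hL : C1_3 a b L) (hg : C1_3 a b g) (hphi : C1_2 a b phi)
  (hpsi : derivable_in `[a, b] psi T) (aTb : a < T < b)
  (hmin : local_min a b alpha beta gam L phi g psi xa x T).

Let hD : inD a b alpha beta gam x T. Proof. by have [[]] := hmin. Qed.
Let q1 := dphi1 a b phi T (x T).
Let q2 := dphi2 phi T (x T).

(** With [k0] spent on restoring the constraint, [tau] and [k1] are free. The identity is
    [P - Q / B * A = 0] from [multiplier_rule], sorted into its part in [tau] and its part in
    [k1]. *)
Lemma multiplier_along k0 : continuous k0 -> variation x T g k0 != 0 ->
  exists l : R, forall tau k1, continuous k1 ->
    tau * (along x L T - l * along x g T + q1 + q2 * deriv_in `[a, b] x T +
           l * deriv_in `[a, b] psi T) +
    (variation x T (fun t u v => L t u v - l * g t u v) k1 + q2 * primitive a k1 T) = 0.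
Proof.
move=> c0 B0; pose Q := variation x T L k0 + q2 * primitive a k0 T.
exists (Q / variation x T g k0) => tau k1 c1.
have [[_ xxa Gx] [delta delta0 Hmin]] := hmin; have [hx _ _ _] := hD.
have /andP[aT Tb] := aTb.
pose J e1 e2 := functional a b alpha beta gam L phi (perturbed a x k1 k0 e1 e2) (T + e1 * tau).
pose G e1 e2 := \int[mu]_(t in `[a, T + e1 * tau]) along (perturbed a x k1 k0 e1 e2) g t -
   psi (T + e1 * tau).
have p0 : perturbed a x k1 k0 0 0 = x by apply/funext => s; rewrite /perturbed; ring.
have fJ := frechet_at0D (integral_frechet_at0 ab halpha hbeta hA hKalpha hKbeta tau hD aTb hL c1 c0)
  (terminal_cost_frechet_at0 ab tau hphi hx aTb c1 c0).
have fG := frechet_at0D (integral_frechet_at0 ab halpha hbeta hA hKalpha hKbeta tau hD aTb hg c1 c0)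
  (frechet_at0N (constraint_level_frechet_at0 tau aTb hpsi)).
rewrite oppr0 addr0 in fG.
have G0 : G 0 0 = 0 by rewrite /G p0 mul0r addr0 /along Gx subrr.
have cG := constraint_continuous (fun e1 => psi (T + e1 * tau)) tau hD aTb hg c1 c0.
have mJ : exists2 d : R, 0 < d & forall e1 e2, `|e1| <= d -> `|e2| <= d ->
    G e1 e2 = 0 -> J 0 0 <= J e1 e2.
  have [d d0 Hd] := perturbed_normD gam ab halpha hbeta hA hKalpha hKbeta tau T delta0 hx c1 c0.
  pose m := Num.min (T - a) (b - T).
  have m0 : 0 < m by rewrite lt_min !subr_gt0 aT.
  have [ma mb] : m <= T - a /\ m <= b - T by rewrite /m !ge_min !lexx !orbT.
  have K0 : 0 < `|tau| + 1 by rewrite ltr_pwDr.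
  exists (Num.min d (m / (`|tau| + 1))) => [|e1 e2]; first by rewrite lt_min d0 divr_gt0.
  rewrite !le_min => /andP[e1d e1m] /andP[e2d _] Ge.
  have sm : `|e1 * tau| <= m.
    rewrite normrM; apply: (@le_trans _ _ (m / (`|tau| + 1) * (`|tau| + 1))); last by rewrite divfK// gt_eqF.
    by rewrite ler_pM// lerDl.
  have Tsab : a <= T + e1 * tau <= b.
    by move: sm; rewrite ler_norml => /andP[? ?]; apply/andP; split; lra.
  rewrite /J p0 mul0r addr0; apply: Hmin; last exact: Hd.
  split.
  - exact: (perturbed_inD ab halpha hbeta hA hKalpha hKbeta e1 e2 hD c1 c0 Tsab).
  - by rewrite /perturbed !primitive_id !mulr0 !addr0.
  - by move/eqP: Ge; rewrite subr_eq0 => /eqP.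
have := multiplier_rule G0 B0 fJ fG cG mJ.
rewrite (variation_along_comb _ hD aTb hL hg c1) -/variation -/along -/q1 -/q2 -/Q.
move: (Q / variation x T g k0) (variation x T L k1) (variation x T g k1) => l vL vg <-.
by ring.
Qed.

End extremal.
End extremals.

Theorem theorem3p2 (R : realType) (a b : R) (hab : a < b)
  (alpha beta : R -> R -> R)
  (halpha : frac_order a b alpha) (hbeta : frac_order a b beta)
  (gam : R * R) (hgam1 : 0 <= gam.1 <= 1) (hgam2 : 0 <= gam.2 <= 1)
  (L g : R -> R -> R -> R) (hL : C1_3 a b L) (hg : C1_3 a b g)
  (phi : R -> R -> R) (hphi : C1_2 a b phi)
  (psi : R -> R) (hpsi : forall t, t \in `[a, b] -> derivable_in `[a, b] psi t)
  (xa : R) (x : R -> R) (T : R) (hT : a < T < b)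
  (hmin : local_min a b alpha beta gam L phi g psi xa x T)
  (hnormal : ~ EL_left a b alpha beta gam x T g \/
             ~ EL_right a b alpha beta gam x T g) :
  exists lambda : R,
    let F := fun t u v => L t u v - lambda * g t u v in
    let y := along a b alpha beta gam x (partial3 F) in
    [/\ EL_left a b alpha beta gam x T F,
        EL_right a b alpha beta gam x T F,
        along a b alpha beta gam x F T + dphi1 a b phi T (x T) +
          dphi2 phi T (x T) * deriv_in `[a, b] x T +
          lambda * deriv_in `[a, b] psi T = 0,
        gam.1 * RL_right_int (compl_order alpha) T y T -
          gam.2 * RL_left_int (compl_order beta) T y T +
          dphi2 phi T (x T) = 0 &
        gam.2 * (RL_left_int (compl_order beta) T y b -
                 RL_left_int (compl_order beta) a y b) = 0].
Proof.
have abW := ltW hab; have /andP[aT Tb] := hT.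
have [A1 /andP[A10 A11] H1] := frac_order_sup abW halpha.
have [A2 /andP[_ A21] H2] := frac_order_sup abW hbeta.
pose A := Num.max A1 A2.
have hA : 0 < A < 1 by rewrite lt_max A10 gt_max A11.
have hKa : weakly_singular A (expR 1) (left_kernel a b alpha).
  by apply: weakly_singular_left_kernel => // [t s|]; [rewrite le_max H1|case/andP: hA].
have hKb : weakly_singular A (expR 1) (left_kernel a b beta).
  by apply: weakly_singular_left_kernel => // [t s|]; [rewrite le_max H2 orbT|case/andP: hA].
have [[hD _ _] _] := hmin; have [hx _ _ cV] := hD.
have cU : {within `[a, b], continuous (x \o clamp a b)}.
  exact: continuous_subspaceT (continuous_clamp abW (C1_on_continuous hx)).
have cV' : {within `[a, b], continuous (combined_caputo a b alpha beta gam x \o clamp a b)}.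
  exact: continuous_subspaceT (continuous_clamp abW cV).
have xU s : a <= s <= b -> x s = (x \o clamp a b) s by move=> sab; rewrite /= clamp_id.
have xV s : a <= s <= b -> combined_caputo a b alpha beta gam x s =
    (combined_caputo a b alpha beta gam x \o clamp a b) s.
  by move=> sab; rewrite /= clamp_id.
have [k0 c0 B0] : exists2 k0, continuous k0 & variation_along a b alpha beta gam x T g k0 != 0.
  apply: contrapT => N.
  have [] := @first_variation_eq0 _ a b alpha beta gam A (expR 1) T hab hA hKa hKb hT g hg _ _ cU cV' 0.
    move=> k ck; rewrite mul0r addr0; apply/eqP/negPn/negP => nz.
    by apply: N; exists k.
  move=> _ hEL; case: hnormal; apply.
    exact: (EL_left_of_EL_function hab halpha hbeta hA hKa hKb hT hg cU cV' hEL xU xV).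
  exact: (EL_right_of_EL_function hab hbeta hA hKa hKb hT hg cU cV' hEL xU xV).
have hpsiT : derivable_in `[a, b] psi T by apply: hpsi; rewrite in_itv/= !ltW.
have [l Hl] := multiplier_along hab halpha hbeta hA hKa hKb hL hg hphi hpsiT hT hmin c0 B0.
exists l => F y; have [hF _ _] := C1_3_comb hab l hL hg.
(* Time direction 0 isolates the weak equation, with [dphi2 phi T (x T)] as boundary coefficient. *)
have [q2 hEL] := @first_variation_eq0 _ a b alpha beta gam A (expR 1) T hab hA hKa hKb hT F hF _ _ cU cV'
  (dphi2 phi T (x T)) (fun k ck => etrans (esym (etrans (congr1 (fun r => r + _) (mul0r _)) (add0r _))) (Hl 0 k ck)).
split.
- exact: (EL_left_of_EL_function hab halpha hbeta hA hKa hKb hT hF cU cV' hEL xU xV).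
- exact: (EL_right_of_EL_function hab hbeta hA hKa hKb hT hF cU cV' hEL xU xV).
(* Time direction 1 with the zero test function isolates the condition at [T]; [q2] removes the
   terms in [dphi2] from both equations. *)
- have := Hl 1 (fun=> 0) (fun t => cvg_cst _).
  rewrite variation_along0 q2 !mul0r !addr0 mul1r => E; exact: E.
(* Both integrals run over the single point [T] and are 0, which leaves [q2]. *)
- by rewrite q2 /RL_right_int /RL_left_int set_itv1 !Rintegral_set1 !mulr0 subr0 addr0.
- exact: (transversality_b_of_EL_function hab hbeta hA hKa hKb hT hF cU cV' hEL xU xV).
Qed.
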